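(* Let $\gamma$ and $r$ be positive real numbers. Let $M=(M_j)_{j\ge 0}$ be a strongly regular sequence of real numbers. Let $d\ge 1$ be an integer and consider a polynomial $$\varphi(z,w)=w^d+a_1(z)w^{d-1}+\cdots+a_d(z)$$ with $a_j\in\mathcal{A}_M(S_{\gamma,r})$ for $j=1,\ldots,d$. If $h$ is an element of $\mathcal{A}^\infty(S_{\gamma,r})$ such that $\varphi(z,h(z))=0$ for all $z\in S_{\gamma,r}$, then $h$ belongs to $\mathcal{A}_M(S_{\gamma',r'})$ for any positive real numbers $\gamma'<\gamma$ and $r'<r$.
   Context: Let $\Sigma$ be the Riemann surface of the logarithm and $\operatorname{Arg}$ the principal value of the argument on $\Sigma$ (a real-valued function on all of $\Sigma$). For $\gamma>0$ and $0<r\le+\infty$, put $S_{\gamma,r}=\{z\in\Sigma : |\operatorname{Arg} z|<\gamma\frac{\pi}{2},\ |z|<r\}$ (for $\gamma<2$ this is an open sector in the complex plane). $\mathcal{A}^\infty(S_{\gamma,r})$ is the space of holomorphic functions on $S_{\gamma,r}$ that are bounded in $S_{\gamma,r}$, as well as each of their derivatives. $\mathcal{A}_M(S_{\gamma,r})$ is the subspace of those $f\in\mathcal{A}^\infty(S_{\gamma,r})$ for which there are constants $C,\sigma>0$ such that $|f^{(j)}(z)|\le C\sigma^j\,j!\,M_j$ for all integers $j\ge 0$ and all $z\in S_{\gamma,r}$. For a function $h$ on $S_{\gamma,r}$, ''$h$ belongs to $\mathcal{A}_M(S_{\gamma',r'})$'' means that its restriction to $S_{\gamma',r'}$ does. A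 sequence $M=(M_j)_{j\ge0}$ of real numbers is strongly regular if all of the following hold: (i) $M$ is increasing (wide sense, $M_j\le M_{j+1}$) with $M_0=1$; (ii) $M$ is logarithmically convex, i.e. $M_{j+1}/M_j$ is an increasing (wide sense) function of $j$; (iii) (moderate growth) $\sup_{j+k\ge 1}\left(\frac{M_{j+k}}{M_jM_k}\right)^{\frac{1}{j+k}}<\infty$; (iv) (strong non-quasianalyticity) $\sup_{k\in\mathbb{N}}\frac{M_{k+1}}{M_k}\sum_{j\ge k}\frac{M_j}{(j+1)M_{j+1}}<\infty$. *)

(* Defs.v *)
(* Stdlib real numbers with Coquelicot: [C] is Coquelicot's field of complex
   numbers. *)
From Stdlib Require Export Reals Factorial.
From Coquelicot Require Export Coquelicot.

Open Scope R_scope.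

(* A point z of the Riemann surface of the logarithm is encoded by the pair
   (|z|, Arg z), with |z| > 0 and Arg z ranging over all of R.  The surface is
   thus the open half-plane {0 < fst p} of R * R, with the product topology.
   Pairs with fst p <= 0 are junk and belong to no sector.  Functions on a
   sector are represented by total functions on R * R, whose values outside the
   sector are never used. *)
Notation logpoint := (R * R)%type (only parsing).

(* The covering map z |-> |z| e^{i Arg z} onto C \ {0}; being a local
   homeomorphism, it provides the complex structure of the surface. *)
Definition cover (p : logpoint) : C :=
  (fst p * cos (snd p), fst p * sin (snd p)).

Definition sector (gamma r : R) (p : logpoint) : Prop :=
  0 < fst p < r /\ Rabs (snd p) < gamma * (PI / 2).

(* f'(p) = l, as the limit of difference quotients in the coordinate [cover].
   The denominators do not vanish for q <> p close to p. *)
Definition is_derive_log (f : logpoint -> C) (p : logpoint) (l : C) : Prop :=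
  filterlim (fun q : logpoint => ((f q - f p) / (cover q - cover p))%C)
    (@locally' (prod_UniformSpace R_UniformSpace R_UniformSpace) p)
    (@locally C_UniformSpace l).

(* The domains S used below are sectors, which are open. *)
Definition holomorphic_on (S : logpoint -> Prop) (f : logpoint -> C) : Prop :=
  forall p, S p -> exists l, is_derive_log f p l.

(* g is the j-th complex derivative of f on the open set S; the values of g on
   S are determined by those of f. *)
Fixpoint is_derive_n_on (S : logpoint -> Prop) (f : logpoint -> C) (j : nat)
    (g : logpoint -> C) : Prop :=
  match j with
  | O => forall p, S p -> g p = f p
  | Datatypes.S i => exists f_i : logpoint -> C,
      is_derive_n_on S f i f_i /\ forall p, S p -> is_derive_log f_i p (g p)
  end.

(* The derivatives of all orders of a holomorphic function exist, so requiring
   their existence here is no restriction. *)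
Definition A_infty (S : logpoint -> Prop) (f : logpoint -> C) : Prop :=
  holomorphic_on S f /\
  forall j : nat, exists g : logpoint -> C,
    is_derive_n_on S f j g /\
    exists B : R, forall p, S p -> Cmod (g p) <= B.

Definition A_class (M : nat -> R) (S : logpoint -> Prop)
    (f : logpoint -> C) : Prop :=
  A_infty S f /\
  exists K sigma : R, 0 < K /\ 0 < sigma /\
    forall (j : nat) (g : logpoint -> C), is_derive_n_on S f j g ->
      forall p, S p -> Cmod (g p) <= K * sigma ^ j * INR (fact j) * M j.

Definition log_convex (M : nat -> R) : Prop :=
  forall j k : nat, (j <= k)%nat -> M (j + 1)%nat / M j <= M (k + 1)%nat / M k.

Definition moderate_growth (M : nat -> R) : Prop :=
  exists A : R, forall j k : nat, (1 <= j + k)%nat ->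
    Rpower (M (j + k)%nat / (M j * M k)) (1 / INR (j + k)) <= A.

(* The sum over j >= k is indexed by i = j - k. *)
Definition strong_non_quasianalyticity (M : nat -> R) : Prop :=
  exists A : R, forall k : nat,
    let u := fun i : nat =>
      M (k + i)%nat / (INR (k + i + 1) * M (k + i + 1)%nat) in
    ex_series u /\ M (k + 1)%nat / M k * Series u <= A.

Definition strongly_regular (M : nat -> R) : Prop :=
  (forall j : nat, M j <= M (j + 1)%nat) /\ M 0%nat = 1 /\
  log_convex M /\ moderate_growth M /\ strong_non_quasianalyticity M.

(* phi(z,w) = w^d + a_1(z) w^(d-1) + ... + a_d(z); only a_1, ..., a_d occur. *)
Definition monic_poly (d : nat) (a : nat -> logpoint -> C)
    (z : logpoint) (w : C) : C :=
  (w ^ d + sum_n_m (fun j : nat => a j z * w ^ (d - j)) 1 d)%C.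

(* Main.v *)
Require Import Defs.
From Stdlib Require Import Lra Lia Arith Classical ClassicalChoice.
From Stdlib Require Import FunctionalExtensionality Rtrigo_facts.

(** Write [z] for the variable, [P_n] for the Taylor polynomial of degree less than
    [n] of the root [h] at the vertex, and [mu n = M (n+1) / M n].  A function
    all of whose derivatives are bounded on the sector satisfies
    [f - P_n = O(z^n)] there, and class [M] gives the constants
    [K sigma^n M_n] ([vertex_taylor]).  Conversely, if the remainders of [h]
    satisfy [|h - P_n| <= K sigma^n M_n |z|^n] for all [n], then Cauchy's
    estimates on disks of radius proportional to [|z|] bound the derivatives
    on every smaller sector ([sector_cauchy]).  So the theorem is about expansions
    at the vertex.  They are multiplied like power series: log-convexity gives
    [M_i M_j <= M_(i+j)], and the constants of class [M] survive products.

    The divided derivatives of the polynomial, evaluated at [h], are functions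
    with an expansion.  Let [m + 1] be the order of the first one whose expansion
    is not identically zero, and let [k] be the order of vanishing of the latter.

    The Taylor coefficients.  The series of [h] is a simple root of the [m]-th
    divided derivative.  Subtracting a Taylor polynomial of degree [k] and
    dividing by powers of [z] turns this into an equation
    [E + U g + z V(g) = 0] with [U] invertible and coefficients of class [M]
    ([root_coefficients_weighted]).  Moderate growth makes class [M] equivalent
    to the boundedness of the sums [|g_0| + |g_1| t + ... + |g_(n-1)| t^(n-1)]
    with [t] of the order of [1 / mu n].  These sums are submultiplicative, and
    in the equation the nonlinear terms carry a factor [t]; a continuity argument
    in [t] bounds the sum of [g] ([weighted_implicit]).

    The remainders.  For [|z| mu n] small, [P_n] itself behaves like a function
    of class [M] up to level [n] ([truncation_remainder]).  Hence in
    the Taylor formula of the polynomial at [P_n] the coefficients of order at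
    most [m], which vanish as power series, are [O(sigma^n M_n |z|^n)].  The
    coefficient of order [m + 1] is at least a multiple of [|z|^k], so
    [|h - P_n|^(m+1)] is at most a constant times [sigma^n M_n |z|^(n-k)]
    ([remainder_power]).  Applying this at the order [(m+1) n + k + 1] and using
    moderate growth to compare [M_((m+1) n)] with [M_n^(m+1)] removes both the
    exponent [m + 1] and the loss [k] ([remainder_near_vertex]).  Where
    [|z| mu n] is not small, the estimate propagates by induction on [n]
    ([remainder_everywhere]). *)

(** * Finite sums and Cauchy products *)

Fixpoint csum (u : nat -> C) (n : nat) : C :=
  match n with O => RtoC 0 | S k => (csum u k + u k)%C end.

Fixpoint rsum (u : nat -> R) (n : nat) : R :=
  match n with O => 0 | S k => rsum u k + u k end.

Lemma csum_ext (u v : nat -> C) n :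
  (forall i, (i < n)%nat -> u i = v i) -> csum u n = csum v n.
Proof.
  intros H; induction n as [|n IH]; [reflexivity|simpl].
  rewrite IH, H by (intros; try apply H; lia); reflexivity.
Qed.

Lemma csum_shift u n : csum u (S n) = (u O + csum (fun i => u (S i)) n)%C.
Proof.
  induction n as [|n IH]; [simpl; ring|].
  change (csum u (S (S n))) with (csum u (S n) + u (S n))%C.
  rewrite IH; simpl; ring.
Qed.

Lemma csum_plus u v n :
  csum (fun i => u i + v i)%C n = (csum u n + csum v n)%C.
Proof. induction n as [|n IH]; simpl; [|rewrite IH]; ring. Qed.

Lemma csum_scal a u n : csum (fun i => a * u i)%C n = (a * csum u n)%C.
Proof. induction n as [|n IH]; simpl; [|rewrite IH]; ring. Qed.

Lemma csum_zero u n : (forall i, (i < n)%nat -> u i = RtoC 0) -> csum u n = RtoC 0.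
Proof.
  intros H; induction n as [|n IH]; [reflexivity|simpl].
  rewrite IH, H by (intros; try apply H; lia); ring.
Qed.

Lemma rsum_le u v n :
  (forall i, (i < n)%nat -> u i <= v i) -> rsum u n <= rsum v n.
Proof.
  intros H; induction n as [|n IH]; simpl; [lra|].
  apply Rplus_le_compat; [apply IH; intros; apply H|apply H]; lia.
Qed.

Lemma rsum_ext u v n :
  (forall i, (i < n)%nat -> u i = v i) -> rsum u n = rsum v n.
Proof.
  intros H; induction n as [|n IH]; [reflexivity|simpl].
  rewrite IH, H by (intros; try apply H; lia); reflexivity.
Qed.

Lemma rsum_shift u n : rsum u (S n) = u O + rsum (fun i => u (S i)) n.
Proof.
  induction n as [|n IH]; [simpl; ring|].
  change (rsum u (S (S n))) with (rsum u (S n) + u (S n)).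
  rewrite IH; simpl; ring.
Qed.

Lemma rsum_plus u v n : rsum (fun i => u i + v i) n = rsum u n + rsum v n.
Proof. induction n as [|n IH]; simpl; [|rewrite IH]; ring. Qed.

Lemma rsum_scal a u n : rsum (fun i => a * u i) n = a * rsum u n.
Proof. induction n as [|n IH]; simpl; [|rewrite IH]; ring. Qed.

Lemma rsum_const a n : rsum (fun _ => a) n = INR n * a.
Proof. induction n as [|n IH]; [simpl; ring|rewrite S_INR; simpl; rewrite IH; ring]. Qed.

Lemma rsum_nonneg u n : (forall i, (i < n)%nat -> 0 <= u i) -> 0 <= rsum u n.
Proof.
  intros H; induction n as [|n IH]; simpl; [lra|].
  apply Rplus_le_le_0_compat; [apply IH; intros; apply H|apply H]; lia.
Qed.

Lemma Cmod_csum u n : Cmod (csum u n) <= rsum (fun i => Cmod (u i)) n.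
Proof.
  induction n as [|n IH]; simpl; [rewrite Cmod_0; lra|].
  eapply Rle_trans; [apply Cmod_triangle|lra].
Qed.

Lemma rsum_half n : rsum (fun i => (/ 2) ^ i) n <= 2.
Proof.
  assert (H : rsum (fun i => (/ 2) ^ i) n = 2 - 2 * (/ 2) ^ n).
  { induction n as [|n IH]; simpl; [|rewrite IH]; lra. }
  pose proof (pow_le (/ 2) n); lra.
Qed.

Definition conv (c d : nat -> C) (n : nat) : C :=
  csum (fun i => c i * d (n - i)%nat)%C (S n).

Definition rconv (a b : nat -> R) (n : nat) : R :=
  rsum (fun i => a i * b (n - i)%nat) (S n).

Definition psum (c : nat -> C) (n : nat) (z : C) : C :=
  csum (fun j => c j * z ^ j)%C n.

Lemma psum_S c n z : psum c (S n) z = (psum c n z + c n * z ^ n)%C.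
Proof. reflexivity. Qed.

Lemma psum_ext c d n z :
  (forall i, (i < n)%nat -> c i = d i) -> psum c n z = psum d n z.
Proof. intros H; apply csum_ext; intros i Hi; rewrite H by lia; reflexivity. Qed.

Lemma psum_add c n k z :
  psum c (n + k) z = (psum c k z + z ^ k * psum (fun j => c (j + k)%nat) n z)%C.
Proof.
  induction n as [|n IH]; [unfold psum; simpl; ring|].
  simpl Nat.add; rewrite !psum_S, IH, Cpow_add_r; ring.
Qed.

Lemma psum_conv c d n z :
  psum (conv c d) n z = csum (fun i => c i * z ^ i * psum d (n - i) z)%C n.
Proof.
  induction n as [|n IH]; [reflexivity|].
  rewrite psum_S, IH; cbn [csum].
  replace (S n - n)%nat with 1%nat by lia.
  match goal with |- _ = (csum ?u n + _)%C =>
  rewrite (csum_ext u (fun i => c i * z ^ i * psum d (n - i) z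
                                + z ^ n * (c i * d (n - i)%nat))%C) end.
  - rewrite csum_plus, csum_scal; unfold conv; cbn [csum].
    rewrite Nat.sub_diag; unfold psum at 3; simpl; ring.
  - intros i Hi; replace (S n - i)%nat with (S (n - i)) by lia.
    rewrite psum_S.
    replace (z ^ n)%C with (z ^ i * z ^ (n - i))%C
      by (rewrite <- Cpow_add_r; f_equal; lia).
    ring.
Qed.

Lemma rsum_conv a b n t :
  rsum (fun l => rconv a b l * t ^ l) n =
  rsum (fun i => a i * t ^ i * rsum (fun j => b j * t ^ j) (n - i)) n.
Proof.
  induction n as [|n IH]; [reflexivity|].
  cbn [rsum]; rewrite IH.
  replace (S n - n)%nat with 1%nat by lia.
  match goal with |- _ = rsum ?u n + _ =>
  rewrite (rsum_ext u (fun i =>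
    a i * t ^ i * rsum (fun j => b j * t ^ j) (n - i)
    + t ^ n * (a i * b (n - i)%nat))) end.
  - rewrite rsum_plus, rsum_scal; unfold rconv; cbn [rsum].
    rewrite Nat.sub_diag; simpl; ring.
  - intros i Hi; replace (S n - i)%nat with (S (n - i)) by lia.
    cbn [rsum].
    replace (t ^ n) with (t ^ i * t ^ (n - i))
      by (rewrite <- pow_add; f_equal; lia).
    ring.
Qed.

Lemma Cmod_psum_le c n z :
  Cmod (psum c n z) <= rsum (fun j => Cmod (c j) * Cmod z ^ j) n.
Proof.
  eapply Rle_trans; [apply Cmod_csum|].
  apply rsum_le; intros i _; rewrite Cmod_mult, Cmod_pow; lra.
Qed.

(** * Asymptotic expansions *)

(** [L x n] says at which levels [n] the expansion is claimed at the point [x];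
    letting [x] range over pairs (point, truncation order) makes one and the
    same calculus cover families of functions with uniform constants. *)
Definition expansion {X : Type} (Z : X -> C) (L : X -> nat -> Prop)
    (alpha : nat -> R) (f : X -> C) (c : nat -> C) : Prop :=
  forall n, Cmod (c n) <= alpha n /\
    forall x, L x n -> Cmod (f x - psum c n (Z x)) <= alpha n * Cmod (Z x) ^ n.

Section Expansions.
Context {X : Type} (Z : X -> C) (L : X -> nat -> Prop).

Lemma expansion_nonneg alpha f c n : expansion Z L alpha f c -> 0 <= alpha n.
Proof.
  intros H; destruct (H n) as [H1 _]; pose proof (Cmod_ge_0 (c n)); lra.
Qed.

Lemma expansion_le alpha beta f c :
  (forall n, alpha n <= beta n) -> expansion Z L alpha f c ->
  expansion Z L beta f c.
Proof.
  intros Hab H n; destruct (H n) as [H1 H2]; specialize (Hab n); split; [lra|].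
  intros x Hx; eapply Rle_trans; [apply H2, Hx|].
  apply Rmult_le_compat_r; [apply pow_le, Cmod_ge_0|exact Hab].
Qed.

Lemma expansion_const k :
  expansion Z L (fun n => match n with O => Cmod k | _ => 0 end) (fun _ => k)
    (fun n => match n with O => k | _ => RtoC 0 end).
Proof.
  intros [|n]; split.
  - lra.
  - intros x _; unfold psum; simpl.
    replace (k - 0)%C with k by ring; lra.
  - rewrite Cmod_0; lra.
  - intros x _; unfold psum; rewrite csum_shift, csum_zero by (intros; ring).
    simpl; replace (k - _)%C with (RtoC 0) by ring; rewrite Cmod_0; lra.
Qed.

Lemma expansion_plus alpha beta f g c d :
  expansion Z L alpha f c -> expansion Z L beta g d ->
  expansion Z L (fun n => alpha n + beta n) (fun x => f x + g x)%C
    (fun n => c n + d n)%C.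
Proof.
  intros Hf Hg n; destruct (Hf n) as [F1 F2], (Hg n) as [G1 G2]; split.
  - eapply Rle_trans; [apply Cmod_triangle|lra].
  - intros x Hx; specialize (F2 x Hx); specialize (G2 x Hx).
    replace (f x + g x - _)%C with
      ((f x - psum c n (Z x)) + (g x - psum d n (Z x)))%C.
    + eapply Rle_trans; [apply Cmod_triangle|lra].
    + unfold psum.
      rewrite (csum_ext (fun j => (c j + d j) * Z x ^ j)%C
        (fun j => c j * Z x ^ j + d j * Z x ^ j)%C) by (intros; ring).
      rewrite csum_plus; ring.
Qed.

Hypothesis L_down : forall x m n, (m <= n)%nat -> L x n -> L x m.

(** The remainder of a product is controlled by the Cauchy product of the two
    sequences of constants, the same operation that multiplies the
    coefficients. *)
Lemma expansion_mult alpha beta f g c d :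
  expansion Z L alpha f c -> expansion Z L beta g d ->
  expansion Z L (rconv alpha beta) (fun x => f x * g x)%C (conv c d).
Proof.
  intros Hf Hg n.
  assert (A0 := fun n => expansion_nonneg _ _ _ n Hf).
  assert (B0 := fun n => expansion_nonneg _ _ _ n Hg).
  split.
  - eapply Rle_trans; [apply Cmod_csum|apply rsum_le]; intros i _.
    rewrite Cmod_mult.
    apply Rmult_le_compat; try apply Cmod_ge_0; [apply Hf|apply Hg].
  - intros x Hx; set (z := Z x).
    (* f g minus the truncated product splits along the last known term of f *)
    replace (f x * g x - psum (conv c d) n z)%C with
      ((f x - psum c n z) * g x
       + csum (fun i => c i * z ^ i * (g x - psum d (n - i) z))%C n)%C.
    2:{ rewrite psum_conv.
        rewrite (csum_ext _ (fun i => g x * (c i * z ^ i)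
          + (-1) * (c i * z ^ i * psum d (n - i) z))%C) by (intros; ring).
        rewrite csum_plus, !csum_scal; unfold psum; ring. }
    eapply Rle_trans; [apply Cmod_triangle|].
    unfold rconv; cbn [rsum]; rewrite Nat.sub_diag, Rmult_plus_distr_r, Rplus_comm.
    apply Rplus_le_compat.
    + eapply Rle_trans; [apply Cmod_csum|].
      rewrite Rmult_comm, <- rsum_scal; apply rsum_le; intros i Hi.
      rewrite !Cmod_mult, Cmod_pow.
      replace (Cmod z ^ n) with (Cmod z ^ i * Cmod z ^ (n - i))
        by (rewrite <- pow_add; f_equal; lia).
      replace (Cmod z ^ i * Cmod z ^ (n - i) * (alpha i * beta (n - i)%nat)) with
        (alpha i * Cmod z ^ i * (beta (n - i)%nat * Cmod z ^ (n - i))) by ring.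
      apply Rmult_le_compat.
      * apply Rmult_le_pos; [apply Cmod_ge_0|apply pow_le, Cmod_ge_0].
      * apply Cmod_ge_0.
      * apply Rmult_le_compat_r; [apply pow_le, Cmod_ge_0|apply Hf].
      * apply Hg; apply L_down with n; [lia|exact Hx].
    + rewrite Cmod_mult.
      destruct (Hg O) as [_ G2]; specialize (G2 x).
      assert (G : Cmod (g x) <= beta O).
      { replace (g x) with (g x - psum d 0 (Z x))%C by (unfold psum; simpl; ring).
        replace (beta O) with (beta O * Cmod (Z x) ^ 0) by (simpl; ring).
        apply G2, L_down with n; [lia|exact Hx]. }
      replace (alpha n * beta O * Cmod z ^ n) with
        (alpha n * Cmod z ^ n * beta O) by ring.
      apply Rmult_le_compat; try apply Cmod_ge_0; [|exact G].
      apply Hf, Hx.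
Qed.

Lemma expansion_bounded alpha f c x n :
  expansion Z L alpha f c -> L x n -> Cmod (f x) <= alpha O.
Proof.
  intros H Hx; destruct (H O) as [_ H2].
  replace (f x) with (f x - psum c 0 (Z x))%C by (unfold psum; simpl; ring).
  replace (alpha O) with (alpha O * Cmod (Z x) ^ 0) by (simpl; ring).
  apply H2, L_down with n; [lia|exact Hx].
Qed.

Lemma expansion_quotient alpha f c k :
  (forall x, Z x <> RtoC 0) -> (forall x n, L x n -> L x (n + k)%nat) ->
  expansion Z L alpha f c ->
  expansion Z L (fun n => alpha (n + k)%nat)
    (fun x => (f x - psum c k (Z x)) / Z x ^ k)%C (fun n => c (n + k)%nat).
Proof.
  intros HZ HL H n; destruct (H (n + k)%nat) as [H1 H2]; split; [exact H1|].
  intros x Hx; specialize (H2 x (HL x n Hx)).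
  assert (Hk : (Z x ^ k)%C <> RtoC 0) by (apply Cpow_nz, HZ).
  rewrite psum_add in H2.
  replace ((f x - psum c k (Z x)) / Z x ^ k - psum (fun j => c (j + k)%nat) n (Z x))%C
    with ((f x - (psum c k (Z x) + Z x ^ k * psum (fun j => c (j + k)%nat) n (Z x)))
          / Z x ^ k)%C by (field; exact Hk).
  rewrite Cmod_div, Cmod_pow by exact Hk.
  assert (Hp : 0 < Cmod (Z x) ^ k) by (apply pow_lt, Cmod_gt_0, HZ).
  apply Rmult_le_reg_r with (Cmod (Z x) ^ k); [exact Hp|].
  rewrite pow_add in H2; field_simplify; lra.
Qed.

(** Two functions that are close to order [N] have the same first [N]
    coefficients, as soon as every level is claimed at points that accumulate
    at the vertex. *)
Lemma expansion_unique alpha beta gamma f g c d N :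
  (forall n eps, 0 < eps -> exists x, L x n /\ 0 < Cmod (Z x) < eps) ->
  expansion Z L alpha f c -> expansion Z L beta g d ->
  (forall x n, (n <= N)%nat -> L x n ->
     Cmod (f x - g x) <= gamma n * Cmod (Z x) ^ n) ->
  forall j, (j < N)%nat -> c j = d j.
Proof.
  intros Hacc Hf Hg Hfg j; induction j as [j IH] using lt_wf_ind.
  intros Hj.
  destruct (Hf (S j)) as [_ F], (Hg (S j)) as [_ G].
  set (K := alpha (S j) + beta (S j) + gamma (S j)).
  assert (B : forall x, L x (S j) -> 0 < Cmod (Z x) ->
     Cmod (c j - d j) <= K * Cmod (Z x)).
  { intros x Hx Hz; specialize (F x Hx); specialize (G x Hx).
    specialize (Hfg x (S j) ltac:(lia) Hx).
    apply Rmult_le_reg_r with (Cmod (Z x) ^ j); [apply pow_lt, Hz|].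
    rewrite <- Cmod_pow, <- Cmod_mult, Cmod_pow.
    replace ((c j - d j) * Z x ^ j)%C with
      ((g x - psum d (S j) (Z x)) + (-(f x - psum c (S j) (Z x)) + (f x - g x)))%C.
    2:{ rewrite !psum_S, (psum_ext c d) by (intros; apply IH; lia); ring. }
    eapply Rle_trans; [apply Cmod_triangle|].
    eapply Rle_trans; [apply Rplus_le_compat_l, Cmod_triangle|].
    rewrite Cmod_opp; simpl in F, G, Hfg; unfold K; lra. }
  destruct (Req_dec (Cmod (c j - d j)) 0) as [H0|H0].
  - apply Cmod_eq_0 in H0.
    replace (c j) with ((c j - d j) + d j)%C by ring; rewrite H0; ring.
  - exfalso; pose proof (Cmod_ge_0 (c j - d j)).
    destruct (Hacc (S j) 1 Rlt_0_1) as [y [Hy1 Hy2]].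
    pose proof (B y Hy1 (proj1 Hy2)) as By.
    assert (HK : 0 < K) by nra.
    destruct (Hacc (S j) (Cmod (c j - d j) / K)) as [x [Hx1 [Hx2 Hx3]]].
    { apply Rdiv_lt_0_compat; lra. }
    pose proof (B x Hx1 Hx2) as Bx.
    apply (Rmult_lt_compat_l K) in Hx3; [|exact HK].
    replace (K * (Cmod (c j - d j) / K)) with (Cmod (c j - d j)) in Hx3
      by (field; lra).
    lra.
Qed.
End Expansions.

(** * Taylor expansion of a monic polynomial at a moving centre *)

(** The coefficient of [s^j t^i] in [p (x + s + t)], for the monic polynomial
    [p] of degree [d] with coefficients [a 1], ..., [a d].  The Horner recursion
    makes it visibly a polynomial expression in [x] and the [a j], without
    binomial coefficients; [j = 0] gives the Taylor coefficients of [p], and a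
    fixed [j] those of its [j]-th divided derivative. *)
Fixpoint taylor2 (d : nat) (a : nat -> C) (x : C) (j i : nat) : C :=
  match d with
  | O => match j, i with O, O => RtoC 1 | _, _ => RtoC 0 end
  | S d' =>
    (match j, i with O, O => a d | _, _ => RtoC 0 end + x * taylor2 d' a x j i
     + match j with O => RtoC 0 | S j' => taylor2 d' a x j' i end
     + match i with O => RtoC 0 | S i' => taylor2 d' a x j i' end)%C
  end.

Lemma taylor2_zero d a x : forall j i, (d < j + i)%nat -> taylor2 d a x j i = RtoC 0.
Proof.
  induction d as [|d IH]; intros j i H.
  - destruct j, i; try reflexivity; lia.
  - simpl; rewrite IH by lia.
    destruct j as [|j], i as [|i]; try lia; rewrite ?IH by lia; ring.
Qed.

Lemma taylor2_lead d a x : taylor2 d a x d 0 = RtoC 1.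
Proof.
  induction d as [|d IH]; [reflexivity|simpl].
  rewrite IH, taylor2_zero by lia; ring.
Qed.

Lemma taylor2_sym d a x : forall j i, taylor2 d a x j i = taylor2 d a x i j.
Proof.
  induction d as [|d IH]; intros j i; [destruct j, i; reflexivity|simpl].
  destruct j as [|j], i as [|i]; [reflexivity|..].
  - rewrite (IH O (S i)), (IH O i); ring.
  - rewrite (IH (S j) O), (IH j O); ring.
  - rewrite (IH (S j) (S i)), (IH j (S i)), (IH (S j) i); ring.
Qed.

Lemma taylor2_one d a x : forall j,
  taylor2 d a x j 1 = (RtoC (INR (S j)) * taylor2 d a x (S j) 0)%C.
Proof.
  induction d as [|d IH]; intros j; [destruct j; simpl; ring|].
  cbn [taylor2]; destruct j as [|j].
  - rewrite IH; simpl; ring.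
  - rewrite !IH, !S_INR, !RtoC_plus; ring.
Qed.

Lemma taylor2_shift d a x y : forall j,
  taylor2 d a (x + y) j 0 = csum (fun i => taylor2 d a x j i * y ^ i)%C (S d).
Proof.
  induction d as [|d IH]; intros j; [simpl; ring|].
  (* the sums at degree d, extended by a vanishing term *)
  assert (E : forall k, csum (fun i => taylor2 d a x k i * y ^ i)%C (S (S d))
     = taylor2 d a (x + y) k 0).
  { intros k; rewrite IH.
    change (csum ?u (S (S d))) with (csum u (S d) + u (S d))%C; cbv beta.
    rewrite taylor2_zero by lia; ring. }
  cbn [taylor2].
  rewrite (csum_ext _ (fun i =>
    (match j, i with O, O => a (S d) | _, _ => 0 end) * y ^ i
    + (x * (taylor2 d a x j i * y ^ i)
    + ((match j with O => 0 | S j' => taylor2 d a x j' i end) * y ^ i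
    + (match i with O => 0 | S i' => taylor2 d a x j i' end) * y ^ i)))%C)
    by (intros; ring).
  rewrite !csum_plus, csum_scal, E.
  rewrite (csum_shift (fun i => match i with O => 0 | S i' => taylor2 d a x j i' end
    * y ^ i)%C).
  rewrite (csum_ext (fun i => taylor2 d a x j i * y ^ S i)%C
    (fun i => y * (taylor2 d a x j i * y ^ i))%C) by (intros; simpl; ring).
  rewrite csum_scal, <- IH.
  rewrite (csum_shift (fun i => match j, i with O, O => a (S d) | _, _ => 0 end
    * y ^ i)%C).
  rewrite (csum_zero (fun i => match j, S i with O, O => a (S d) | _, _ => 0 end
    * y ^ S i)%C) by (intros; destruct j; ring).
  destruct j as [|j]; [rewrite csum_zero by (intros; ring)|rewrite E]; simpl; ring.
Qed.

Lemma taylor2_eval d a x :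
  taylor2 d a x 0 0 =
  (x ^ d + sum_n_m (fun j => a j * x ^ (d - j)) 1 d)%C.
Proof.
  induction d as [|d IH].
  - simpl; rewrite sum_n_m_zero by lia; unfold zero; simpl; ring.
  - cbn [taylor2]; rewrite IH, sum_n_Sm by lia.
    rewrite Nat.sub_diag.
    assert (E : forall n, (n <= d)%nat ->
      sum_n_m (fun j => a j * x ^ (S d - j))%C 1 n =
      (x * sum_n_m (fun j => a j * x ^ (d - j)) 1 n)%C).
    { induction n as [|n IHn]; intros Hn.
      - rewrite !sum_n_m_zero by lia; unfold zero; simpl; ring.
      - rewrite !sum_n_Sm, IHn by lia.
        replace (S d - S n)%nat with (S (d - S n)) by lia.
        unfold plus; simpl; ring. }
    rewrite E by lia; unfold plus; simpl; ring.
Qed.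

(** * Algebras of functions *)

(** Polynomial expressions stay in such a class.  This is applied to four classes:
    bounded functions, functions with an expansion, those whose expansion has
    class [M], and those whose expansion is controlled by a given series. *)
Definition function_algebra {X : Type} (P : (X -> C) -> Prop) : Prop :=
  (forall k : C, P (fun _ => k)) /\
  (forall f g, P f -> P g -> P (fun x => f x + g x)%C) /\
  (forall f g, P f -> P g -> P (fun x => f x * g x)%C).

Section FunctionAlgebra.
Context {X : Type} (P : (X -> C) -> Prop) (HP : function_algebra P).

Lemma function_algebra_opp f : P f -> P (fun x => - f x)%C.
Proof.
  intros Hf; destruct HP as [H1 [_ H3]].
  replace (fun x => - f x)%C with (fun x => -(1) * f x)%C
    by (apply functional_extensionality; intros; ring).
  apply (H3 _ _ (H1 (-(1))%C) Hf).
Qed.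

Lemma function_algebra_minus f g : P f -> P g -> P (fun x => f x - g x)%C.
Proof.
  intros Hf Hg; destruct HP as [_ [H2 _]].
  apply (H2 f (fun x => - g x)%C Hf), function_algebra_opp, Hg.
Qed.

Lemma function_algebra_pow f i : P f -> P (fun x => f x ^ i)%C.
Proof.
  intros Hf; destruct HP as [H1 [_ H3]]; induction i as [|i IH]; simpl; [apply H1|].
  apply (H3 f (fun x => f x ^ i)%C Hf IH).
Qed.

Lemma function_algebra_csum (u : nat -> X -> C) n :
  (forall i, (i < n)%nat -> P (u i)) -> P (fun x => csum (fun i => u i x) n).
Proof.
  intros Hu; destruct HP as [H1 [H2 _]]; induction n as [|n IH]; simpl; [apply H1|].
  apply (H2 (fun x => csum (fun i => u i x) n) (u n)); auto.
Qed.

Lemma function_algebra_psum f c n : P f -> P (fun x => psum c n (f x)).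
Proof.
  intros Hf; apply (function_algebra_csum (fun i x => c i * f x ^ i)%C).
  intros i _; apply (proj2 (proj2 HP) (fun _ => c i)); [apply HP|].
  apply function_algebra_pow, Hf.
Qed.

Lemma function_algebra_taylor2 d (a : nat -> X -> C) f :
  (forall j, (1 <= j <= d)%nat -> P (a j)) -> P f ->
  forall j i, P (fun x => taylor2 d (fun k => a k x) (f x) j i).
Proof.
  intros Ha Hf; destruct HP as [H1 [H2 H3]].
  induction d as [|d IH]; intros j i.
  { destruct j, i; [apply (H1 (RtoC 1))|apply (H1 (RtoC 0))..]. }
  assert (IH' := IH ltac:(intros; apply Ha; lia)).
  set (T := fun j i x => taylor2 d (fun k => a k x) (f x) j i) in *.
  assert (E : (fun x => taylor2 (S d) (fun k => a k x) (f x) j i) = (fun x =>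
    (match j, i with O, O => a (S d) | _, _ => fun _ => RtoC 0 end) x
    + f x * T j i x
    + (match j with O => fun _ => RtoC 0 | S j' => T j' i end) x
    + (match i with O => fun _ => RtoC 0 | S i' => T j i' end) x)%C)
    by (apply functional_extensionality; intros x; destruct j, i; reflexivity).
  rewrite E; apply H2; [apply H2; [apply H2|]|].
  - destruct j, i; [apply Ha; lia|apply (H1 (RtoC 0))..].
  - apply H3; [exact Hf|apply IH'].
  - destruct j; [apply (H1 (RtoC 0))|apply IH'].
  - destruct i; [apply (H1 (RtoC 0))|apply IH'].
Qed.
End FunctionAlgebra.

(** * Weight sequences *)

Definition ratio (M : nat -> R) (n : nat) : R := M (S n) / M n.

(** Log-convexity in terms of the ratios, and moderate growth in multiplicative
    form, with the constant [A] as a parameter. *)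
Record weight (M : nat -> R) (A : R) : Prop := {
  weight_0 : M O = 1;
  weight_incr : forall j, M j <= M (S j);
  weight_convex : forall j k, (j <= k)%nat -> ratio M j <= ratio M k;
  weight_A : 1 <= A;
  weight_growth : forall j k, M (j + k)%nat <= A ^ (j + k) * (M j * M k)
}.

Lemma strongly_regular_weight M : strongly_regular M -> exists A, weight M A.
Proof.
  intros [Hi [H0 [Hc [[A HA] _]]]].
  assert (H1 : forall j, 1 <= M j).
  { induction j as [|j IH]; [lra|]; specialize (Hi j); rewrite Nat.add_1_r in Hi; lra. }
  exists (Rmax 1 A); constructor.
  - exact H0.
  - intros j; specialize (Hi j); rewrite Nat.add_1_r in Hi; exact Hi.
  - intros j k Hjk; specialize (Hc j k Hjk); rewrite !Nat.add_1_r in Hc; exact Hc.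
  - apply Rmax_l.
  - intros j k.
    assert (Hp : 0 < M j * M k) by (apply Rmult_lt_0_compat; [specialize (H1 j)|specialize (H1 k)]; lra).
    destruct (Nat.eq_dec (j + k) 0) as [E|E].
    { assert (j = O) by lia; assert (k = O) by lia; subst; simpl; rewrite H0; lra. }
    specialize (HA j k ltac:(lia)).
    set (q := M (j + k)%nat / (M j * M k)) in *.
    assert (Hq : 0 < q) by (apply Rdiv_lt_0_compat; [specialize (H1 (j + k)%nat)|]; lra).
    replace (M (j + k)%nat) with (q * (M j * M k)) 
      by (unfold q; field; pose proof (H1 j); pose proof (H1 k); lra).
    apply Rmult_le_compat_r; [lra|].
    assert (Hn : 0 < INR (j + k)) by (apply lt_0_INR; lia).
    replace q with (Rpower q (1 / INR (j + k)) ^ (j + k)).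
    2:{ rewrite <- Rpower_pow by apply exp_pos.
        rewrite Rpower_mult; replace (1 / INR (j + k) * INR (j + k)) with 1 by (field; lra).
        apply Rpower_1, Hq. }
    apply pow_incr; split; [left; apply exp_pos|].
    eapply Rle_trans; [exact HA|apply Rmax_r].
Qed.

Lemma pow_ge_1 a n : 1 <= a -> 1 <= a ^ n.
Proof. intros H; apply pow_R1_Rle, H. Qed.

Lemma pow_base_le a b n : 0 <= b -> a ^ S n <= b ^ S n -> a <= b.
Proof.
  intros Hb H; destruct (Rle_lt_dec a b) as [|Hlt]; [assumption|exfalso].
  assert (b ^ S n < a ^ S n); [|lra].
  clear H; induction n as [|n IH]; [simpl; lra|].
  change (b * b ^ S n < a * a ^ S n).
  assert (0 <= b ^ S n) by (apply pow_le, Hb); nra.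
Qed.

Section Weight.
Context (M : nat -> R) (A : R) (W : weight M A).
Local Notation mu := (ratio M).

Lemma weight_ge_1 j : 1 <= M j.
Proof.
  induction j as [|j IH]; [rewrite (weight_0 M A W); lra|].
  pose proof (weight_incr M A W j); lra.
Qed.

Lemma weight_pos j : 0 < M j.
Proof. pose proof (weight_ge_1 j); lra. Qed.

Lemma weight_S j : M (S j) = mu j * M j.
Proof. unfold ratio; field; pose proof (weight_pos j); lra. Qed.

Lemma ratio_ge_1 j : 1 <= mu j.
Proof.
  pose proof (weight_pos j); pose proof (weight_incr M A W j).
  apply Rmult_le_reg_r with (M j); [assumption|].
  rewrite <- weight_S; lra.
Qed.

Lemma weight_mono j k : (j <= k)%nat -> M j <= M k.
Proof.
  induction 1 as [|k _ IH]; [lra|].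
  pose proof (weight_incr M A W k); lra.
Qed.

Lemma weight_mult j k : M j * M k <= M (j + k)%nat.
Proof.
  induction k as [|k IH].
  - rewrite Nat.add_0_r, (weight_0 M A W); lra.
  - rewrite Nat.add_succ_r, !weight_S.
    pose proof (weight_convex M A W k (j + k) ltac:(lia)).
    pose proof (ratio_ge_1 k); pose proof (weight_pos k); pose proof (weight_pos j).
    replace (M j * (mu k * M k)) with (mu k * (M j * M k)) by ring.
    apply Rmult_le_compat; try lra; apply Rmult_le_pos; lra.
Qed.

Lemma weight_le_ratio_pow j n : (j <= S n)%nat -> M j <= mu n ^ j.
Proof.
  induction j as [|j IH]; intros H; [rewrite (weight_0 M A W); simpl; lra|].
  rewrite weight_S; simpl.
  pose proof (weight_convex M A W j n ltac:(lia)).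
  pose proof (ratio_ge_1 j); pose proof (weight_pos j).
  apply Rmult_le_compat; try lra; apply IH; lia.
Qed.

Lemma ratio_pow_weight n l : mu n ^ l * M n <= M (n + l)%nat.
Proof.
  induction l as [|l IH]; [rewrite Nat.add_0_r; simpl; lra|].
  rewrite Nat.add_succ_r, weight_S; simpl.
  pose proof (weight_convex M A W n (n + l) ltac:(lia)).
  pose proof (ratio_ge_1 n); pose proof (weight_pos n).
  rewrite Rmult_assoc; apply Rmult_le_compat; try lra.
  apply Rmult_le_pos; [apply pow_le|]; lra.
Qed.

(** Moderate growth makes [M l] comparable to [mu l ^ l], up to a geometric
    factor. *)
Lemma ratio_pow_le n l : mu n ^ l <= A ^ (n + l) * M l.
Proof.
  pose proof (ratio_pow_weight n l); pose proof (weight_growth M A W n l).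
  pose proof (weight_pos n).
  apply Rmult_le_reg_r with (M n); [assumption|]; nra.
Qed.

Lemma weight_growth_iter m n k :
  M (m * n + k)%nat <= A ^ (m * (m * n + k)) * (M n ^ m * M k).
Proof.
  pose proof (weight_A M A W) as HA.
  induction m as [|m IH]; [simpl; lra|].
  replace (S m * n + k)%nat with (n + (m * n + k))%nat by lia.
  eapply Rle_trans; [apply (weight_growth M A W)|].
  pose proof (weight_pos n); pose proof (weight_pos k).
  assert (0 < A ^ (n + (m * n + k))) by (apply pow_lt; lra).
  eapply Rle_trans.
  { apply Rmult_le_compat_l; [lra|]; apply Rmult_le_compat_l; [lra|exact IH]. }
  replace (A ^ (n + (m * n + k)) * (M n * (A ^ (m * (m * n + k)) * (M n ^ m * M k))))
    with (A ^ (n + (m * n + k) + m * (m * n + k)) * (M n ^ S m * M k))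
    by (rewrite pow_add; simpl; ring).
  apply Rmult_le_compat_r.
  - apply Rmult_le_pos; [apply pow_le|]; lra.
  - apply Rle_pow; [exact HA|nia].
Qed.

(** [mu (q (n+1))] exceeds [mu n] by a constant factor at most: take the
    [(n+1)]-st root in [ratio_pow_le] and use [M (n+1) <= mu n ^ (n+1)].
    This allows the order of an expansion to be multiplied by a constant without
    leaving the range [|z| mu n <= s]. *)
Lemma ratio_dilate q n : mu (q * S n) <= A ^ S q * mu n.
Proof.
  pose proof (weight_A M A W) as HA.
  apply pow_base_le with n.
  { apply Rmult_le_pos; [apply pow_le|pose proof (ratio_ge_1 n)]; lra. }
  eapply Rle_trans; [apply ratio_pow_le|].
  rewrite Rpow_mult_distr, <- pow_mult.
  replace (q * S n + S n)%nat with (S q * S n)%nat by lia.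
  apply Rmult_le_compat_l; [apply pow_le; lra|].
  apply weight_le_ratio_pow; lia.
Qed.

(** * Coefficient sequences and functions of class [M] *)

Definition weighted (c : nat -> C) : Prop :=
  exists K sigma, 0 < K /\ 0 < sigma /\
    forall n, Cmod (c n) <= K * sigma ^ n * M n.

Definition geometric (K sigma : R) (n : nat) : R := K * sigma ^ n * M n.

Lemma geometric_pos K sigma n : 0 < K -> 0 < sigma -> 0 < geometric K sigma n.
Proof.
  intros; unfold geometric; apply Rmult_lt_0_compat; [apply Rmult_lt_0_compat|].
  - assumption.
  - apply pow_lt; assumption.
  - apply weight_pos.
Qed.

Lemma geometric_le K sigma K' sigma' n : 0 <= K <= K' -> 0 <= sigma <= sigma' ->
  geometric K sigma n <= geometric K' sigma' n.
Proof.
  intros HK Hs; unfold geometric; pose proof (weight_pos n).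
  apply Rmult_le_compat_r; [lra|].
  apply Rmult_le_compat; try lra; [apply pow_le; lra|apply pow_incr; lra].
Qed.

Lemma geometric_plus K s K' s' n : 0 < K -> 0 < s -> 0 < K' -> 0 < s' ->
  geometric K s n + geometric K' s' n <= geometric (K + K') (Rmax s s') n.
Proof.
  intros; pose proof (Rmax_l s s'); pose proof (Rmax_r s s').
  pose proof (geometric_le K s K (Rmax s s') n ltac:(lra) ltac:(lra)).
  pose proof (geometric_le K' s' K' (Rmax s s') n ltac:(lra) ltac:(lra)).
  unfold geometric in *; nra.
Qed.

Lemma rconv_geometric K s K' s' n : 0 < K -> 0 < s -> 0 < K' -> 0 < s' ->
  rconv (geometric K s) (geometric K' s') n
  <= geometric (K * K') (2 * Rmax s s') n.
Proof.
  intros HK Hs HK' Hs'; set (t := Rmax s s').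
  assert (s <= t) by apply Rmax_l; assert (s' <= t) by apply Rmax_r.
  assert (Ht : 0 < t ^ n) by (apply pow_lt; lra).
  assert (P : forall i, (i < S n)%nat ->
    geometric K s i * geometric K' s' (n - i) <= K * K' * (t ^ n * M n)).
  { intros i Hi.
    apply Rle_trans with (geometric K t i * geometric K' t (n - i)).
    - apply Rmult_le_compat;
        try (left; apply geometric_pos; lra); apply geometric_le; lra.
    - unfold geometric.
      replace (K * t ^ i * M i * (K' * t ^ (n - i) * M (n - i)%nat)) with
        (K * K' * ((t ^ i * t ^ (n - i)) * (M i * M (n - i)%nat))) by ring.
      rewrite <- pow_add; replace (i + (n - i))%nat with n by lia.
      apply Rmult_le_compat_l; [apply Rmult_le_pos; lra|].
      apply Rmult_le_compat_l; [lra|].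
      eapply Rle_trans; [apply weight_mult|right; f_equal; lia]. }
  unfold rconv; eapply Rle_trans; [apply rsum_le, P|].
  rewrite rsum_const; unfold geometric; rewrite Rpow_mult_distr.
  assert (Hn : INR (S n) <= 2 ^ n).
  { clear; induction n as [|n IH]; [simpl; lra|].
    rewrite S_INR; simpl pow; assert (1 <= 2 ^ n) by (apply pow_R1_Rle; lra); lra. }
  replace (K * K' * (2 ^ n * t ^ n) * M n) with (2 ^ n * (K * K' * (t ^ n * M n))) by ring.
  apply Rmult_le_compat_r; [|exact Hn].
  pose proof (weight_pos n); repeat apply Rmult_le_pos; lra.
Qed.

(** By moderate growth, division by a power of the variable preserves class
    [M]. *)
Lemma geometric_shift K s k : 0 < K -> 0 < s ->
  exists K' s', 0 < K' /\ 0 < s' /\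
    forall n, geometric K s (n + k) <= geometric K' s' n.
Proof.
  intros HK Hs; pose proof (weight_A M A W) as HA; pose proof (weight_pos k).
  assert (0 < A ^ k) by (apply pow_lt; lra).
  assert (0 < s ^ k) by (apply pow_lt; lra).
  exists (K * s ^ k * A ^ k * M k), (s * A); split; [|split].
  - repeat apply Rmult_lt_0_compat; assumption.
  - apply Rmult_lt_0_compat; lra.
  - intros n; unfold geometric.
    assert (0 < s ^ n) by (apply pow_lt; lra).
    eapply Rle_trans.
    { apply Rmult_le_compat_l; [|apply (weight_growth M A W)].
      apply Rmult_le_pos; [lra|apply pow_le; lra]. }
    rewrite !pow_add, Rpow_mult_distr; right; ring.
Qed.

Section WeightedFunctions.
Context {X : Type} (Z : X -> C) (L : X -> nat -> Prop).
Hypothesis L_down : forall x m n, (m <= n)%nat -> L x n -> L x m.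

Definition has_weighted_expansion (f : X -> C) (c : nat -> C) : Prop :=
  exists K sigma, 0 < K /\ 0 < sigma /\ expansion Z L (geometric K sigma) f c.

Definition has_expansion (f : X -> C) (c : nat -> C) : Prop :=
  exists alpha, expansion Z L alpha f c.

Lemma weighted_has_expansion f c : has_weighted_expansion f c -> has_expansion f c.
Proof. intros [K [s [_ [_ H]]]]; exists (geometric K s); exact H. Qed.

Lemma has_weighted_expansion_weighted f c :
  has_weighted_expansion f c -> weighted c.
Proof.
  intros [K [s [HK [Hs H]]]]; exists K, s; split; [exact HK|split; [exact Hs|]].
  intros n; apply H.
Qed.

Lemma weighted_functions_algebra :
  function_algebra (fun f => exists c, has_weighted_expansion f c).
Proof.
  split; [|split].
  - intros k; eexists; exists (Cmod k + 1), 1.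
    pose proof (Cmod_ge_0 k); split; [lra|split; [lra|]].
    eapply expansion_le; [|apply expansion_const].
    intros [|n]; unfold geometric.
    + rewrite (weight_0 M A W); simpl; lra.
    + left; apply (geometric_pos (Cmod k + 1) 1); lra.
  - intros f g [c [K [s [HK [Hs H]]]]] [d [K' [s' [HK' [Hs' H']]]]].
    eexists; exists (K + K'), (Rmax s s').
    split; [lra|split; [eapply Rlt_le_trans; [exact Hs|apply Rmax_l]|]].
    eapply expansion_le; [|apply (expansion_plus Z L _ _ _ _ _ _ H H')].
    intros n; apply geometric_plus; assumption.
  - intros f g [c [K [s [HK [Hs H]]]]] [d [K' [s' [HK' [Hs' H']]]]].
    eexists; exists (K * K'), (2 * Rmax s s').
    split; [apply Rmult_lt_0_compat; lra|split].
    { pose proof (Rmax_l s s'); lra. }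
    eapply expansion_le; [|apply (expansion_mult Z L L_down _ _ _ _ _ _ H H')].
    intros n; apply rconv_geometric; assumption.
Qed.

Lemma expandable_functions_algebra :
  function_algebra (fun f => exists c, has_expansion f c).
Proof.
  split; [|split].
  - intros k; eexists; eexists; apply expansion_const.
  - intros f g [c [al H]] [d [be H']].
    eexists; eexists; apply (expansion_plus Z L _ _ _ _ _ _ H H').
  - intros f g [c [al H]] [d [be H']].
    eexists; eexists; apply (expansion_mult Z L L_down _ _ _ _ _ _ H H').
Qed.

Lemma bounded_functions_algebra :
  function_algebra (fun f : X -> C => exists B, forall x, Cmod (f x) <= B).
Proof.
  split; [|split].
  - intros k; exists (Cmod k); intros; lra.
  - intros f g [B H] [B' H']; exists (B + B'); intros x.
    eapply Rle_trans; [apply Cmod_triangle|]; specialize (H x); specialize (H' x); lra.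
  - intros f g [B H] [B' H']; exists (B * B'); intros x; rewrite Cmod_mult.
    apply Rmult_le_compat; auto; apply Cmod_ge_0.
Qed.

Lemma has_weighted_expansion_quotient f c k :
  (forall x, Z x <> RtoC 0) -> (forall x n, L x n -> L x (n + k)%nat) ->
  has_weighted_expansion f c ->
  has_weighted_expansion (fun x => (f x - psum c k (Z x)) / Z x ^ k)%C
    (fun n => c (n + k)%nat).
Proof.
  intros HZ HL [K [s [HK [Hs H]]]].
  destruct (geometric_shift K s k HK Hs) as [K' [s' [HK' [Hs' Hle]]]].
  exists K', s'; split; [exact HK'|split; [exact Hs'|]].
  eapply expansion_le; [exact Hle|apply expansion_quotient; assumption].
Qed.
End WeightedFunctions.
End Weight.

(** * An implicit function theorem for weighted power series *)

Definition nrm (c : nat -> C) (n : nat) (t : R) : R :=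
  rsum (fun j => Cmod (c j) * t ^ j) n.

Lemma nrm_nonneg c n t : 0 <= t -> 0 <= nrm c n t.
Proof.
  intros Ht; apply rsum_nonneg; intros i _.
  apply Rmult_le_pos; [apply Cmod_ge_0|apply pow_le, Ht].
Qed.

Lemma nrm_plus c d n t : 0 <= t ->
  nrm (fun i => c i + d i)%C n t <= nrm c n t + nrm d n t.
Proof.
  intros Ht; unfold nrm; rewrite <- rsum_plus; apply rsum_le; intros i _.
  rewrite <- Rmult_plus_distr_r.
  apply Rmult_le_compat_r; [apply pow_le, Ht|apply Cmod_triangle].
Qed.

Lemma nrm_conv c d n t : 0 <= t -> nrm (conv c d) n t <= nrm c n t * nrm d n t.
Proof.
  intros Ht.
  assert (P : forall c i, 0 <= Cmod (c i) * t ^ i).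
  { intros c' i; apply Rmult_le_pos; [apply Cmod_ge_0|apply pow_le, Ht]. }
  apply Rle_trans with
    (rsum (fun l => rconv (fun i => Cmod (c i)) (fun i => Cmod (d i)) l * t ^ l) n).
  - apply rsum_le; intros i _; apply Rmult_le_compat_r; [apply pow_le, Ht|].
    eapply Rle_trans; [apply Cmod_csum|]; apply rsum_le; intros k _.
    rewrite Cmod_mult; lra.
  - rewrite rsum_conv; unfold nrm at 1; rewrite Rmult_comm, <- rsum_scal.
    apply rsum_le; intros i Hi; rewrite Rmult_comm.
    apply Rmult_le_compat_r; [apply P|].
    assert (E : forall k m, (k <= m)%nat ->
      rsum (fun j => Cmod (d j) * t ^ j) k <= rsum (fun j => Cmod (d j) * t ^ j) m).
    { induction 1 as [|m _ IH]; [lra|]; simpl; specialize (P d m); lra. }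
    apply E; lia.
Qed.

Lemma nrm_term c n t : 0 <= t -> Cmod (c n) * t ^ n <= nrm c (S n) t.
Proof.
  intros Ht; unfold nrm; simpl rsum; pose proof (nrm_nonneg c n t Ht).
  unfold nrm in *; lra.
Qed.

Lemma nrm_continuity c n : continuity (nrm c n).
Proof.
  induction n as [|n IH].
  - apply continuity_const; intros x y; reflexivity.
  - apply (continuity_plus (nrm c n) (fun t => Cmod (c n) * t ^ n)); [exact IH|].
    apply (continuity_scal (fun t => t ^ n)), derivable_continuous, derivable_pow.
Qed.

Section Implicit.
Context (M : nat -> R) (A : R) (W : weight M A).
Local Notation mu := (ratio M).

(** The sums [nrm c n t] with [t] of the order of [1 / mu n] stay bounded for a
    weighted sequence [c]; by moderate growth the converse is true as well.
    This replaces the estimates of class [M] by a submultiplicative norm. *)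
Lemma weighted_nrm c : weighted M c ->
  exists kappa s, 0 <= kappa /\ 0 < s /\ forall n t, 0 <= t -> t * mu n <= s ->
    nrm c n t <= kappa.
Proof.
  intros [K [s [HK [Hs H]]]]; exists (K * 2), (/ (2 * s)).
  split; [lra|split; [apply Rinv_0_lt_compat; lra|]].
  intros n t Ht Htn; unfold nrm.
  apply Rle_trans with (rsum (fun j => K * (/ 2) ^ j) n).
  - apply rsum_le; intros j Hj.
    apply Rle_trans with (K * (s ^ j * mu n ^ j * t ^ j)).
    + replace (K * (s ^ j * mu n ^ j * t ^ j)) with
        (K * s ^ j * mu n ^ j * t ^ j) by ring.
      apply Rmult_le_compat_r; [apply pow_le, Ht|].
      eapply Rle_trans; [apply H|].
      apply Rmult_le_compat_l.
      * apply Rmult_le_pos; [lra|apply pow_le; lra].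
      * apply (weight_le_ratio_pow M A W); lia.
    + apply Rmult_le_compat_l; [lra|].
      rewrite <- !Rpow_mult_distr; apply pow_incr.
      pose proof (ratio_ge_1 M A W n); split.
      * apply Rmult_le_pos; [apply Rmult_le_pos|]; lra.
      * replace (s * mu n * t) with (s * (t * mu n)) by ring.
        apply (Rmult_le_compat_l s) in Htn; [|lra].
        replace (s * / (2 * s)) with (/ 2) in Htn by (field; lra); lra.
  - rewrite rsum_scal; apply Rmult_le_compat_l; [lra|apply rsum_half].
Qed.

(** The bound may depend on the norm of [g], so that [g] itself and its powers
    belong to the class. *)
Definition controlled (g v : nat -> C) : Prop :=
  forall Y, exists kappa s, 0 <= kappa /\ 0 < s /\
    forall n t, 0 <= t -> t * mu n <= s -> nrm g n t <= Y -> nrm v n t <= kappa.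

Lemma controlled_self g : controlled g g.
Proof.
  intros Y; exists (Rmax 0 Y), 1; split; [apply Rmax_l|split; [lra|]].
  intros n t _ _ H; eapply Rle_trans; [exact H|apply Rmax_r].
Qed.

Lemma weighted_controlled g v : weighted M v -> controlled g v.
Proof.
  intros H Y; destruct (weighted_nrm v H) as [k [s [Hk [Hs H']]]].
  exists k, s; auto.
Qed.

Lemma controlled_plus g v w :
  controlled g v -> controlled g w -> controlled g (fun n => v n + w n)%C.
Proof.
  intros Hv Hw Y; destruct (Hv Y) as [k [s [Hk [Hs H]]]], (Hw Y) as [k' [s' [Hk' [Hs' H']]]].
  exists (k + k'), (Rmin s s'); split; [lra|split; [apply Rmin_pos; lra|]].
  intros n t Ht Htn Hg; pose proof (Rmin_l s s'); pose proof (Rmin_r s s').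
  eapply Rle_trans; [apply nrm_plus, Ht|].
  apply Rplus_le_compat; [apply H|apply H']; auto; lra.
Qed.

Lemma controlled_conv g v w :
  controlled g v -> controlled g w -> controlled g (conv v w).
Proof.
  intros Hv Hw Y; destruct (Hv Y) as [k [s [Hk [Hs H]]]], (Hw Y) as [k' [s' [Hk' [Hs' H']]]].
  exists (k * k'), (Rmin s s'); split; [nra|split; [apply Rmin_pos; lra|]].
  intros n t Ht Htn Hg; pose proof (Rmin_l s s'); pose proof (Rmin_r s s').
  eapply Rle_trans; [apply nrm_conv, Ht|].
  apply Rmult_le_compat; try apply nrm_nonneg, Ht; [apply H|apply H']; auto; lra.
Qed.

(** A power series [g] with [a g + e + z v = 0] is weighted when [e] is and [v]
    is controlled by [g].  In the norm at [t], the term [z v] costs a factor [t]: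
    if [t <= s / mu n], the norm of [g] cannot take the value [Y], and since it
    is continuous in [t] and below [Y] at [t = 0], it stays below [Y]. *)
Lemma weighted_implicit a g e v :
  a <> RtoC 0 -> weighted M e -> controlled g v ->
  (forall n, (a * g n + e n + match n with O => 0 | S j => v j end)%C = RtoC 0) ->
  weighted M g.
Proof.
  intros Ha He Hv Heq.
  destruct (weighted_nrm e He) as [k [s [Hk [Hs He']]]].
  assert (Ha' : 0 < Cmod a) by (apply Cmod_gt_0, Ha).
  set (Y := (k + 2) / Cmod a).
  assert (HY : Cmod a * Y = k + 2) by (unfold Y; field; lra).
  assert (HY0 : 0 < Y) by (apply Rdiv_lt_0_compat; lra).
  destruct (Hv Y) as [k' [s' [Hk' [Hs' Hv']]]].
  set (s0 := Rmin (Rmin s s') (/ (k' + 1))).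
  assert (Hs0 : 0 < s0).
  { apply Rmin_pos; [apply Rmin_pos; assumption|apply Rinv_0_lt_compat; lra]. }
  assert (S1 : s0 <= s) by (eapply Rle_trans; [apply Rmin_l|apply Rmin_l]).
  assert (S2 : s0 <= s') by (eapply Rle_trans; [apply Rmin_l|apply Rmin_r]).
  assert (S3 : s0 * k' <= 1).
  { apply Rle_trans with (/ (k' + 1) * (k' + 1)).
    - apply Rmult_le_compat; try lra; apply Rmin_r.
    - right; field; lra. }
  assert (Key : forall n t, 0 <= t -> Cmod a * nrm g (S n) t
                 <= nrm e (S n) t + t * nrm v (S n) t).
  { intros n t Ht; unfold nrm; rewrite <- rsum_scal.
    apply Rle_trans with (rsum (fun j => Cmod (e j) * t ^ j
      + Cmod (match j with O => RtoC 0 | S i => v i end) * t ^ j) (S n)).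
    - apply rsum_le; intros j _.
      rewrite <- Rmult_assoc, <- Cmod_mult, <- Rmult_plus_distr_r.
      apply Rmult_le_compat_r; [apply pow_le, Ht|].
      replace (a * g j)%C with (-(e j + match j with O => 0 | S i => v i end))%C.
      + rewrite Cmod_opp; apply Cmod_triangle.
      + replace (-(e j + _))%C with (a * g j - (a * g j + e j +
          match j with O => 0 | S i => v i end))%C by ring.
        rewrite Heq; ring.
    - rewrite rsum_plus; apply Rplus_le_compat_l.
      rewrite (rsum_shift (fun j => Cmod (match j with O => RtoC 0 | S i => v i end) * t ^ j)).
      rewrite Cmod_0, Rmult_0_l, Rplus_0_l.
      rewrite <- rsum_scal; simpl rsum at 2.
      rewrite (rsum_ext (fun i => Cmod (v i) * t ^ S i)
        (fun i => t * (Cmod (v i) * t ^ i))) by (intros; simpl; ring).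
      assert (0 <= t * (Cmod (v n) * t ^ n)); [|lra].
      apply Rmult_le_pos; [exact Ht|].
      apply Rmult_le_pos; [apply Cmod_ge_0|apply pow_le, Ht]. }
  assert (NotY : forall n t, 0 <= t -> t * mu (S n) <= s0 -> nrm g (S n) t <> Y).
  { intros n t Ht Htn E; specialize (Key n t Ht); rewrite E, HY in Key.
    pose proof (ratio_ge_1 M A W (S n)).
    assert (Ts : t <= s0) by nra.
    specialize (He' (S n) t Ht ltac:(lra)).
    specialize (Hv' (S n) t Ht ltac:(lra) ltac:(lra)).
    pose proof (nrm_nonneg v (S n) t Ht); nra. }
  assert (Zero : forall n, nrm g (S n) 0 < Y).
  { intros n; specialize (Key n 0 ltac:(lra)).
    pose proof (ratio_ge_1 M A W (S n)).
    specialize (He' (S n) 0 ltac:(lra) ltac:(lra)).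
    apply Rmult_lt_reg_l with (Cmod a); lra. }
  assert (Bound : forall n t, 0 <= t -> t * mu (S n) <= s0 -> nrm g (S n) t < Y).
  { intros n t Ht Htn; destruct (Rlt_le_dec (nrm g (S n) t) Y) as [|Hge]; [assumption|].
    exfalso; specialize (Zero n).
    destruct (IVT_gen (nrm g (S n)) 0 t Y (nrm_continuity g (S n))) as [x [Hx HxY]].
    - rewrite Rmin_left, Rmax_right by lra; lra.
    - rewrite Rmin_left, Rmax_right in Hx by lra.
      pose proof (ratio_ge_1 M A W (S n)).
      apply (NotY n x); [lra|nra|exact HxY]. }
  pose proof (weight_A M A W) as HA.
  exists (Y * A), (/ s0 * A ^ 2); split; [nra|split].
  { apply Rmult_lt_0_compat; [apply Rinv_0_lt_compat, Hs0|apply pow_lt; lra]. }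
  intros n; pose proof (ratio_ge_1 M A W (S n)) as Hmu.
  set (t := s0 / mu (S n)).
  assert (Ht : 0 < t) by (apply Rdiv_lt_0_compat; lra).
  specialize (Bound n t ltac:(lra) ltac:(right; unfold t; field; lra)).
  pose proof (nrm_term g n t ltac:(lra)) as Hn.
  assert (Htn : 0 < t ^ n) by (apply pow_lt, Ht).
  apply Rmult_le_reg_r with (t ^ n); [exact Htn|].
  apply Rle_trans with Y; [lra|].
  assert (E : t ^ n * mu (S n) ^ n = s0 ^ n).
  { rewrite <- Rpow_mult_distr; f_equal; unfold t; field; lra. }
  pose proof (ratio_pow_le M A W (S n) n) as Hr.
  replace (Y * A * (/ s0 * A ^ 2) ^ n * M n * t ^ n) with
    (Y * ((/ s0) ^ n * (t ^ n * (A ^ (S n + n) * M n)))).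
  2:{ rewrite Rpow_mult_distr, <- pow_mult.
      replace (S n + n)%nat with (1 + 2 * n)%nat by lia.
      rewrite pow_add; simpl; ring. }
  rewrite <- (Rmult_1_r Y) at 1; apply Rmult_le_compat_l; [lra|].
  replace 1 with ((/ s0) ^ n * s0 ^ n)
    by (rewrite <- Rpow_mult_distr, Rinv_l, pow1; lra).
  apply Rmult_le_compat_l; [apply pow_le; left; apply Rinv_0_lt_compat, Hs0|].
  rewrite <- E; apply Rmult_le_compat_l; lra.
Qed.
End Implicit.

(** * The Taylor coefficients of a root *)

Lemma least_nonzero (t : nat -> C) :
  (forall j, t j = RtoC 0) \/
  exists k, t k <> RtoC 0 /\ forall j, (j < k)%nat -> t j = RtoC 0.
Proof.
  destruct (classic (exists k, t k <> RtoC 0)) as [[k Hk]|H].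
  - right; induction k as [k IH] using lt_wf_ind.
    destruct (classic (exists j, (j < k)%nat /\ t j <> RtoC 0)) as [[j [Hj Hj']]|N].
    + apply (IH j Hj Hj').
    + exists k; split; [exact Hk|]; intros j Hj.
      apply NNPP; intros Hj'; apply N; exists j; auto.
  - left; intros j; apply NNPP; intros Hj; apply H; exists j; exact Hj.
Qed.

Lemma csum_split u a b :
  csum u (a + b) = (csum u a + csum (fun i => u (a + i)%nat) b)%C.
Proof.
  induction b as [|b IH]; [rewrite Nat.add_0_r; simpl; ring|].
  rewrite Nat.add_succ_r; simpl; rewrite IH; ring.
Qed.

(** The coefficients of [z v]. *)
Definition delay (v : nat -> C) (n : nat) : C :=
  match n with O => RtoC 0 | S j => v j end.

Definition bounded {X : Type} (f : X -> C) : Prop :=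
  exists B, forall x, Cmod (f x) <= B.

Lemma taylor2_lipschitz {X : Type} d (a : nat -> X -> C) (f g : X -> C) j :
  (forall i, (1 <= i <= d)%nat -> bounded (a i)) -> bounded f -> bounded g ->
  exists B, 0 <= B /\ forall x,
    Cmod (taylor2 d (fun i => a i x) (f x) j 0 - taylor2 d (fun i => a i x) (g x) j 0)
    <= B * Cmod (f x - g x).
Proof.
  intros Ha Hf Hg; pose proof (@bounded_functions_algebra X) as HP.
  assert (HR : bounded (fun x => csum (fun i =>
     taylor2 d (fun i => a i x) (g x) j (S i) * (f x - g x) ^ i)%C d)).
  { apply (function_algebra_csum bounded HP (fun i x =>
      taylor2 d (fun i => a i x) (g x) j (S i) * (f x - g x) ^ i)%C).
    intros i _; apply (proj2 (proj2 HP)).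
    - apply (function_algebra_taylor2 bounded HP); assumption.
    - apply (function_algebra_pow bounded HP), (function_algebra_minus bounded HP); assumption. }
  destruct HR as [B HB]; exists (Rmax 0 B); split; [apply Rmax_l|].
  intros x; specialize (HB x).
  replace (f x) with (g x + (f x - g x))%C at 1 by ring.
  rewrite taylor2_shift, csum_shift; simpl Cpow.
  rewrite (csum_ext _ (fun i => (f x - g x) *
    (taylor2 d (fun i => a i x) (g x) j (S i) * (f x - g x) ^ i))%C)
    by (intros; ring).
  rewrite csum_scal.
  replace (_ - _)%C with ((f x - g x) * csum (fun i =>
     taylor2 d (fun i => a i x) (g x) j (S i) * (f x - g x) ^ i)%C d)%C by ring.
  rewrite Cmod_mult, Rmult_comm.
  apply Rmult_le_compat_r; [apply Cmod_ge_0|].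
  eapply Rle_trans; [exact HB|apply Rmax_r].
Qed.

Lemma conv_delay_l (v : nat -> C) n :
  conv (fun n => match n with 1%nat => RtoC 1 | _ => RtoC 0 end) v n = delay v n.
Proof.
  unfold conv; destruct n as [|n]; [simpl; ring|].
  rewrite csum_shift, csum_shift, csum_zero by (intros; ring).
  simpl; rewrite Nat.sub_0_r; ring.
Qed.

Lemma conv_head_l (u v : nat -> C) n :
  conv u v n = (u O * v n + delay (conv (fun i => u (S i)) v) n)%C.
Proof.
  unfold conv at 1; destruct n as [|n]; [simpl; ring|].
  rewrite csum_shift; reflexivity.
Qed.

(** The expansions of functions on the sector hold at all levels. *)
Definition everywhere {X : Type} (_ : X) (_ : nat) : Prop := True.

Section Coefficients.
Context (M : nat -> R) (A : R) (W : weight M A).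
Context {X : Type} (Z : X -> C) (r : R).
Hypothesis Z_nonzero : forall x, Z x <> RtoC 0.
Hypothesis Z_small : forall eps, 0 < eps -> exists x, Cmod (Z x) < eps.
Hypothesis Z_bounded : forall x, Cmod (Z x) <= r.

Definition flat (f : X -> C) : Prop :=
  forall n, exists B, forall x, Cmod (f x) <= B * Cmod (Z x) ^ n.

Local Notation has_exp := (has_expansion Z everywhere).
Local Notation has_wexp := (has_weighted_expansion M Z everywhere).

Lemma everywhere_down (x : X) m n :
  (m <= n)%nat -> everywhere x n -> everywhere x m.
Proof. intros; exact I. Qed.

Lemma everywhere_acc (n : nat) eps :
  0 < eps -> exists x, everywhere x n /\ 0 < Cmod (Z x) < eps.
Proof.
  intros He; destruct (Z_small eps He) as [x Hx]; exists x.
  split; [exact I|split; [apply Cmod_gt_0, Z_nonzero|exact Hx]].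
Qed.

Lemma has_expansion_bounded f c : has_exp f c -> bounded f.
Proof.
  intros [al H]; exists (al O); intros x.
  apply (expansion_bounded Z everywhere everywhere_down al f c x O H I).
Qed.

Lemma flat_iff f : flat f <-> has_exp f (fun _ => RtoC 0).
Proof.
  assert (P0 : forall n z, psum (fun _ => RtoC 0) n z = RtoC 0)
    by (intros; apply csum_zero; intros; ring).
  split.
  - intros H.
    assert (H' : forall n, exists B, 0 <= B /\ forall x, Cmod (f x) <= B * Cmod (Z x) ^ n).
    { intros n; destruct (H n) as [B HB]; exists (Rmax 0 B); split; [apply Rmax_l|].
      intros x; eapply Rle_trans; [apply HB|].
      apply Rmult_le_compat_r; [apply pow_le, Cmod_ge_0|apply Rmax_r]. }
    apply choice in H'; destruct H' as [al Hal]; exists al.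
    intros n; destruct (Hal n) as [H0 H1]; split; [rewrite Cmod_0; exact H0|].
    intros x _; rewrite P0; replace (f x - 0)%C with (f x) by ring; apply H1.
  - intros [al H] n; exists (al n); intros x.
    destruct (H n) as [_ H1]; specialize (H1 x I).
    rewrite P0 in H1; replace (f x - 0)%C with (f x) in H1 by ring; exact H1.
Qed.

Lemma has_expansion_unique f c d : has_exp f c -> has_exp f d -> forall j, c j = d j.
Proof.
  intros [al H] [be H'] j.
  apply (expansion_unique Z everywhere al be (fun _ => 0) f f c d (S j) everywhere_acc H H');
    [|lia].
  intros x n _ _; replace (f x - f x)%C with (RtoC 0) by ring; rewrite Cmod_0; lra.
Qed.

(** [expansion_unique] for a closeness that is given at the order [N] only; the
    lower orders follow because [|z|] is bounded. *)
Lemma has_expansion_close f g c d B N :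
  has_exp f c -> has_exp g d ->
  (forall x, Cmod (f x - g x) <= B * Cmod (Z x) ^ N) ->
  forall j, (j < N)%nat -> c j = d j.
Proof.
  intros [al H] [be H'] HB.
  apply (expansion_unique Z everywhere al be (fun n => Rmax 0 B * Rmax 1 r ^ (N - n))
    f g c d N everywhere_acc H H').
  intros x n Hn _; eapply Rle_trans; [apply HB|].
  replace (Cmod (Z x) ^ N) with (Cmod (Z x) ^ (N - n) * Cmod (Z x) ^ n)
    by (rewrite <- pow_add; f_equal; lia).
  rewrite <- Rmult_assoc; apply Rmult_le_compat_r; [apply pow_le, Cmod_ge_0|].
  apply Rle_trans with (Rmax 0 B * Cmod (Z x) ^ (N - n)).
  - apply Rmult_le_compat_r; [apply pow_le, Cmod_ge_0|apply Rmax_r].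
  - apply Rmult_le_compat_l; [apply Rmax_l|].
    apply pow_incr; split; [apply Cmod_ge_0|].
    eapply Rle_trans; [apply Z_bounded|apply Rmax_r].
Qed.

Lemma variable_weighted :
  has_wexp Z (fun n => match n with 1%nat => RtoC 1 | _ => RtoC 0 end).
Proof.
  exists (Rmax 1 r), 1; pose proof (Rmax_l 1 r); pose proof (Rmax_r 1 r).
  split; [lra|split; [lra|]].
  assert (G : forall n, 1 <= geometric M (Rmax 1 r) 1 n).
  { intros n; unfold geometric; rewrite pow1, Rmult_1_r.
    pose proof (weight_ge_1 M A W n); nra. }
  intros n; split.
  - specialize (G n); destruct n as [|[|n]]; rewrite ?Cmod_0, ?Cmod_1; lra.
  - intros x _; destruct n as [|[|n]].
    + unfold psum, geometric; simpl; rewrite (weight_0 M A W).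
      replace (Z x - 0)%C with (Z x) by ring; specialize (Z_bounded x); lra.
    + unfold psum; simpl csum; simpl Cpow; replace (Z x - _)%C with (Z x) by ring.
      rewrite pow_1; pose proof (Cmod_ge_0 (Z x)); specialize (G 1%nat); nra.
    + unfold psum; rewrite !csum_shift, csum_zero by (intros; ring).
      simpl Cpow; replace (Z x - _)%C with (RtoC 0) by ring; rewrite Cmod_0.
      apply Rmult_le_pos; [specialize (G (S (S n))); lra|apply pow_le, Cmod_ge_0].
Qed.

Lemma controlled_functions_algebra g :
  function_algebra (fun f => exists v, has_exp f v /\ controlled M g v).
Proof.
  pose proof (weighted_functions_algebra M A W Z everywhere everywhere_down) as [HW _].
  split; [|split].
  - intros k; destruct (HW k) as [c Hc]; exists c; split.
    + apply (weighted_has_expansion M); exact Hc.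
    + apply (weighted_controlled M A W).
      apply (has_weighted_expansion_weighted M Z everywhere _ _ Hc).
  - intros f1 f2 [v1 [[al1 H1] C1]] [v2 [[al2 H2] C2]].
    exists (fun n => v1 n + v2 n)%C; split; [|apply controlled_plus; assumption].
    eexists; apply (expansion_plus Z everywhere _ _ _ _ _ _ H1 H2).
  - intros f1 f2 [v1 [[al1 H1] C1]] [v2 [[al2 H2] C2]].
    exists (conv v1 v2); split; [|apply controlled_conv; assumption].
    eexists; apply (expansion_mult Z everywhere everywhere_down _ _ _ _ _ _ H1 H2).
Qed.

Context (d : nat) (a : nat -> X -> C) (h : X -> C) (c : nat -> C).
Hypothesis a_weighted : forall i, (1 <= i <= d)%nat -> exists b, has_wexp (a i) b.
Hypothesis h_expansion : has_exp h c.

Local Notation tay f j i := (fun x => taylor2 d (fun l => a l x) (f x) j i).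

(** If the [m]-th divided derivative of the polynomial vanishes at [h] as a
    power series, and the next one has order exactly [k], write
    [h = P + z^(k+1) G] with [P] the Taylor polynomial of degree [k].  The Taylor
    formula at [P], divided by [z^(2k+1)], becomes [E + U G + z V = 0] with
    [U] invertible, [E], [U] of class [M], and [V] a polynomial in [G] with
    coefficients of class [M]. *)
Lemma root_coefficients_weighted m k t :
  (1 <= d)%nat ->
  flat (tay h m 0) -> has_exp (tay h m 1) t ->
  (forall j, (j < k)%nat -> t j = RtoC 0) -> t k <> RtoC 0 ->
  weighted M c.
Proof.
  intros Hd Hflat Ht Ht0 Htk.
  pose proof (weighted_functions_algebra M A W Z everywhere everywhere_down) as WA.
  set (P := fun x => psum c (S k) (Z x)).
  assert (PW : exists b, has_wexp P b).
  { apply (function_algebra_psum _ WA Z c (S k)).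
    eexists; apply variable_weighted. }
  assert (eW : forall j i, exists b, has_wexp (tay P j i) b)
    by (apply (function_algebra_taylor2 _ WA); assumption).
  assert (wb : forall f, (exists b, has_wexp f b) -> bounded f).
  { intros f [b Hb]; apply weighted_has_expansion in Hb.
    apply (has_expansion_bounded f b Hb). }
  assert (Hb : bounded h) by apply (has_expansion_bounded h c h_expansion).
  set (G := fun x => ((h x - psum c (S k) (Z x)) / Z x ^ S k)%C).
  set (g := fun n => c (n + S k)%nat).
  assert (GE : has_exp G g).
  { destruct h_expansion as [al H]; eexists.
    apply (expansion_quotient Z everywhere al h c (S k) Z_nonzero (fun _ _ _ => I) H). }
  assert (hG : forall x, (h x - P x)%C = (Z x ^ S k * G x)%C).
  { intros x; unfold G, P; field; apply Cpow_nz, Z_nonzero. }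
  destruct (has_expansion_bounded G g GE) as [BG HBG].
  (* order of the linear coefficient *)
  destruct (eW m 1%nat) as [e1 He1].
  assert (e1t : forall j, (j < S k)%nat -> e1 j = t j).
  { destruct (taylor2_lipschitz d a h P (S m)) as [B [HB0 HB]].
    { intros i Hi; exact (wb (a i) (a_weighted i Hi)). }
    { exact Hb. }
    { exact (wb P PW). }
    apply (has_expansion_close (tay P m 1) (tay h m 1) e1 t (INR (S m) * (B * BG)) (S k)).
    - apply (weighted_has_expansion M); exact He1.
    - exact Ht.
    - intros x; rewrite !taylor2_one.
      replace (_ - _)%C with (RtoC (INR (S m)) * - (taylor2 d (fun l => a l x) (h x) (S m) 0
         - taylor2 d (fun l => a l x) (P x) (S m) 0))%C by ring.
      rewrite Cmod_mult, Cmod_opp, Cmod_R, Rabs_right by apply Rle_ge, pos_INR.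
      rewrite !Rmult_assoc; apply Rmult_le_compat_l; [apply pos_INR|].
      eapply Rle_trans; [apply HB|]; apply Rmult_le_compat_l; [exact HB0|].
      rewrite hG, Cmod_mult, Cmod_pow, Rmult_comm.
      apply Rmult_le_compat_r; [apply pow_le, Cmod_ge_0|apply HBG]. }
  set (U := fun x => ((taylor2 d (fun l => a l x) (P x) m 1 - psum e1 k (Z x)) / Z x ^ k)%C).
  set (u := fun n => e1 (n + k)%nat).
  assert (UW : has_wexp U u)
    by apply (has_weighted_expansion_quotient M A W Z everywhere (tay P m 1) e1 k Z_nonzero (fun _ _ _ => I) He1).
  assert (u0 : u O <> RtoC 0) by (unfold u; simpl; rewrite e1t by lia; exact Htk).
  assert (e1U : forall x, taylor2 d (fun l => a l x) (P x) m 1 = (Z x ^ k * U x)%C).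
  { intros x; unfold U; unfold psum at 1.
    rewrite csum_zero by (intros j Hj; rewrite e1t, Ht0 by lia; ring).
    field; apply Cpow_nz, Z_nonzero. }
  (* the terms of degree at least 2 *)
  set (V := fun x => csum (fun i => taylor2 d (fun l => a l x) (P x) m (S (S i))
      * Z x ^ (S k * i) * G x ^ S (S i))%C (d - 1)).
  assert (VC : exists v, has_exp V v /\ controlled M g v).
  { pose proof (controlled_functions_algebra g) as CA.
    assert (wc : forall f, (exists b, has_wexp f b) ->
              exists v, has_exp f v /\ controlled M g v).
    { intros f [b Hb']; exists b; split; [apply (weighted_has_expansion M); exact Hb'|].
      apply (weighted_controlled M A W).
      apply (has_weighted_expansion_weighted M Z everywhere _ _ Hb'). }
    apply (function_algebra_csum _ CA (fun i x => taylor2 d (fun l => a l x) (P x) m (S (S i))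
      * Z x ^ (S k * i) * G x ^ S (S i))%C).
    intros i _; apply (proj2 (proj2 CA) (fun x => taylor2 d (fun l => a l x) (P x) m (S (S i))
      * Z x ^ (S k * i))%C (fun x => G x ^ S (S i))%C).
    - apply wc, (proj2 (proj2 WA) (tay P m (S (S i))) (fun x => Z x ^ (S k * i))%C); [apply eW|].
      apply (function_algebra_pow _ WA); eexists; apply variable_weighted.
    - apply (function_algebra_pow _ CA); exists g; split; [exact GE|apply controlled_self]. }
  destruct VC as [v [VE VC]].
  destruct (has_expansion_bounded V v VE) as [BV HBV].
  destruct (has_expansion_bounded U u (weighted_has_expansion M Z everywhere U u UW)) as [BU HBU].
  assert (Main : forall x, taylor2 d (fun l => a l x) (h x) m 0 =
    (taylor2 d (fun l => a l x) (P x) m 0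
     + Z x ^ (2 * k + 1) * (U x * G x + Z x * V x))%C).
  { intros x; replace (h x) with (P x + Z x ^ S k * G x)%C by (rewrite <- hG; ring).
    rewrite taylor2_shift; replace (S d) with (2 + (d - 1))%nat by lia.
    rewrite csum_split; simpl csum at 1; rewrite e1U.
    rewrite (csum_ext _ (fun i => Z x ^ (2 * k + 2) * (taylor2 d (fun l => a l x) (P x) m (S (S i))
      * Z x ^ (S k * i) * G x ^ S (S i)))%C).
    2:{ intros i _; replace (2 + i)%nat with (S (S i)) by lia.
        rewrite Cpow_mult_l, <- Cpow_mult_r.
        replace (S k * S (S i))%nat with (2 * k + 2 + S k * i)%nat by lia.
        rewrite Cpow_add_r; ring. }
    rewrite csum_scal; fold (V x).
    replace (2 * k + 1)%nat with (k + S k)%nat by lia.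
    replace (2 * k + 2)%nat with (S (k + S k)) by lia.
    rewrite (Cpow_S _ (k + S k)), Cpow_add_r, (Cpow_S _ k); ring. }
  (* the constant coefficient *)
  destruct (eW m O) as [e0 He0].
  assert (e00 : forall j, (j < 2 * k + 1)%nat -> e0 j = RtoC 0).
  { destruct (Hflat (2 * k + 1)%nat) as [B HB].
    apply (has_expansion_close (tay P m 0) (fun _ => RtoC 0) e0 (fun _ => RtoC 0)
      (B + (BU * BG + r * BV)) (2 * k + 1)).
    - apply (weighted_has_expansion M); exact He0.
    - apply flat_iff; intros n; exists 0; intros x; rewrite Cmod_0; lra.
    - intros x; specialize (HB x); cbv beta in HB.
      replace (taylor2 d (fun l => a l x) (P x) m 0 - 0)%C with
       (taylor2 d (fun l => a l x) (h x) m 0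
        + - (Z x ^ (2 * k + 1) * (U x * G x + Z x * V x)))%C by (rewrite Main; ring).
      eapply Rle_trans; [apply Cmod_triangle|]; rewrite Rmult_plus_distr_r.
      apply Rplus_le_compat; [exact HB|].
      rewrite Cmod_opp, Cmod_mult, Cmod_pow, Rmult_comm.
      apply Rmult_le_compat_r; [apply pow_le, Cmod_ge_0|].
      eapply Rle_trans; [apply Cmod_triangle|]; rewrite !Cmod_mult.
      apply Rplus_le_compat; apply Rmult_le_compat; try apply Cmod_ge_0; auto. }
  set (E := fun x => ((taylor2 d (fun l => a l x) (P x) m 0
     - psum e0 (2 * k + 1) (Z x)) / Z x ^ (2 * k + 1))%C).
  set (e := fun n => e0 (n + (2 * k + 1))%nat).
  assert (EW : has_wexp E e)
    by apply (has_weighted_expansion_quotient M A W Z everywhere (tay P m 0) e0 (2 * k + 1)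
      Z_nonzero (fun _ _ _ => I) He0).
  assert (Sum0 : has_exp (fun x => E x + (U x * G x + Z x * V x))%C (fun _ => RtoC 0)).
  { apply flat_iff; intros n; destruct (Hflat (n + (2 * k + 1))%nat) as [B HB]; exists B.
    intros x; specialize (HB x); cbv beta in HB.
    assert (Hk : (Z x ^ (2 * k + 1))%C <> RtoC 0) by apply Cpow_nz, Z_nonzero.
    assert (Hk' : 0 < Cmod (Z x) ^ (2 * k + 1)) by apply pow_lt, Cmod_gt_0, Z_nonzero.
    apply Rmult_le_reg_r with (Cmod (Z x) ^ (2 * k + 1)); [exact Hk'|].
    rewrite <- Cmod_pow at 1; rewrite <- Cmod_mult, Rmult_assoc, <- pow_add.
    replace ((E x + (U x * G x + Z x * V x)) * Z x ^ (2 * k + 1))%C with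
      (taylor2 d (fun l => a l x) (h x) m 0); [exact HB|].
    rewrite Main; unfold E; unfold psum at 1.
    rewrite csum_zero by (intros j Hj; rewrite e00 by exact Hj; ring).
    field; exact Hk. }
  destruct (weighted_has_expansion M Z everywhere E e EW) as [al1 X1].
  destruct (weighted_has_expansion M Z everywhere U u UW) as [al2 X2].
  destruct GE as [al3 X3]; destruct VE as [al4 X4].
  destruct (weighted_has_expansion M Z everywhere Z _ variable_weighted) as [al5 X5].
  pose proof (expansion_mult Z everywhere everywhere_down _ _ _ _ _ _ X2 X3) as Y1.
  pose proof (expansion_mult Z everywhere everywhere_down _ _ _ _ _ _ X5 X4) as Y2.
  pose proof (expansion_plus Z everywhere _ _ _ _ _ _ X1
    (expansion_plus Z everywhere _ _ _ _ _ _ Y1 Y2)) as Y3.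
  assert (Hg : weighted M g).
  { apply (weighted_implicit M A W (u O) g e
      (fun n => conv (fun i => u (S i)) g n + v n)%C u0).
    - apply (has_weighted_expansion_weighted M Z everywhere E e EW).
    - apply controlled_plus; [|exact VC].
      apply controlled_conv; [|apply controlled_self].
      apply (weighted_controlled M A W).
      destruct (has_weighted_expansion_weighted M Z everywhere U u UW) as [K [s [HK [Hs H]]]].
      destruct (geometric_shift M A W K s 1 HK Hs) as [K' [s' [HK' [Hs' H']]]].
      exists K', s'; split; [exact HK'|split; [exact Hs'|]].
      intros n; eapply Rle_trans; [apply H|]; rewrite <- Nat.add_1_r; apply H'.
    - intros n.
      pose proof (has_expansion_unique _ _ _ (ex_intro (fun al => expansion Z everywhere al _ _) _ Y3) Sum0 n) as Hn.
      cbv beta in Hn; rewrite conv_delay_l, (conv_head_l u g) in Hn.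
      etransitivity; [|exact Hn]; destruct n; unfold delay; ring. }
  destruct Hg as [K [s [HK [Hs H]]]].
  (* finitely many initial coefficients are absorbed by the constant *)
  set (K1 := rsum (fun j => Cmod (c j)) (S k)).
  set (s1 := Rmax 1 s).
  assert (Hs1 : 1 <= s1) by apply Rmax_l.
  assert (HK1 : 0 <= K1) by (apply rsum_nonneg; intros; apply Cmod_ge_0).
  exists (K + K1), s1; split; [lra|split; [lra|]].
  intros n; pose proof (weight_ge_1 M A W n) as HM.
  assert (P1 : 1 <= s1 ^ n) by (apply pow_ge_1, Hs1).
  destruct (le_lt_dec (S k) n) as [Hn|Hn].
  - specialize (H (n - S k)%nat); unfold g in H.
    replace (n - S k + S k)%nat with n in H by lia.
    eapply Rle_trans; [exact H|].
    apply Rmult_le_compat.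
    + apply Rmult_le_pos; [lra|apply pow_le; lra].
    + left; apply (weight_pos M A W).
    + apply Rmult_le_compat; [lra|apply pow_le; lra|lra|].
      apply Rle_trans with (s1 ^ (n - S k)).
      * apply pow_incr; split; [lra|apply Rmax_r].
      * apply Rle_pow; [exact Hs1|lia].
    + apply (weight_mono M A W); lia.
  - apply Rle_trans with K1.
    + unfold K1; clear - Hn; induction (S k) as [|q IH]; [lia|simpl].
      assert (0 <= rsum (fun j => Cmod (c j)) q)
        by (apply rsum_nonneg; intros; apply Cmod_ge_0).
      pose proof (Cmod_ge_0 (c q)).
      destruct (Nat.eq_dec n q) as [->|Hne]; [lra|specialize (IH ltac:(lia)); lra].
    + assert (1 <= s1 ^ n * M n) by nra; nra.
Qed.
End Coefficients.

(** * The remainders of a root *)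

Lemma first_failure (u : nat -> Prop) d :
  u O -> ~ u d -> exists m, (m < d)%nat /\ (forall i, (i <= m)%nat -> u i) /\ ~ u (S m).
Proof.
  intros H0; induction d as [|d IH]; intros Hd; [contradiction|].
  destruct (classic (forall i, (i <= d)%nat -> u i)) as [H|H].
  - exists d; split; [lia|split; assumption].
  - destruct (classic (u d)) as [Hu|Hu].
    + destruct (not_all_ex_not _ _ H) as [i Hi].
      apply imply_to_and in Hi; destruct Hi as [Hi Hui].
      clear IH Hd Hu H; induction i as [i IHi] using lt_wf_ind.
      destruct i as [|i]; [contradiction|].
      destruct (classic (forall j, (j <= i)%nat -> u j)) as [H|H].
      * exists i; split; [lia|split; assumption].
      * destruct (not_all_ex_not _ _ H) as [j Hj].
        apply imply_to_and in Hj; destruct Hj as [Hj Huj].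
        apply (IHi j); [lia|lia|exact Huj].
    + destruct (IH Hu) as [m [Hm Hm']]; exists m; split; [lia|exact Hm'].
Qed.

Section Remainders.
Context (M : nat -> R) (A : R) (W : weight M A).
Local Notation mu := (ratio M).

Lemma weight_add_le n j N : (j + n <= S N)%nat -> M (j + n)%nat <= mu N ^ j * M n.
Proof.
  induction j as [|j IH]; intros H; [simpl; lra|].
  simpl Nat.add; rewrite (weight_S M A W); simpl pow; rewrite Rmult_assoc.
  pose proof (weight_convex M A W (j + n) N ltac:(lia)).
  pose proof (ratio_ge_1 M A W (j + n)); pose proof (weight_pos M A W (j + n)).
  apply Rmult_le_compat; try lra; apply IH; lia.
Qed.

(** In the range [|z| mu N <= 1 / (2 sigma)] the terms of a weighted series
    decrease geometrically up to the index [N], so that the partial sum of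
    order [N] behaves up to level [N] like a function of class [M]. *)
Lemma truncation_remainder K sigma c z n N :
  0 < K -> 0 < sigma -> (forall j, Cmod (c j) <= geometric M K sigma j) ->
  (n <= N)%nat -> Cmod z * mu N <= / (2 * sigma) ->
  Cmod (psum c N z - psum c n z) <= geometric M (2 * K) sigma n * Cmod z ^ n.
Proof.
  intros HK Hs Hc Hn Hz.
  assert (Hs' : 0 <= sigma * (Cmod z * mu N) <= / 2).
  { pose proof (ratio_ge_1 M A W N); pose proof (Cmod_ge_0 z); split.
    - apply Rmult_le_pos; [lra|apply Rmult_le_pos; lra].
    - apply (Rmult_le_compat_l sigma) in Hz; [|lra].
      replace (sigma * / (2 * sigma)) with (/ 2) in Hz by (field; lra); lra. }
  replace N with ((N - n) + n)%nat at 1 by lia.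
  rewrite psum_add.
  replace (_ - _)%C with (z ^ n * psum (fun j => c (j + n)%nat) (N - n) z)%C by ring.
  rewrite Cmod_mult, Cmod_pow, Rmult_comm.
  apply Rmult_le_compat_r; [apply pow_le, Cmod_ge_0|].
  eapply Rle_trans; [apply Cmod_psum_le|].
  pose proof (geometric_pos M A W K sigma n HK Hs) as HG.
  apply Rle_trans with (rsum (fun j => geometric M K sigma n * (/ 2) ^ j) (N - n)).
  - apply rsum_le; intros j Hj.
    apply Rle_trans with (geometric M K sigma n * (sigma * (Cmod z * mu N)) ^ j).
    2:{ apply Rmult_le_compat_l; [lra|apply pow_incr, Hs']. }
    rewrite !Rpow_mult_distr.
    replace (geometric M K sigma n * (sigma ^ j * (Cmod z ^ j * mu N ^ j))) with
      (K * (sigma ^ j * sigma ^ n) * (mu N ^ j * M n) * Cmod z ^ j)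
      by (unfold geometric; ring).
    apply Rmult_le_compat_r; [apply pow_le, Cmod_ge_0|].
    eapply Rle_trans; [apply Hc|]; unfold geometric; rewrite <- pow_add.
    apply Rmult_le_compat_l; [apply Rmult_le_pos; [lra|apply pow_le; lra]|].
    apply weight_add_le; lia.
  - rewrite rsum_scal; pose proof (rsum_half (N - n)).
    replace (geometric M (2 * K) sigma n) with (geometric M K sigma n * 2)
      by (unfold geometric; ring).
    apply Rmult_le_compat_l; [lra|exact H].
Qed.

Context {X : Type} (Z : X -> C) (r : R).
Hypothesis Z_nonzero : forall x, Z x <> RtoC 0.
Hypothesis Z_small : forall eps, 0 < eps -> exists x, Cmod (Z x) < eps.
Hypothesis Z_bounded : forall x, Cmod (Z x) <= r.

Local Notation has_exp := (has_expansion Z everywhere).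
Local Notation has_wexp := (has_weighted_expansion M Z everywhere).

Lemma order_lower_bound f t k :
  has_exp f t -> (forall j, (j < k)%nat -> t j = RtoC 0) -> t k <> RtoC 0 ->
  exists q rho, 0 < q /\ 0 < rho /\
    forall x, Cmod (Z x) <= rho -> q * Cmod (Z x) ^ k <= Cmod (f x).
Proof.
  intros [al H] Ht0 Htk; apply Cmod_gt_0 in Htk.
  pose proof (expansion_nonneg Z everywhere al f t (S k) H) as Hal.
  exists (Cmod (t k) / 2), (Cmod (t k) / (2 * (al (S k) + 1))).
  split; [lra|split; [apply Rdiv_lt_0_compat; lra|]].
  intros x Hx; destruct (H (S k)) as [_ H1]; specialize (H1 x I).
  rewrite psum_S in H1; unfold psum in H1.
  rewrite csum_zero in H1 by (intros j Hj; rewrite Ht0 by exact Hj; ring).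
  assert (T : Cmod (t k * Z x ^ k) <= Cmod (f x) + Cmod (f x - (0 + t k * Z x ^ k))).
  { replace (t k * Z x ^ k)%C with (f x + - (f x - (0 + t k * Z x ^ k)))%C at 1 by ring.
    eapply Rle_trans; [apply Cmod_triangle|rewrite Cmod_opp; lra]. }
  rewrite Cmod_mult, Cmod_pow in T; simpl pow in H1.
  assert (Hk : 0 <= Cmod (Z x) ^ k) by apply pow_le, Cmod_ge_0.
  assert (Hs : al (S k) * Cmod (Z x) <= Cmod (t k) / 2).
  { apply (Rmult_le_compat_l (al (S k) + 1)) in Hx; [|lra].
    replace ((al (S k) + 1) * (Cmod (t k) / (2 * (al (S k) + 1)))) with (Cmod (t k) / 2)
      in Hx by (field; lra).
    pose proof (Cmod_ge_0 (Z x)); lra. }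
  assert (al (S k) * (Cmod (Z x) * Cmod (Z x) ^ k) <= Cmod (t k) / 2 * Cmod (Z x) ^ k).
  { rewrite <- Rmult_assoc; apply Rmult_le_compat_r; assumption. }
  lra.
Qed.

Context (d : nat) (a : nat -> X -> C) (h : X -> C) (c : nat -> C).
Hypothesis a_weighted : forall i, (1 <= i <= d)%nat -> exists b, has_wexp (a i) b.
Hypothesis h_expansion : has_exp h c.
Hypothesis h_root : forall x, taylor2 d (fun l => a l x) (h x) 0 0 = RtoC 0.

Local Notation tay f j i := (fun x => taylor2 d (fun l => a l x) (f x) j i).

(** Let [v] be the remainder of [h] of order [N].  In the Taylor formula at the
    partial sum, the coefficients of order at most [m] vanish as power series,
    hence are [O(z^N)] with the constants of class [M], and the term of order
    [m + 1] dominates the later ones since [v] is small. *)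
Lemma remainder_power m k t :
  (m < d)%nat -> weighted M c ->
  (forall i, (i <= m)%nat -> flat Z (tay h i 0)) ->
  has_exp (tay h m 1) t ->
  (forall j, (j < k)%nat -> t j = RtoC 0) -> t k <> RtoC 0 ->
  exists K sigma s, 0 < K /\ 0 < sigma /\ 0 < s /\ forall x N, (k < N)%nat ->
    Cmod (Z x) * mu N <= s ->
    Cmod (h x - psum c N (Z x)) ^ S m
    <= geometric M K sigma N * Cmod (Z x) ^ (N - k).
Proof.
  intros Hmd [K0 [s0 [HK0 [Hs0 Hc]]]] Hflat Ht Ht0 Htk.
  (* points paired with a truncation order: a single expansion on this set speaks
     of all partial sums at once, with constants that do not depend on the order *)
  set (X' := {p : X * nat | Cmod (Z (fst p)) * mu (snd p) <= / (2 * s0)}).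
  set (pt := fun q : X' => fst (proj1_sig q)).
  set (ord := fun q : X' => snd (proj1_sig q)).
  set (Z' := fun q => Z (pt q)).
  set (L' := fun (q : X') n => (n <= ord q)%nat).
  assert (L'd : forall q m n, (m <= n)%nat -> L' q n -> L' q m) by (unfold L'; intros; lia).
  set (P := fun q : X' => psum c (ord q) (Z' q)).
  pose proof (weighted_functions_algebra M A W Z' L' L'd) as WA.
  pose proof (@bounded_functions_algebra X') as BA.
  assert (lift : forall f b, has_wexp f b ->
            has_weighted_expansion M Z' L' (fun q => f (pt q)) b).
  { intros f b [K [s [HK [Hs H]]]]; exists K, s; split; [exact HK|split; [exact Hs|]].
    intros n; split; [apply H|]; intros q _; apply (proj2 (H n) (pt q) I). }
  assert (PE : expansion Z' L' (geometric M (2 * K0) s0) P c).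
  { intros n; split.
    - eapply Rle_trans; [apply Hc|]; apply (geometric_le M A W); lra.
    - intros q Hq; apply truncation_remainder; auto.
      apply (proj2_sig q). }
  assert (PW : exists b, has_weighted_expansion M Z' L' P b).
  { exists c, (2 * K0), s0; split; [lra|split; [exact Hs0|exact PE]]. }
  assert (aW : forall i, (1 <= i <= d)%nat ->
     exists b, has_weighted_expansion M Z' L' (fun q => a i (pt q)) b).
  { intros i Hi; destruct (a_weighted i Hi) as [b Hb]; exists b; apply lift, Hb. }
  assert (wb : forall f, (exists b, has_weighted_expansion M Z' L' f b) -> bounded f).
  { intros f [b [K [s [_ [_ H]]]]]; exists (geometric M K s O); intros q.
    apply (expansion_bounded Z' L' L'd _ f b q O H); unfold L'; lia. }
  assert (hb : bounded (fun q => h (pt q))).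
  { destruct (has_expansion_bounded Z h c h_expansion) as [B HB]; exists B; intros; apply HB. }
  set (F := fun i q => taylor2 d (fun l => a l (pt q)) (P q) i 0).
  assert (FW : forall i, exists b, has_weighted_expansion M Z' L' (F i) b).
  { intros i; apply (function_algebra_taylor2 _ WA d (fun l q => a l (pt q)) P aW PW i 0). }
  set (v := fun q => (h (pt q) - P q)%C).
  assert (vb : bounded v) by exact (function_algebra_minus _ BA _ _ hb (wb P PW)).
  assert (FL : forall i, exists B, 0 <= B /\ forall q,
     Cmod (F i q - taylor2 d (fun l => a l (pt q)) (h (pt q)) i 0) <= B * Cmod (v q)).
  { intros i; destruct (taylor2_lipschitz d (fun l q => a l (pt q)) (fun q => h (pt q)) P i)
      as [B [HB0 HB]].
    { intros l Hl; exact (wb _ (aW l Hl)). }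
    { exact hb. }
    { exact (wb P PW). }
    exists B; split; [exact HB0|]; intros q; specialize (HB q); cbv beta in HB.
    rewrite <- Cmod_opp.
    replace (- (F i q - _))%C with
      (taylor2 d (fun l => a l (pt q)) (h (pt q)) i 0 - F i q)%C by ring.
    exact HB. }
  destruct h_expansion as [al Hal].
  assert (vB : forall n q, L' q n ->
     Cmod (v q) <= (al n + geometric M (2 * K0) s0 n) * Cmod (Z' q) ^ n).
  { intros n q Hq; unfold v.
    replace (h (pt q) - P q)%C with
      ((h (pt q) - psum c n (Z' q)) + - (P q - psum c n (Z' q)))%C by ring.
    eapply Rle_trans; [apply Cmod_triangle|]; rewrite Cmod_opp, Rmult_plus_distr_r.
    apply Rplus_le_compat; [apply (proj2 (Hal n) (pt q) I)|apply (proj2 (PE n) q Hq)]. }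
  (* F i has an expansion of class M, and agrees to every order with the flat
     i-th divided derivative at h, so that its coefficients vanish *)
  assert (Fsmall : forall i, (i <= m)%nat -> exists K s, 0 < K /\ 0 < s /\ forall q,
     Cmod (F i q) <= geometric M K s (ord q) * Cmod (Z' q) ^ ord q).
  { intros i Hi; destruct (FW i) as [b [K [s [HK [Hs H]]]]].
    exists K, s; split; [exact HK|split; [exact Hs|]].
    destruct (FL i) as [B [HB0 HB]].
    destruct (proj1 (flat_iff Z _) (Hflat i Hi)) as [be Hbe].
    assert (b0 : forall j, b j = RtoC 0).
    { intros j.
      set (z0 := fun n : nat => match n with O => RtoC 0 | _ => RtoC 0 end).
      transitivity (z0 j); [|destruct j; reflexivity].
      apply (expansion_unique Z' L' (geometric M K s)
        (fun n => match n with O => Cmod 0 | _ => 0 end)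
        (fun n => B * (al n + geometric M (2 * K0) s0 n) + be n)
        (F i) (fun _ => RtoC 0) b z0 (S j)).
      - intros n eps Heps; pose proof (ratio_ge_1 M A W n).
        assert (0 < / (2 * s0)) by (apply Rinv_0_lt_compat; lra).
        destruct (Z_small (Rmin eps (/ (2 * s0) / mu n))) as [x Hx].
        { apply Rmin_pos; [exact Heps|apply Rdiv_lt_0_compat; lra]. }
        assert (Hx' : Cmod (Z (fst (x, n))) * mu (snd (x, n)) <= / (2 * s0)).
        { simpl; apply Rle_trans with (/ (2 * s0) / mu n * mu n).
          - apply Rmult_le_compat_r; [lra|]; left.
            eapply Rlt_le_trans; [exact Hx|apply Rmin_r].
          - right; field; lra. }
        exists (exist _ (x, n) Hx'); split; [unfold L', ord; simpl; lia|].
        unfold Z', pt; simpl; split; [apply Cmod_gt_0, Z_nonzero|].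
        eapply Rlt_le_trans; [exact Hx|apply Rmin_l].
      - exact H.
      - apply expansion_const.
      - intros q n _ Hq.
        replace (F i q - 0)%C with
          ((F i q - taylor2 d (fun l => a l (pt q)) (h (pt q)) i 0)
           + taylor2 d (fun l => a l (pt q)) (h (pt q)) i 0)%C by ring.
        eapply Rle_trans; [apply Cmod_triangle|]; rewrite Rmult_plus_distr_r.
        apply Rplus_le_compat.
        + eapply Rle_trans; [apply HB|]; rewrite Rmult_assoc.
          apply Rmult_le_compat_l; [exact HB0|apply vB, Hq].
        + destruct (Hbe n) as [_ Hn]; specialize (Hn (pt q) I).
          unfold psum in Hn; rewrite csum_zero in Hn by (intros; ring).
          replace (_ - 0)%C with (taylor2 d (fun l => a l (pt q)) (h (pt q)) i 0) in Hn by ring.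
          exact Hn.
      - lia. }
    intros q; destruct (H (ord q)) as [_ Hq].
    specialize (Hq q ltac:(unfold L'; lia)).
    unfold psum in Hq; rewrite csum_zero in Hq by (intros; rewrite b0; ring).
    replace (F i q - 0)%C with (F i q) in Hq by ring; exact Hq. }
  set (Q := fun q => csum (fun i => F i q * v q ^ i)%C (S m)).
  assert (QB : exists K s, 0 < K /\ 0 < s /\ forall q,
     Cmod (Q q) <= geometric M K s (ord q) * Cmod (Z' q) ^ ord q).
  { destruct vb as [B HB].
    assert (G : forall n, (n <= S m)%nat -> exists K s, 0 < K /\ 0 < s /\ forall q,
      Cmod (csum (fun i => F i q * v q ^ i)%C n)
      <= geometric M K s (ord q) * Cmod (Z' q) ^ ord q).
    { induction n as [|n IH]; intros Hn.
      - exists 1, 1; split; [lra|split; [lra|]]; intros q; simpl; rewrite Cmod_0.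
        apply Rmult_le_pos; [left; apply (geometric_pos M A W); lra|apply pow_le, Cmod_ge_0].
      - destruct (IH ltac:(lia)) as [K [s [HK [Hs H]]]].
        destruct (Fsmall n ltac:(lia)) as [K' [s' [HK' [Hs' H']]]].
        set (B' := Rmax 1 B ^ n).
        assert (HB' : 1 <= B') by (apply pow_ge_1, Rmax_l).
        assert (HKB : 0 < K' * B') by (apply Rmult_lt_0_compat; lra).
        exists (K + K' * B'), (Rmax s s'); split; [lra|split].
        { eapply Rlt_le_trans; [exact Hs|apply Rmax_l]. }
        intros q; simpl csum; eapply Rle_trans; [apply Cmod_triangle|].
        eapply Rle_trans.
        2:{ apply Rmult_le_compat_r; [apply pow_le, Cmod_ge_0|].
            apply (geometric_plus M A W); assumption. }
        rewrite Rmult_plus_distr_r; apply Rplus_le_compat; [apply H|].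
        rewrite Cmod_mult, Cmod_pow.
        replace (geometric M (K' * B') s' (ord q) * Cmod (Z' q) ^ ord q) with
          (geometric M K' s' (ord q) * Cmod (Z' q) ^ ord q * B')
          by (unfold geometric; ring).
        apply Rmult_le_compat; try apply Cmod_ge_0; [apply pow_le, Cmod_ge_0|apply H'|].
        apply pow_incr; split; [apply Cmod_ge_0|].
        eapply Rle_trans; [apply HB|apply Rmax_r]. }
    apply G; lia. }
  set (T := fun q => csum (fun i => F (S m + S i)%nat q * v q ^ i)%C (d - S m)).
  assert (TB : bounded T).
  { apply (function_algebra_csum _ BA (fun i q => F (S m + S i)%nat q * v q ^ i)%C).
    intros i _; apply (proj2 (proj2 BA)); [apply wb, FW|].
    apply (function_algebra_pow _ BA), vb. }
  assert (Main : forall q, (F (S m) q * v q ^ S m)%C = (- (Q q + v q ^ (m + 2) * T q))%C).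
  { intros q; pose proof (h_root (pt q)) as E.
    replace (h (pt q)) with (P q + v q)%C in E by (unfold v; ring).
    rewrite taylor2_shift in E.
    replace (S d) with (S m + S (d - S m))%nat in E by lia.
    rewrite csum_split, (csum_shift (fun i => taylor2 d (fun l => a l (pt q)) (P q) 0 (S m + i)
      * v q ^ (S m + i))%C) in E.
    rewrite (csum_ext (fun i => taylor2 d (fun l => a l (pt q)) (P q) 0 i * v q ^ i)%C
      (fun i => F i q * v q ^ i)%C (S m)) in E
      by (intros; unfold F; rewrite taylor2_sym; reflexivity).
    rewrite (csum_ext (fun i => taylor2 d (fun l => a l (pt q)) (P q) 0 (S m + S i) * v q ^ (S m + S i))%C
       (fun i => v q ^ (m + 2) * (F (S m + S i)%nat q * v q ^ i))%C (d - S m)) in E.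
    2:{ intros i _; unfold F; rewrite taylor2_sym.
        replace (S m + S i)%nat with (m + 2 + i)%nat by lia.
        rewrite (Cpow_add_r (v q) (m + 2) i); ring. }
    rewrite csum_scal, taylor2_sym, Nat.add_0_r in E.
    fold (Q q) (T q) (F (S m) q) in E.
    replace (F (S m) q * v q ^ S m)%C with
      ((Q q + (F (S m) q * v q ^ S m + v q ^ (m + 2) * T q))
       - (Q q + v q ^ (m + 2) * T q))%C by ring.
    rewrite E; ring. }
  (* the dominant coefficient F (S m) is at least a multiple of |z|^k, and the
     other terms are smaller because |v| <= D |z|^(k+1) *)
  destruct (order_lower_bound _ t k Ht Ht0 Htk) as [q0 [rho [Hq0 [Hrho Hlow]]]].
  destruct QB as [K [s [HK [Hs HQ]]]], TB as [BT HBT], (FL (S m)) as [BF [HBF0 HBF]].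
  set (D := al (S k) + geometric M (2 * K0) s0 (S k)).
  assert (HD : 0 < D).
  { unfold D; pose proof (expansion_nonneg Z everywhere al h c (S k) Hal).
    pose proof (geometric_pos M A W (2 * K0) s0 (S k)); lra. }
  assert (Hm1 : 0 < INR (S m)) by (apply lt_0_INR; lia).
  set (q1 := q0 / INR (S m)).
  assert (Hq1 : 0 < q1) by (apply Rdiv_lt_0_compat; assumption).
  set (B := BF + Rmax 0 BT).
  assert (HB : 0 <= B) by (unfold B; pose proof (Rmax_l 0 BT); lra).
  set (rho1 := Rmin rho (q1 / 2 / (D * (B + 1)))).
  assert (HDB : 0 < D * (B + 1)) by (apply Rmult_lt_0_compat; lra).
  assert (Hrho1 : 0 < rho1) by (apply Rmin_pos; [exact Hrho|apply Rdiv_lt_0_compat; lra]).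
  exists (2 / q1 * K), s, (Rmin (/ (2 * s0)) rho1).
  split; [apply Rmult_lt_0_compat; [apply Rdiv_lt_0_compat|]; lra|].
  split; [exact Hs|split].
  { apply Rmin_pos; [apply Rinv_0_lt_compat; lra|exact Hrho1]. }
  intros x N HN Hx.
  assert (Hx1 : Cmod (Z (fst (x, N))) * mu (snd (x, N)) <= / (2 * s0))
    by (eapply Rle_trans; [exact Hx|apply Rmin_l]).
  assert (Hx2 : Cmod (Z x) <= rho1).
  { pose proof (ratio_ge_1 M A W N); pose proof (Cmod_ge_0 (Z x)).
    apply Rle_trans with (Cmod (Z x) * mu N); [nra|].
    eapply Rle_trans; [exact Hx|apply Rmin_r]. }
  set (q := exist _ (x, N) Hx1 : X').
  specialize (HQ q); specialize (HBT q); specialize (HBF q); specialize (Main q).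
  specialize (Hlow x (Rle_trans _ _ _ Hx2 (Rmin_l _ _))).
  pose proof (vB (S k) q HN) as Hv.
  change (ord q) with N in *; change (pt q) with x in *; change (Z' q) with (Z x) in *.
  change (h x - psum c N (Z x))%C with (v q).
  fold D in Hv.
  set (w := Cmod (v q)) in *; set (z := Cmod (Z x)) in *.
  assert (Hw0 : 0 <= w) by apply Cmod_ge_0.
  assert (Hz0 : 0 < z) by apply Cmod_gt_0, Z_nonzero.
  assert (Hzk : 0 < z ^ k) by (apply pow_lt, Hz0).
  assert (HF : q1 * z ^ k - BF * w <= Cmod (F (S m) q)).
  { rewrite taylor2_one, Cmod_mult, Cmod_R, Rabs_right in Hlow by lra.
    assert (q1 * z ^ k <= Cmod (taylor2 d (fun l => a l x) (h x) (S m) 0)).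
    { apply Rmult_le_reg_l with (INR (S m)); [exact Hm1|].
      unfold q1; replace (INR (S m) * (q0 / INR (S m) * z ^ k)) with (q0 * z ^ k)
        by (field; lra); exact Hlow. }
    assert (Cmod (taylor2 d (fun l => a l x) (h x) (S m) 0) <= Cmod (F (S m) q) + BF * w).
    { replace (taylor2 d (fun l => a l x) (h x) (S m) 0) with
       (F (S m) q + - (F (S m) q - taylor2 d (fun l => a l x) (h x) (S m) 0))%C at 1 by ring.
      eapply Rle_trans; [apply Cmod_triangle|]; rewrite Cmod_opp; lra. }
    lra. }
  assert (HBw : B * w <= q1 / 2 * z ^ k).
  { apply Rle_trans with (B * (D * z ^ S k)); [apply Rmult_le_compat_l; lra|].
    simpl pow; replace (B * (D * (z * z ^ k))) with (B * D * z * z ^ k) by ring.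
    apply Rmult_le_compat_r; [lra|].
    assert (z <= q1 / 2 / (D * (B + 1))) by (eapply Rle_trans; [exact Hx2|apply Rmin_r]).
    apply Rle_trans with (D * (B + 1) * (q1 / 2 / (D * (B + 1)))).
    - apply Rmult_le_compat; nra.
    - right; field; split; lra. }
  assert (Hwm : 0 <= w ^ S m) by (apply pow_le, Hw0).
  assert (HM : Cmod (F (S m) q) * w ^ S m <= Cmod (Q q) + w * w ^ S m * Rmax 0 BT).
  { unfold w at 1; rewrite <- Cmod_pow, <- Cmod_mult, Main, Cmod_opp.
    eapply Rle_trans; [apply Cmod_triangle|apply Rplus_le_compat_l].
    rewrite Cmod_mult, Cmod_pow; fold w.
    replace (m + 2)%nat with (S (S m)) by lia; simpl pow.
    apply Rmult_le_compat; [apply Rmult_le_pos; [lra|exact Hwm]|apply Cmod_ge_0|lra|].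
    eapply Rle_trans; [exact HBT|apply Rmax_r]. }
  assert (HE : q1 / 2 * z ^ k * w ^ S m <= geometric M K s N * z ^ N).
  { apply Rle_trans with (Cmod (Q q)); [|exact HQ].
    assert (q1 / 2 * z ^ k <= Cmod (F (S m) q) - w * Rmax 0 BT) by (unfold B in HBw; lra).
    apply Rle_trans with ((Cmod (F (S m) q) - w * Rmax 0 BT) * w ^ S m); [|lra].
    apply Rmult_le_compat_r; assumption. }
  apply Rmult_le_reg_l with (q1 / 2 * z ^ k).
  { apply Rmult_lt_0_compat; lra. }
  eapply Rle_trans; [exact HE|right].
  replace N with (k + (N - k))%nat at 2 by lia; rewrite pow_add.
  unfold geometric; field; lra.
Qed.

(** The previous estimate at the order [N = (m + 1) n + k + 1] bounds the
    [m + 1]-st power of the remainder by [M N |z|^((m + 1) n + 1)], and moderate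
    growth compares this to the [m + 1]-st power of [M n |z|^n]. *)
Lemma remainder_near_vertex m k t :
  (m < d)%nat -> weighted M c ->
  (forall i, (i <= m)%nat -> flat Z (tay h i 0)) ->
  has_exp (tay h m 1) t ->
  (forall j, (j < k)%nat -> t j = RtoC 0) -> t k <> RtoC 0 ->
  exists K sigma s, 0 < K /\ 0 < sigma /\ 0 < s /\ forall x n,
    Cmod (Z x) * mu n <= s ->
    Cmod (h x - psum c n (Z x)) <= geometric M K sigma n * Cmod (Z x) ^ n.
Proof.
  intros Hmd Hcw Hflat Ht Ht0 Htk.
  destruct (remainder_power m k t Hmd Hcw Hflat Ht Ht0 Htk)
    as [K [s [s1 [HK [Hs [Hs1 H]]]]]].
  destruct Hcw as [K0 [s0 [HK0 [Hs0 Hc]]]].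
  pose proof (weight_A M A W) as HA.
  set (s2 := Rmin (Rmin s1 1) (/ (2 * s0))).
  assert (Hs2 : 0 < s2).
  { apply Rmin_pos; [apply Rmin_pos; lra|apply Rinv_0_lt_compat; lra]. }
  set (p := (m + k + 2)%nat).
  set (b := Rmax 1 s * A ^ S m).
  assert (Hb : 1 <= b).
  { unfold b; pose proof (pow_ge_1 A (S m) HA); pose proof (Rmax_l 1 s); nra. }
  set (B := K * b ^ S k * M (S k)).
  assert (HB : 0 <= B).
  { unfold B; pose proof (weight_pos M A W (S k)).
    apply Rmult_le_pos; [apply Rmult_le_pos; [|apply pow_le]|]; lra. }
  set (K5 := Rmax 1 B); assert (HK5 : 1 <= K5) by apply Rmax_l.
  exists (K5 + 2 * K0), (Rmax b s0), (s2 / A ^ S p).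
  assert (HAp : 0 < A ^ S p) by (apply pow_lt; lra).
  split; [lra|split; [eapply Rlt_le_trans; [|apply Rmax_l]; lra|]].
  split; [apply Rdiv_lt_0_compat; assumption|].
  intros x n Hx; set (N := (S m * n + S k)%nat).
  assert (HmuN : Cmod (Z x) * mu N <= s2).
  { apply Rle_trans with (Cmod (Z x) * (A ^ S p * mu n)).
    - apply Rmult_le_compat_l; [apply Cmod_ge_0|].
      eapply Rle_trans; [|apply (ratio_dilate M A W)].
      apply (weight_convex M A W); unfold N, p; nia.
    - apply (Rmult_le_compat_l (A ^ S p)) in Hx; [|lra].
      replace (A ^ S p * (s2 / A ^ S p)) with s2 in Hx by (field; lra); lra. }
  assert (L1 : s2 <= s1) by (eapply Rle_trans; [apply Rmin_l|apply Rmin_l]).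
  assert (L2 : s2 <= 1) by (eapply Rle_trans; [apply Rmin_l|apply Rmin_r]).
  assert (L3 : s2 <= / (2 * s0)) by apply Rmin_r.
  specialize (H x N ltac:(unfold N; lia) ltac:(lra)).
  pose proof (truncation_remainder K0 s0 c (Z x) n N HK0 Hs0 Hc ltac:(unfold N; nia) ltac:(lra)) as Htr.
  set (z := Cmod (Z x)) in *.
  assert (Hz0 : 0 <= z) by apply Cmod_ge_0.
  assert (Hz1 : z <= 1) by (pose proof (ratio_ge_1 M A W N); nra).
  set (w := Cmod (h x - psum c N (Z x))) in *.
  assert (Hw : w <= geometric M K5 b n * z ^ n).
  { pose proof (weight_pos M A W n) as HMn; pose proof (weight_pos M A W (S k)) as HMk.
    assert (Hbn : 0 < b ^ n) by (apply pow_lt; lra).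
    assert (Hzn : 0 <= z ^ n) by (apply pow_le, Hz0).
    assert (0 <= b ^ n * M n * z ^ n)
      by (apply Rmult_le_pos; [apply Rmult_le_pos|]; lra).
    apply pow_base_le with m.
    { apply Rmult_le_pos; [left; apply (geometric_pos M A W); lra|exact Hzn]. }
    eapply Rle_trans; [exact H|].
    apply Rle_trans with (B * (b ^ n * M n * z ^ n) ^ S m).
    - assert (E1 : z ^ (N - k) <= (z ^ n) ^ S m).
      { rewrite <- pow_mult; replace (N - k)%nat with (1 + n * S m)%nat by (unfold N; nia).
        rewrite pow_add, pow_1; assert (0 <= z ^ (n * S m)) by (apply pow_le, Hz0); nra. }
      assert (E2 : geometric M K s N <= B * (b ^ n * M n) ^ S m).
      { unfold geometric; apply Rle_trans with
          (K * Rmax 1 s ^ N * (A ^ (S m * N) * (M n ^ S m * M (S k)))).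
        - apply Rmult_le_compat.
          + apply Rmult_le_pos; [lra|apply pow_le; lra].
          + left; apply (weight_pos M A W).
          + apply Rmult_le_compat_l; [lra|apply pow_incr; split; [lra|apply Rmax_r]].
          + apply (weight_growth_iter M A W).
        - right; rewrite pow_mult; unfold B.
          replace (K * Rmax 1 s ^ N * ((A ^ S m) ^ N * (M n ^ S m * M (S k)))) with
            (K * (Rmax 1 s ^ N * (A ^ S m) ^ N) * (M n ^ S m * M (S k))) by ring.
          rewrite <- Rpow_mult_distr; fold b; unfold N.
          rewrite (pow_add b), (Nat.mul_comm (S m) n), (pow_mult b n (S m)), Rpow_mult_distr.
          ring. }
      rewrite (Rpow_mult_distr (b ^ n * M n)), <- Rmult_assoc.
      apply Rmult_le_compat; [left; apply (geometric_pos M A W); assumption|apply pow_le, Hz0|exact E2|exact E1].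
    - replace (geometric M K5 b n * z ^ n) with (K5 * (b ^ n * M n * z ^ n))
        by (unfold geometric; ring).
      rewrite (Rpow_mult_distr K5); apply Rmult_le_compat_r; [apply pow_le; assumption|].
      apply Rle_trans with K5; [apply Rmax_r|].
      rewrite <- (pow_1 K5) at 1; apply Rle_pow; [exact HK5|lia]. }
  replace (h x - psum c n (Z x))%C with
    ((h x - psum c N (Z x)) + (psum c N (Z x) - psum c n (Z x)))%C by ring.
  eapply Rle_trans; [apply Cmod_triangle|]; fold w.
  eapply Rle_trans.
  2:{ apply Rmult_le_compat_r; [apply pow_le, Hz0|].
      apply (geometric_plus M A W); lra. }
  lra.
Qed.

(** Away from the vertex, passing from the order [n] to [n + 1] costs a constant
    factor, because [|z| mu n] is bounded from below there. *)
Lemma remainder_everywhere :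
  weighted M c ->
  (exists K sigma s, 0 < K /\ 0 < sigma /\ 0 < s /\ forall x n,
    Cmod (Z x) * mu n <= s ->
    Cmod (h x - psum c n (Z x)) <= geometric M K sigma n * Cmod (Z x) ^ n) ->
  has_wexp h c.
Proof.
  intros [K0 [s0 [HK0 [Hs0 Hc]]]] [K [s1 [s [HK [Hs1 [Hs H]]]]]].
  destruct (has_expansion_bounded Z h c h_expansion) as [B HB].
  pose proof (weight_A M A W) as HA.
  set (K' := Rmax (Rmax K K0) B); set (lam := Rmax (Rmax s1 s0) (2 * A ^ 2 / s)).
  assert (k1 : K <= K') by (eapply Rle_trans; [apply Rmax_l|apply Rmax_l]).
  assert (k2 : K0 <= K') by (eapply Rle_trans; [apply Rmax_r|apply Rmax_l]).
  assert (k3 : B <= K') by apply Rmax_r.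
  assert (l1 : s1 <= lam) by (eapply Rle_trans; [apply Rmax_l|apply Rmax_l]).
  assert (l2 : s0 <= lam) by (eapply Rle_trans; [apply Rmax_r|apply Rmax_l]).
  assert (l3 : 2 * A ^ 2 / s <= lam) by apply Rmax_r.
  assert (HA2 : 0 < A ^ 2) by (apply pow_lt; lra).
  exists K', lam; split; [lra|split; [lra|]].
  intros n; split.
  { eapply Rle_trans; [apply Hc|]; apply (geometric_le M A W); lra. }
  intros x _; induction n as [|n IH].
  { unfold psum, geometric; simpl; rewrite (weight_0 M A W).
    replace (h x - 0)%C with (h x) by ring; specialize (HB x); lra. }
  destruct (Rle_lt_dec (Cmod (Z x) * mu (S n)) s) as [Hle|Hlt].
  { eapply Rle_trans; [apply H, Hle|].
    apply Rmult_le_compat_r; [apply pow_le, Cmod_ge_0|].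
    apply (geometric_le M A W); lra. }
  set (z := Cmod (Z x)) in *; assert (Hz0 : 0 <= z) by apply Cmod_ge_0.
  pose proof (ratio_dilate M A W 1 n) as Hd; rewrite Nat.mul_1_l in Hd.
  assert (Hzm : 2 <= lam * (z * mu n)).
  { assert (s <= A ^ 2 * (z * mu n)).
    { apply Rle_trans with (z * mu (S n)); [lra|].
      replace (A ^ 2 * (z * mu n)) with (z * (A ^ 2 * mu n)) by ring.
      apply Rmult_le_compat_l; assumption. }
    apply Rle_trans with (2 * A ^ 2 / s * (z * mu n)).
    - replace 2 with (2 / s * s) at 1 by (field; lra).
      replace (2 * A ^ 2 / s * (z * mu n)) with (2 / s * (A ^ 2 * (z * mu n))) by (field; lra).
      apply Rmult_le_compat_l; [left; apply Rdiv_lt_0_compat; lra|assumption].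
    - apply Rmult_le_compat_r; [|exact l3].
      pose proof (ratio_ge_1 M A W n); apply Rmult_le_pos; lra. }
  rewrite psum_S.
  replace (h x - _)%C with ((h x - psum c n (Z x)) + - (c n * Z x ^ n))%C by ring.
  eapply Rle_trans; [apply Cmod_triangle|]; rewrite Cmod_opp, Cmod_mult, Cmod_pow; fold z.
  assert (Hzn : 0 <= z ^ n) by (apply pow_le, Hz0).
  assert (Hcn : Cmod (c n) * z ^ n <= geometric M K' lam n * z ^ n).
  { apply Rmult_le_compat_r; [exact Hzn|].
    eapply Rle_trans; [apply Hc|]; apply (geometric_le M A W); lra. }
  replace (geometric M K' lam (S n) * z ^ S n) with
    (lam * (z * mu n) * (geometric M K' lam n * z ^ n))
    by (unfold geometric; rewrite (weight_S M A W); simpl; ring).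
  pose proof (geometric_pos M A W K' lam n ltac:(lra) ltac:(lra)).
  assert (0 <= geometric M K' lam n * z ^ n) by (apply Rmult_le_pos; lra).
  nra.
Qed.

(** The index [m] is the last one before the first divided derivative that is
    not flat at [h]; it exists since the [d]-th one is the constant 1. *)
Theorem root_weighted_expansion : (1 <= d)%nat -> has_wexp h c.
Proof.
  intros Hd.
  assert (Top : ~ flat Z (tay h d 0)).
  { intros H; destruct (H 1%nat) as [B HB].
    destruct (Z_small (/ (Rmax 0 B + 1))) as [x Hx].
    { apply Rinv_0_lt_compat; pose proof (Rmax_l 0 B); lra. }
    specialize (HB x); rewrite taylor2_lead, Cmod_1, pow_1 in HB.
    pose proof (Rmax_l 0 B); pose proof (Rmax_r 0 B); pose proof (Cmod_ge_0 (Z x)).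
    apply (Rmult_lt_compat_l (Rmax 0 B + 1)) in Hx; [|lra].
    rewrite Rinv_r in Hx by lra; nra. }
  destruct (first_failure (fun i => flat Z (tay h i 0)) d) as [m [Hm [Hlow Hnext]]];
    [|exact Top|].
  { intros n; exists 0; intros x; rewrite h_root, Cmod_0; lra. }
  assert (Ht : exists t, has_exp (tay h m 1) t).
  { pose proof (expandable_functions_algebra Z everywhere everywhere_down) as EA.
    apply (function_algebra_taylor2 _ EA).
    - intros j Hj; destruct (a_weighted j Hj) as [b Hb]; exists b.
      apply (weighted_has_expansion M), Hb.
    - exists c; exact h_expansion. }
  destruct Ht as [t Ht].
  destruct (least_nonzero t) as [Hz|[k [Htk Ht0]]].
  - exfalso; apply Hnext.
    assert (Hf : flat Z (tay h m 1)).
    { apply flat_iff; replace (fun _ : nat => RtoC 0) with t; [exact Ht|].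
      apply functional_extensionality, Hz. }
    intros n; destruct (Hf n) as [B HB]; exists B; intros x.
    eapply Rle_trans; [|apply HB]; cbv beta.
    rewrite taylor2_one, Cmod_mult, Cmod_R, Rabs_right by apply Rle_ge, pos_INR.
    rewrite S_INR; pose proof (pos_INR m).
    pose proof (Cmod_ge_0 (taylor2 d (fun l => a l x) (h x) (S m) 0)); nra.
  - assert (Hcw : weighted M c).
    { apply (root_coefficients_weighted M A W Z r Z_nonzero Z_small Z_bounded d a h c
        a_weighted h_expansion m k t Hd); auto. }
    apply remainder_everywhere; [exact Hcw|].
    apply (remainder_near_vertex m k t); assumption.
Qed.
End Remainders.

(** * Differentiation along curves *)

(** Componentwise, so that the product rule and the integrals below reduce to
    those of real functions; [curve_derive_eps] is the complex form. *)
Definition curve_derive (f : R -> C) (t : R) (v : C) : Prop :=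
  is_derive (fun s => Re (f s)) t (Re v) /\ is_derive (fun s => Im (f s)) t (Im v).

Lemma is_derive_eps (g : R -> R) t v :
  is_derive g t v <->
  forall eps, 0 < eps -> exists delta, 0 < delta /\ forall s, Rabs (s - t) < delta ->
    Rabs (g s - g t - (s - t) * v) <= eps * Rabs (s - t).
Proof.
  rewrite is_derive_Reals; split.
  - intros H eps He; destruct (H eps He) as [[delta Hd] H']; simpl in H'.
    exists delta; split; [exact Hd|]; intros s Hs.
    destruct (Req_dec (s - t) 0) as [E|E].
    + replace s with t by lra; replace (g t - g t - (t - t) * v) with 0 by ring.
      rewrite Rabs_R0; replace (t - t) with 0 by ring; rewrite Rabs_R0; lra.
    + specialize (H' (s - t) E Hs); replace (t + (s - t)) with s in H' by ring.
      replace (g s - g t - (s - t) * v) with (((g s - g t) / (s - t) - v) * (s - t))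
        by (field; exact E).
      rewrite Rabs_mult; apply Rmult_le_compat_r; [apply Rabs_pos|lra].
  - intros H eps He; destruct (H (eps / 2) ltac:(lra)) as [delta [Hd H']].
    exists (mkposreal delta Hd); intros h Hh Hhd; simpl in Hhd.
    specialize (H' (t + h)); replace (t + h - t) with h in H' by ring.
    specialize (H' Hhd).
    replace ((g (t + h) - g t) / h - v) with ((g (t + h) - g t - h * v) / h)
      by (field; exact Hh).
    unfold Rdiv; rewrite Rabs_mult, Rabs_inv.
    assert (Hp : 0 < Rabs h) by apply Rabs_pos_lt, Hh.
    apply Rmult_lt_reg_r with (Rabs h); [exact Hp|].
    rewrite Rmult_assoc, Rinv_l by lra; nra.
Qed.

Lemma Cmod_le_parts (z : C) : Cmod z <= Rabs (Re z) + Rabs (Im z).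
Proof.
  replace z with (RtoC (Re z) + RtoC (Im z) * Ci)%C at 1
    by (destruct z; apply injective_projections; simpl; ring).
  eapply Rle_trans; [apply Cmod_triangle|].
  rewrite Cmod_mult, Cmod_Ci, !Cmod_R; lra.
Qed.

Lemma im_le_Cmod (z : C) : Rabs (Im z) <= Cmod z.
Proof. pose proof (Rmax_Cmod z); eapply Rle_trans; [apply Rmax_r|apply H]. Qed.

Lemma curve_derive_eps f t v :
  curve_derive f t v <->
  forall eps, 0 < eps -> exists delta, 0 < delta /\ forall s, Rabs (s - t) < delta ->
    Cmod (f s - f t - RtoC (s - t) * v) <= eps * Rabs (s - t).
Proof.
  assert (ER : forall s, Re (f s - f t - RtoC (s - t) * v) =
     Re (f s) - Re (f t) - (s - t) * Re v).
  { intros s; unfold Re; simpl; ring. }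
  assert (EI : forall s, Im (f s - f t - RtoC (s - t) * v) =
     Im (f s) - Im (f t) - (s - t) * Im v).
  { intros s; unfold Im; simpl; ring. }
  split.
  - intros [H1 H2] eps He; rewrite is_derive_eps in H1, H2.
    destruct (H1 (eps / 2) ltac:(lra)) as [d1 [Hd1 H1']].
    destruct (H2 (eps / 2) ltac:(lra)) as [d2 [Hd2 H2']].
    exists (Rmin d1 d2); split; [apply Rmin_pos; assumption|]; intros s Hs.
    pose proof (Rmin_l d1 d2); pose proof (Rmin_r d1 d2).
    eapply Rle_trans; [apply Cmod_le_parts|]; rewrite ER, EI.
    specialize (H1' s ltac:(lra)); specialize (H2' s ltac:(lra)); lra.
  - intros H; split; apply is_derive_eps; intros eps He;
      destruct (H eps He) as [d [Hd H']]; exists d; (split; [exact Hd|]);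
      intros s Hs; specialize (H' s Hs); (eapply Rle_trans; [|exact H']).
    + rewrite <- ER; apply re_le_Cmod.
    + rewrite <- EI; apply im_le_Cmod.
Qed.

Lemma curve_derive_const k t : curve_derive (fun _ => k) t (RtoC 0).
Proof. split; apply is_derive_Reals, derivable_pt_lim_const. Qed.

Lemma curve_derive_plus f g t v w :
  curve_derive f t v -> curve_derive g t w ->
  curve_derive (fun s => f s + g s)%C t (v + w)%C.
Proof.
  intros [F1 F2] [G1 G2]; split.
  - apply (is_derive_plus (fun s => Re (f s)) (fun s => Re (g s)) t (Re v) (Re w) F1 G1).
  - apply (is_derive_plus (fun s => Im (f s)) (fun s => Im (g s)) t (Im v) (Im w) F2 G2).
Qed.

Lemma curve_derive_mult f g t v w :
  curve_derive f t v -> curve_derive g t w ->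
  curve_derive (fun s => f s * g s)%C t (v * g t + f t * w)%C.
Proof.
  intros [F1 F2] [G1 G2]; split.
  - apply (is_derive_ext (fun s => Re (f s) * Re (g s) - Im (f s) * Im (g s))).
    { intros s; reflexivity. }
    replace (Re (v * g t + f t * w)) with
      ((Re v * Re (g t) + Re (f t) * Re w) - (Im v * Im (g t) + Im (f t) * Im w))
      by (unfold Re, Im; simpl; ring).
    apply (is_derive_minus (fun s => Re (f s) * Re (g s)) (fun s => Im (f s) * Im (g s)));
      apply (is_derive_mult (K := R_AbsRing)); auto; intros; apply Rmult_comm.
  - apply (is_derive_ext (fun s => Re (f s) * Im (g s) + Im (f s) * Re (g s))).
    { intros s; reflexivity. }
    replace (Im (v * g t + f t * w)) with
      ((Re v * Im (g t) + Re (f t) * Im w) + (Im v * Re (g t) + Im (f t) * Re w))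
      by (unfold Re, Im; simpl; ring).
    apply (is_derive_plus (fun s => Re (f s) * Im (g s)) (fun s => Im (f s) * Re (g s)));
      apply (is_derive_mult (K := R_AbsRing)); auto; intros; apply Rmult_comm.
Qed.

Lemma curve_derive_scal k f t v :
  curve_derive f t v -> curve_derive (fun s => k * f s)%C t (k * v)%C.
Proof.
  intros H; replace (k * v)%C with (RtoC 0 * f t + k * v)%C by ring.
  apply (curve_derive_mult (fun _ => k) f); [apply curve_derive_const|exact H].
Qed.

Lemma curve_derive_minus f g t v w :
  curve_derive f t v -> curve_derive g t w ->
  curve_derive (fun s => f s - g s)%C t (v - w)%C.
Proof.
  intros Hf Hg; replace (v - w)%C with (v + (-(1)) * w)%C by ring.
  replace (fun s => f s - g s)%C with (fun s => f s + (-(1)) * g s)%C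
    by (apply functional_extensionality; intros; ring).
  apply curve_derive_plus, curve_derive_scal; assumption.
Qed.

Lemma curve_derive_pow f t v n :
  curve_derive f t v ->
  curve_derive (fun s => f s ^ S n)%C t (RtoC (INR (S n)) * f t ^ n * v)%C.
Proof.
  intros H; induction n as [|n IH].
  - replace (RtoC (INR 1) * f t ^ 0 * v)%C with (v * 1 + f t * 0)%C by (simpl; ring).
    apply (curve_derive_mult f (fun _ => RtoC 1)); [exact H|apply curve_derive_const].
  - replace (RtoC (INR (S (S n))) * f t ^ S n * v)%C with
      (v * f t ^ S n + f t * (RtoC (INR (S n)) * f t ^ n * v))%C
      by (rewrite (S_INR (S n)), RtoC_plus; simpl Cpow; ring).
    apply (curve_derive_mult f (fun s => f s ^ S n)%C); assumption.
Qed.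

Definition dcoef (c : nat -> C) (n : nat) : C := (RtoC (INR (S n)) * c (S n))%C.

Lemma curve_derive_psum c n f t v :
  curve_derive f t v ->
  curve_derive (fun s => psum c n (f s)) t (psum (dcoef c) (n - 1) (f t) * v)%C.
Proof.
  intros H; induction n as [|n IH].
  - replace (psum _ _ _ * v)%C with (RtoC 0) by (unfold psum; simpl; ring).
    apply (curve_derive_const (RtoC 0)).
  - destruct n as [|n].
    + replace (psum _ _ _ * v)%C with (RtoC 0) by (unfold psum; simpl; ring).
      replace (fun s => psum c 1 (f s)) with (fun _ : R => c O)
        by (apply functional_extensionality; intros; unfold psum; simpl; ring).
      apply curve_derive_const.
    + replace (S (S n) - 1)%nat with (S n) by lia.
      replace (S n - 1)%nat with n in IH by lia.
      rewrite psum_S.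
      replace ((psum (dcoef c) n (f t) + dcoef c n * f t ^ n) * v)%C with
        (psum (dcoef c) n (f t) * v + c (S n) * (RtoC (INR (S n)) * f t ^ n * v))%C
        by (unfold dcoef; ring).
      apply (curve_derive_plus (fun s => psum c (S n) (f s)) (fun s => c (S n) * f s ^ S n)%C);
        [exact IH|].
      apply curve_derive_scal, curve_derive_pow, H.
Qed.

(** Projecting on the direction of the increment reduces the estimate to real
    functions, without loss in the constant. *)
Lemma curve_mean_value (E E' : R -> C) (phi phi' : R -> R) a b :
  a <= b ->
  (forall t, a <= t <= b -> curve_derive E t (E' t)) ->
  (forall t, a <= t <= b -> is_derive phi t (phi' t)) ->
  (forall t, a <= t <= b -> Cmod (E' t) <= phi' t) ->
  Cmod (E b - E a) <= phi b - phi a.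
Proof.
  intros Hab HE Hphi Hle.
  assert (Mono : forall g g' : R -> R, (forall t, a <= t <= b -> is_derive g t (g' t)) ->
    (forall t, a <= t <= b -> 0 <= g' t) -> g a <= g b).
  { intros g g' Hg Hg'; destruct (MVT_gen g a b g') as [x [Hx Ex]].
    - intros t Ht; rewrite Rmin_left, Rmax_right in Ht by lra; apply Hg; lra.
    - intros t Ht; rewrite Rmin_left, Rmax_right in Ht by lra.
      apply continuity_pt_filterlim, (ex_derive_continuous g).
      exists (g' t); apply Hg, Ht.
    - rewrite Rmin_left, Rmax_right in Hx by lra; specialize (Hg' x Hx).
      assert (0 <= g' x * (b - a)) by (apply Rmult_le_pos; lra); lra. }
  set (w := (E b - E a)%C).
  destruct (Req_dec (Cmod w) 0) as [H0|H0].
  { rewrite H0.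
    assert (phi a <= phi b); [|lra].
    apply (Mono phi phi' Hphi); intros t Ht; specialize (Hle t Ht).
    pose proof (Cmod_ge_0 (E' t)); lra. }
  assert (Hw : 0 < Cmod w) by (pose proof (Cmod_ge_0 w); lra).
  (* rotate so that the increment becomes real *)
  set (g := fun t => Cmod w * phi t - Re (Cconj w * E t)).
  assert (Hg : g a <= g b).
  { apply (Mono g (fun t => Cmod w * phi' t - Re (Cconj w * E' t))).
    - intros t Ht.
      apply (is_derive_minus (fun t => Cmod w * phi t) (fun t => Re (Cconj w * E t))).
      + apply (is_derive_scal phi t (Cmod w)), Hphi, Ht.
      + apply (curve_derive_scal (Cconj w) E t (E' t) (HE t Ht)).
    - intros t Ht; specialize (Hle t Ht).
      pose proof (re_le_Cmod (Cconj w * E' t)) as H1.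
      rewrite Cmod_mult, Cmod_conj in H1.
      pose proof (Rle_abs (Re (Cconj w * E' t))).
      assert (Cmod w * Cmod (E' t) <= Cmod w * phi' t) by (apply Rmult_le_compat_l; lra).
      lra. }
  unfold g in Hg.
  assert (Hre : Re (Cconj w * E b) - Re (Cconj w * E a) = Cmod w * Cmod w).
  { replace (Cmod w * Cmod w) with (Cmod w ^ 2) by ring; rewrite Cmod2_alt.
    unfold w, Re, Im; simpl; ring. }
  apply Rmult_le_reg_l with (Cmod w); [exact Hw|]; lra.
Qed.

(** * Derivatives on the Riemann surface of the logarithm *)

Definition cis (t : R) : C := (cos t, sin t).

Lemma Cmod_cis t : Cmod (cis t) = 1.
Proof.
  unfold Cmod, cis; simpl fst; simpl snd.
  replace (cos t ^ 2 + sin t ^ 2) with 1; [apply sqrt_1|].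
  pose proof (sin2_cos2 t) as H; unfold Rsqr in H; simpl; lra.
Qed.

Lemma cover_cis p : cover p = (RtoC (fst p) * cis (snd p))%C.
Proof. unfold cover, cis; apply injective_projections; simpl; ring. Qed.

Lemma Cmod_cover p : 0 < fst p -> Cmod (cover p) = fst p.
Proof.
  intros H; rewrite cover_cis, Cmod_mult, Cmod_cis, Cmod_R, Rabs_right; lra.
Qed.

Lemma curve_derive_cis t : curve_derive cis t (Ci * cis t)%C.
Proof.
  split; unfold cis, Re, Im; simpl fst; simpl snd; auto_derive; auto; ring.
Qed.

(** Needed for the difference quotients that define [is_derive_log]: their
    denominators vanish at no nearby point. *)
Lemma cover_injective p q :
  0 < fst p -> 0 < fst q -> Rabs (snd q - snd p) < PI -> cover q = cover p -> q = p.
Proof.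
  intros Hp Hq Hs E.
  assert (E1 : fst q = fst p) by (rewrite <- (Cmod_cover p), <- (Cmod_cover q), E by assumption; reflexivity).
  unfold cover in E; rewrite E1 in E; injection E; intros Es Ec.
  apply Rmult_eq_reg_l in Es; [|lra]; apply Rmult_eq_reg_l in Ec; [|lra].
  set (x := snd q - snd p) in *.
  assert (Cx : cos (2 * (x / 2)) = 1).
  { replace (2 * (x / 2)) with x by field; unfold x.
    rewrite cos_minus, Es, Ec; pose proof (sin2_cos2 (snd p)) as H.
    unfold Rsqr in H; lra. }
  rewrite cos_2a_sin in Cx.
  assert (S0 : sin (x / 2) = 0) by nra.
  apply Rabs_def2 in Hs; pose proof PI_RGT_0.
  assert (x = 0).
  { destruct (Rtotal_order x 0) as [Hx|[Hx|Hx]]; [|exact Hx|].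
    - pose proof (sin_lt_0_var (x / 2) ltac:(lra) ltac:(lra)); lra.
    - pose proof (sin_gt_0 (x / 2) ltac:(lra) ltac:(lra)); lra. }
  apply injective_projections; [exact E1|unfold x in *; lra].
Qed.

Lemma is_derive_log_eps f p l : 0 < fst p -> is_derive_log f p l ->
  forall eps, 0 < eps -> exists delta, 0 < delta /\ forall q,
    Rabs (fst q - fst p) < delta -> Rabs (snd q - snd p) < delta ->
    Cmod (f q - f p - l * (cover q - cover p)) <= eps * Cmod (cover q - cover p).
Proof.
  intros Hp H eps He.
  destruct (H (fun y => Cmod (y - l) <= eps)) as [delta Hd].
  { exists (mkposreal (eps / 2) ltac:(lra)); intros y [Hy1 Hy2]; simpl in Hy1, Hy2.
    eapply Rle_trans; [apply Cmod_le_parts|].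
    unfold ball, Re, Im in *; simpl in *; unfold AbsRing_ball, abs, minus, plus, opp in *; simpl in *.
    lra. }
  pose proof PI_RGT_0.
  exists (Rmin delta (Rmin PI (fst p))); split.
  { apply Rmin_pos; [apply cond_pos|apply Rmin_pos; assumption]. }
  intros q Hq1 Hq2.
  pose proof (Rmin_l delta (Rmin PI (fst p))); pose proof (Rmin_r delta (Rmin PI (fst p))).
  pose proof (Rmin_l PI (fst p)); pose proof (Rmin_r PI (fst p)).
  destruct (classic (q = p)) as [->|Hne].
  { replace (f p - f p - l * (cover p - cover p))%C with (RtoC 0) by ring.
    rewrite Cmod_0; apply Rmult_le_pos; [lra|apply Cmod_ge_0]. }
  assert (Hc : (cover q - cover p)%C <> RtoC 0).
  { intros E; apply Hne, cover_injective; [exact Hp| |lra|].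
    - apply Rabs_def2 in Hq1; lra.
    - replace (cover q) with ((cover q - cover p) + cover p)%C by ring.
      rewrite E; ring. }
  specialize (Hd q).
  assert (Hb : Cmod ((f q - f p) / (cover q - cover p) - l) <= eps).
  { apply Hd; [|exact Hne].
    split; [change (Rabs (fst q - fst p) < delta)|change (Rabs (snd q - snd p) < delta)]; lra. }
  replace (f q - f p - l * (cover q - cover p))%C with
    (((f q - f p) / (cover q - cover p) - l) * (cover q - cover p))%C
    by (field; exact Hc).
  rewrite Cmod_mult; apply Rmult_le_compat_r; [apply Cmod_ge_0|exact Hb].
Qed.

Lemma is_derive_log_unique f p l l' :
  0 < fst p -> is_derive_log f p l -> is_derive_log f p l' -> l = l'.
Proof.
  intros Hp H H'.
  destruct (Req_dec (Cmod (l - l')) 0) as [E|E].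
  { apply Cmod_eq_0 in E; replace l with ((l - l') + l')%C by ring; rewrite E; ring. }
  exfalso; pose proof (Cmod_ge_0 (l - l')).
  destruct (is_derive_log_eps f p l Hp H (Cmod (l - l') / 4) ltac:(lra)) as [d1 [Hd1 H1]].
  destruct (is_derive_log_eps f p l' Hp H' (Cmod (l - l') / 4) ltac:(lra)) as [d2 [Hd2 H2]].
  set (e := Rmin d1 d2 / 2).
  assert (He : 0 < e) by (pose proof (Rmin_pos d1 d2 Hd1 Hd2); unfold e; lra).
  assert (e < d1 /\ e < d2).
  { pose proof (Rmin_l d1 d2); pose proof (Rmin_r d1 d2); unfold e in *; lra. }
  set (q := (fst p + e, snd p)).
  assert (Q1 : Rabs (fst q - fst p) = e).
  { simpl; replace (fst p + e - fst p) with e by ring; apply Rabs_right; lra. }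
  assert (Q2 : Rabs (snd q - snd p) = 0).
  { simpl; replace (snd p - snd p) with 0 by ring; apply Rabs_R0. }
  specialize (H1 q ltac:(lra) ltac:(lra)); specialize (H2 q ltac:(lra) ltac:(lra)).
  assert (Hc : Cmod (cover q - cover p) = e).
  { replace (cover q - cover p)%C with (RtoC e * cis (snd p))%C
      by (rewrite !cover_cis; simpl; rewrite RtoC_plus; ring).
    rewrite Cmod_mult, Cmod_cis, Cmod_R, Rabs_right; lra. }
  assert (B : Cmod (l - l') * e <= 2 * (Cmod (l - l') / 4 * e)).
  { rewrite <- Hc at 1; rewrite <- Cmod_mult.
    replace ((l - l') * (cover q - cover p))%C with
      (- (f q - f p - l * (cover q - cover p)) + (f q - f p - l' * (cover q - cover p)))%C
      by ring.
    eapply Rle_trans; [apply Cmod_triangle|]; rewrite Cmod_opp; rewrite Hc in *; lra. }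
  nra.
Qed.

Lemma sector_open gamma r p : sector gamma r p ->
  exists delta, 0 < delta /\ forall q,
    Rabs (fst q - fst p) < delta -> Rabs (snd q - snd p) < delta -> sector gamma r q.
Proof.
  intros [[H1 H2] H3].
  exists (Rmin (Rmin (fst p) (r - fst p)) (gamma * (PI / 2) - Rabs (snd p))); split.
  { apply Rmin_pos; [apply Rmin_pos|]; lra. }
  intros q Hq1 Hq2.
  set (m := Rmin (fst p) (r - fst p)) in *; set (n := gamma * (PI / 2) - Rabs (snd p)) in *.
  pose proof (Rmin_l m n); pose proof (Rmin_r m n).
  assert (m <= fst p) by apply Rmin_l; assert (m <= r - fst p) by apply Rmin_r.
  apply Rabs_def2 in Hq1; split; [lra|].
  replace (snd q) with (snd p + (snd q - snd p)) by ring.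
  eapply Rle_lt_trans; [apply Rabs_triang|unfold n in *; lra].
Qed.

Lemma is_derive_log_ext gamma r f g p l :
  (forall q, sector gamma r q -> f q = g q) -> sector gamma r p ->
  is_derive_log f p l -> is_derive_log g p l.
Proof.
  intros Hfg Hp; unfold is_derive_log; apply filterlim_ext_loc.
  destruct (sector_open gamma r p Hp) as [delta [Hd H]].
  exists (mkposreal delta Hd); intros q [Hq1 Hq2] _.
  rewrite !Hfg; [reflexivity|exact Hp|].
  unfold ball in *; simpl in *; unfold AbsRing_ball, abs, minus, plus, opp in *; simpl in *.
  apply H; [exact Hq1|exact Hq2].
Qed.

(** The chain rule through which all derivatives on the surface are used: along
    rays, arcs and circles. *)
Lemma curve_derive_log f (path : R -> R * R) t l v :
  0 < fst (path t) -> is_derive_log f (path t) l ->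
  ex_derive (fun s => fst (path s)) t -> ex_derive (fun s => snd (path s)) t ->
  curve_derive (fun s => cover (path s)) t v ->
  curve_derive (fun s => f (path s)) t (l * v)%C.
Proof.
  intros Hp Hf H1 H2 Hc.
  assert (Cont : forall g : R -> R, ex_derive g t -> forall delta, 0 < delta ->
     exists eta, 0 < eta /\ forall s, Rabs (s - t) < eta -> Rabs (g s - g t) < delta).
  { intros g Hg delta Hd.
    apply ex_derive_continuous, continuity_pt_filterlim in Hg.
    destruct (Hg delta Hd) as [eta [Heta H]]; exists eta; split; [exact Heta|].
    intros s Hs; destruct (Req_dec s t) as [->|Hst].
    - replace (g t - g t) with 0 by ring; rewrite Rabs_R0; exact Hd.
    - apply H; split; [split; [exact I|auto]|exact Hs]. }
  apply curve_derive_eps; intros eps He.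
  rewrite curve_derive_eps in Hc.
  pose proof (Cmod_ge_0 l); pose proof (Cmod_ge_0 v).
  set (e1 := Rmin 1 (eps / (2 * (Cmod l + 1)))).
  assert (He1 : 0 < e1) by (apply Rmin_pos; [lra|apply Rdiv_lt_0_compat; lra]).
  set (e2 := eps / (2 * (Cmod v + 1))).
  assert (He2 : 0 < e2) by (apply Rdiv_lt_0_compat; lra).
  destruct (Hc e1 He1) as [d1 [Hd1 D1]].
  destruct (is_derive_log_eps f (path t) l Hp Hf e2 He2) as [d2 [Hd2 D2]].
  destruct (Cont _ H1 d2 Hd2) as [d3 [Hd3 D3]], (Cont _ H2 d2 Hd2) as [d4 [Hd4 D4]].
  exists (Rmin d1 (Rmin d3 d4)); split; [repeat apply Rmin_pos; assumption|].
  intros s Hs.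
  pose proof (Rmin_l d1 (Rmin d3 d4)); pose proof (Rmin_r d1 (Rmin d3 d4)).
  pose proof (Rmin_l d3 d4); pose proof (Rmin_r d3 d4).
  specialize (D1 s ltac:(lra)).
  specialize (D2 (path s) (D3 s ltac:(lra)) (D4 s ltac:(lra))).
  set (dc := (cover (path s) - cover (path t))%C) in *.
  set (x := Rabs (s - t)) in *; assert (Hx : 0 <= x) by apply Rabs_pos.
  assert (Hdc : Cmod dc <= (Cmod v + 1) * x).
  { replace dc with ((dc - RtoC (s - t) * v) + RtoC (s - t) * v)%C by ring.
    eapply Rle_trans; [apply Cmod_triangle|]; rewrite Cmod_mult, Cmod_R; fold x.
    assert (e1 <= 1) by apply Rmin_l; nra. }
  replace (f (path s) - f (path t) - RtoC (s - t) * (l * v))%C with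
    ((f (path s) - f (path t) - l * dc) + l * (dc - RtoC (s - t) * v))%C by ring.
  eapply Rle_trans; [apply Cmod_triangle|]; rewrite Cmod_mult.
  assert (A1 : e2 * Cmod dc <= eps / 2 * x).
  { apply Rle_trans with (e2 * ((Cmod v + 1) * x)); [apply Rmult_le_compat_l; lra|].
    right; unfold e2; field; lra. }
  assert (A2 : Cmod l * Cmod (dc - RtoC (s - t) * v) <= eps / 2 * x).
  { apply Rle_trans with (Cmod l * (e1 * x)); [apply Rmult_le_compat_l; assumption|].
    apply Rle_trans with ((Cmod l + 1) * (eps / (2 * (Cmod l + 1)) * x)).
    - apply Rmult_le_compat; try lra; [apply Rmult_le_pos; lra|].
      apply Rmult_le_compat_r; [exact Hx|apply Rmin_r].
    - right; field; lra. }
  lra.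
Qed.

(** * Chains of derivatives and the Taylor formula at the vertex *)

Definition derivative_chain (S : R * R -> Prop) (G : nat -> R * R -> C) : Prop :=
  forall j p, S p -> is_derive_log (G j) p (G (Datatypes.S j) p).

Lemma is_derive_n_on_unique gamma r f j : forall g g',
  is_derive_n_on (sector gamma r) f j g -> is_derive_n_on (sector gamma r) f j g' ->
  forall p, sector gamma r p -> g p = g' p.
Proof.
  induction j as [|j IH]; simpl; intros g g' H H' p Hp.
  - rewrite H, H' by exact Hp; reflexivity.
  - destruct H as [u [Hu Hd]], H' as [u' [Hu' Hd']].
    apply (is_derive_log_unique u p); [apply Hp|apply Hd, Hp|].
    apply (is_derive_log_ext gamma r u'); [|exact Hp|apply Hd', Hp].
    intros q Hq; symmetry; apply (IH u u' Hu Hu' q Hq).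
Qed.

Lemma is_derive_n_on_restrict (S S' : R * R -> Prop) f j : forall g,
  (forall p, S' p -> S p) -> is_derive_n_on S f j g -> is_derive_n_on S' f j g.
Proof.
  induction j as [|j IH]; simpl; intros g HS H; [auto|].
  destruct H as [u [Hu Hd]]; exists u; split; [apply IH; assumption|auto].
Qed.

(** The derivatives of the various orders come from unrelated existential
    statements; uniqueness of derivatives on the open sector makes them a single
    chain. *)
Lemma A_infty_chain gamma r f : A_infty (sector gamma r) f ->
  exists G, (forall p, sector gamma r p -> G O p = f p) /\
    derivative_chain (sector gamma r) G /\
    (forall j, is_derive_n_on (sector gamma r) f j (G j)) /\
    forall j, exists B, forall p, sector gamma r p -> Cmod (G j p) <= B.
Proof.
  intros [_ H]; apply choice in H; destruct H as [G HG].
  exists G; split; [|split; [|split]].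
  - intros p Hp; apply (HG O), Hp.
  - intros j p Hp; destruct (HG (S j)) as [[u [Hu Hd]] _].
    apply (is_derive_log_ext gamma r u); [|exact Hp|apply Hd, Hp].
    apply (is_derive_n_on_unique gamma r f j); [exact Hu|apply HG].
  - intros j; apply HG.
  - intros j; apply HG.
Qed.

Section VertexTaylor.
Context (gamma r : R) (hgamma : 0 < gamma) (hr : 0 < r).
Context (G : nat -> R * R -> C) (B : nat -> R).
Hypothesis chain : derivative_chain (sector gamma r) G.
Hypothesis bound : forall j p, sector gamma r p -> Cmod (G j p) <= B j.

Lemma axis_in_sector rho : 0 < rho < r -> sector gamma r (rho, 0).
Proof.
  intros H; split; [exact H|]; simpl; rewrite Rabs_R0.
  pose proof PI_RGT_0; apply Rmult_lt_0_compat; lra.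
Qed.

Lemma chain_bound_nonneg j : 0 <= B j.
Proof.
  pose proof (bound j (r / 2, 0) (axis_in_sector (r / 2) ltac:(lra))).
  pose proof (Cmod_ge_0 (G j (r / 2, 0))); lra.
Qed.

Lemma ray_derive j rho theta : sector gamma r (rho, theta) ->
  curve_derive (fun s => G j (s, theta)) rho (G (S j) (rho, theta) * cis theta)%C.
Proof.
  intros Hs; apply (curve_derive_log (G j) (fun s => (s, theta))).
  - apply Hs.
  - apply chain, Hs.
  - simpl; auto_derive; exact I.
  - simpl; auto_derive; exact I.
  - split; unfold cover, cis, Re, Im; simpl; auto_derive; auto; ring.
Qed.

Lemma arc_derive j rho theta : sector gamma r (rho, theta) ->
  curve_derive (fun s => G j (rho, s)) theta
    (G (S j) (rho, theta) * (RtoC rho * (Ci * cis theta)))%C.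
Proof.
  intros Hs; apply (curve_derive_log (G j) (fun s => (rho, s))).
  - apply Hs.
  - apply chain, Hs.
  - simpl; auto_derive; exact I.
  - simpl; auto_derive; exact I.
  - split; unfold cover, cis, Re, Im; simpl; auto_derive; auto; ring.
Qed.

Lemma ray_lipschitz j rho1 rho2 theta :
  0 < rho1 <= rho2 -> sector gamma r (rho2, theta) ->
  Cmod (G j (rho2, theta) - G j (rho1, theta)) <= B (S j) * (rho2 - rho1).
Proof.
  intros H12 [H1 H2]; simpl in H1, H2.
  replace (B (S j) * (rho2 - rho1)) with (B (S j) * rho2 - B (S j) * rho1) by ring.
  assert (Hin : forall s, rho1 <= s <= rho2 -> sector gamma r (s, theta))
    by (intros; split; simpl; lra).
  apply (curve_mean_value (fun s => G j (s, theta)) (fun s => G (S j) (s, theta) * cis theta)%C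
    (fun s => B (S j) * s) (fun _ => B (S j))); [lra| | |].
  - intros s Hs; apply ray_derive, Hin, Hs.
  - intros s _; auto_derive; auto; ring.
  - intros s Hs; rewrite Cmod_mult, Cmod_cis, Rmult_1_r; apply bound, Hin, Hs.
Qed.

Lemma arc_lipschitz j rho theta : sector gamma r (rho, theta) ->
  Cmod (G j (rho, theta) - G j (rho, 0)) <= B (S j) * rho * Rabs theta.
Proof.
  intros [H1 H2]; simpl in H1, H2.
  assert (Gen : forall a b, a <= b -> Rabs a < gamma * (PI / 2) -> Rabs b < gamma * (PI / 2) ->
     Cmod (G j (rho, b) - G j (rho, a)) <= B (S j) * rho * (b - a)).
  { intros a b Hab Ha Hb; apply Rabs_def2 in Ha; apply Rabs_def2 in Hb.
    assert (Hin : forall s, a <= s <= b -> sector gamma r (rho, s))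
      by (intros; split; simpl; [lra|apply Rabs_def1; lra]).
    replace (B (S j) * rho * (b - a)) with (B (S j) * rho * b - B (S j) * rho * a) by ring.
    apply (curve_mean_value (fun s => G j (rho, s))
      (fun s => G (S j) (rho, s) * (RtoC rho * (Ci * cis s)))%C
      (fun s => B (S j) * rho * s) (fun _ => B (S j) * rho)); [lra| | |].
    - intros s Hs; apply arc_derive, Hin, Hs.
    - intros s _; auto_derive; auto; ring.
    - intros s Hs; rewrite !Cmod_mult, Cmod_cis, Cmod_Ci, Cmod_R, Rabs_right by lra.
      rewrite !Rmult_1_r; apply Rmult_le_compat_r; [lra|apply bound, Hin, Hs]. }
  assert (H0 : Rabs 0 < gamma * (PI / 2)).
  { rewrite Rabs_R0; pose proof PI_RGT_0; apply Rmult_lt_0_compat; lra. }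
  destruct (Rle_lt_dec 0 theta) as [Ht|Ht].
  - rewrite (Rabs_right theta) by lra.
    replace theta with (theta - 0) at 2 by ring; apply Gen; assumption.
  - rewrite (Rabs_left theta) by lra.
    rewrite <- Cmod_opp.
    replace (- (G j (rho, theta) - G j (rho, 0)))%C with (G j (rho, 0) - G j (rho, theta))%C by ring.
    replace (- theta) with (0 - theta) by ring; apply Gen; auto; lra.
Qed.

(** A function with bounded derivative is Lipschitz along rays and arcs.  So it has
    a limit along one ray, and the arc of radius [rho], of length
    [rho * theta], transfers it to the other rays. *)
Lemma vertex_limit j :
  exists l, forall p, sector gamma r p -> Cmod (G j p - l) <= B (S j) * fst p.
Proof.
  pose proof (chain_bound_nonneg (S j)) as HB.
  set (x := fun k : nat => r / (INR k + 2)).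
  assert (Hx : forall k, 0 < x k < r).
  { intros k; pose proof (pos_INR k); unfold x; split; [apply Rdiv_lt_0_compat; lra|].
    apply Rmult_lt_reg_r with (INR k + 2); [lra|].
    replace (r / (INR k + 2) * (INR k + 2)) with r by (field; lra); nra. }
  assert (Hx0 : forall eps, 0 < eps -> exists N, forall k, (N <= k)%nat -> x k < eps).
  { intros eps He; destruct (INR_unbounded (r / eps)) as [N HN]; exists N.
    intros k Hk; apply le_INR in Hk; pose proof (pos_INR k).
    assert (r / eps * eps = r) by (field; lra).
    unfold x; apply Rmult_lt_reg_r with (INR k + 2); [lra|].
    replace (r / (INR k + 2) * (INR k + 2)) with r by (field; lra); nra. }
  assert (Lip : forall k n, Cmod (G j (x k, 0) - G j (x n, 0)) <= B (S j) * Rmax (x k) (x n)).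
  { assert (L : forall k n, x n <= x k ->
      Cmod (G j (x k, 0) - G j (x n, 0)) <= B (S j) * x k).
    { intros k n Hle; eapply Rle_trans.
      - apply ray_lipschitz; [split; [apply Hx|exact Hle]|apply axis_in_sector, Hx].
      - apply Rmult_le_compat_l; [exact HB|pose proof (Hx n); lra]. }
    intros k n; destruct (Rle_lt_dec (x n) (x k)) as [Hle|Hlt].
    - rewrite Rmax_left by exact Hle; apply L, Hle.
    - rewrite Rmax_right by lra; rewrite <- Cmod_opp.
      replace (- (G j (x k, 0) - G j (x n, 0)))%C with (G j (x n, 0) - G j (x k, 0))%C by ring.
      apply L; lra. }
  assert (Cauchy : forall eps : posreal, exists N, forall n m, (N <= n)%nat -> (N <= m)%nat ->
     Cmod (G j (x n, 0) - G j (x m, 0)) < eps).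
  { intros eps; pose proof (cond_pos eps).
    destruct (Hx0 (eps / (B (S j) + 1))) as [N HN]; [apply Rdiv_lt_0_compat; lra|].
    exists N; intros n m Hn Hm; eapply Rle_lt_trans; [apply Lip|].
    assert (Hmax : Rmax (x n) (x m) < eps / (B (S j) + 1)) by (apply Rmax_lub_lt; auto).
    apply (Rmult_lt_compat_l (B (S j) + 1)) in Hmax; [|lra].
    replace ((B (S j) + 1) * (eps / (B (S j) + 1))) with (pos eps) in Hmax by (field; lra).
    pose proof (Hx n); pose proof (Rmax_l (x n) (x m)); nra. }
  assert (C1 : ex_finite_lim_seq (fun k => Re (G j (x k, 0)))).
  { apply ex_lim_seq_cauchy_corr; intros eps; destruct (Cauchy eps) as [N HN].
    exists N; intros n m Hn Hm; eapply Rle_lt_trans; [|apply (HN n m Hn Hm)].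
    eapply Rle_trans; [|apply re_le_Cmod]; right; f_equal. }
  assert (C2 : ex_finite_lim_seq (fun k => Im (G j (x k, 0)))).
  { apply ex_lim_seq_cauchy_corr; intros eps; destruct (Cauchy eps) as [N HN].
    exists N; intros n m Hn Hm; eapply Rle_lt_trans; [|apply (HN n m Hn Hm)].
    eapply Rle_trans; [|apply im_le_Cmod]; right; f_equal. }
  destruct C1 as [l1 L1], C2 as [l2 L2]; exists ((l1, l2) : C).
  intros [rho theta] Hp; simpl fst; apply Rle_plus_epsilon.
  intros eps He.
  apply is_lim_seq_spec in L1; apply is_lim_seq_spec in L2.
  destruct (L1 (mkposreal (eps / 4) ltac:(lra))) as [N1 HN1].
  destruct (L2 (mkposreal (eps / 4) ltac:(lra))) as [N2 HN2].
  set (q := B (S j) * Rabs theta + 1).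
  assert (Hq : 0 < q) by (unfold q; pose proof (Rabs_pos theta); nra).
  destruct (Hx0 (Rmin rho (eps / 4 / q))) as [N3 HN3].
  { apply Rmin_pos; [apply Hp|apply Rdiv_lt_0_compat; lra]. }
  set (k := (N1 + N2 + N3)%nat).
  specialize (HN1 k ltac:(unfold k; lia)); specialize (HN2 k ltac:(unfold k; lia)).
  specialize (HN3 k ltac:(unfold k; lia)); simpl in HN1, HN2.
  pose proof (Rmin_l rho (eps / 4 / q)); pose proof (Rmin_r rho (eps / 4 / q)).
  pose proof (Hx k) as Hxk; destruct Hp as [Hp1 Hp2]; simpl in Hp1, Hp2.
  pose proof (ray_lipschitz j (x k) rho theta ltac:(lra) (conj Hp1 Hp2)) as R1.
  pose proof (arc_lipschitz j (x k) theta (conj Hxk Hp2)) as R2.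
  assert (R3 : Cmod (G j (x k, 0) - ((l1, l2) : C)) <= eps / 2).
  { eapply Rle_trans; [apply Cmod_le_parts|].
    assert (Rabs (Re (G j (x k, 0) - ((l1, l2) : C))) < eps / 4) by exact HN1.
    assert (Rabs (Im (G j (x k, 0) - ((l1, l2) : C))) < eps / 4) by exact HN2.
    lra. }
  replace (G j (rho, theta) - ((l1, l2) : C))%C with
    ((G j (rho, theta) - G j (x k, theta)) + ((G j (x k, theta) - G j (x k, 0))
      + (G j (x k, 0) - ((l1, l2) : C))))%C by ring.
  eapply Rle_trans; [apply Cmod_triangle|].
  eapply Rle_trans; [apply Rplus_le_compat_l, Cmod_triangle|].
  assert (Hxq : x k * q <= eps / 4).
  { apply Rle_trans with (eps / 4 / q * q); [apply Rmult_le_compat_r; lra|].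
    right; field; lra. }
  unfold q in Hxq; nra.
Qed.

(** Taylor's formula at the vertex follows by integrating along the rays, where
    all derivatives extend continuously by [vertex_limit]. *)
Lemma vertex_taylor :
  exists l : nat -> C, (forall j, Cmod (l j) <= B j) /\
  forall n j p, sector gamma r p ->
    Cmod (G j p - psum (fun i => l (j + i)%nat / RtoC (INR (fact i)))%C n (cover p))
    <= B (j + n)%nat / INR (fact n) * fst p ^ n.
Proof.
  destruct (choice _ vertex_limit) as [l Hl]; exists l; split.
  { intros j; apply Rle_plus_epsilon; intros eps He.
    pose proof (chain_bound_nonneg (S j)) as HB.
    set (x := Rmin (r / 2) (eps / (B (S j) + 1))).
    assert (Hx : 0 < x < r).
    { split; [apply Rmin_pos; [lra|apply Rdiv_lt_0_compat; lra]|].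
      eapply Rle_lt_trans; [apply Rmin_l|lra]. }
    pose proof (axis_in_sector x Hx) as Hs.
    specialize (Hl j (x, 0) Hs); pose proof (bound j (x, 0) Hs); simpl fst in Hl.
    assert (Hxe : (B (S j) + 1) * x <= eps).
    { apply Rle_trans with ((B (S j) + 1) * (eps / (B (S j) + 1))).
      - apply Rmult_le_compat_l; [lra|apply Rmin_r].
      - right; field; lra. }
    replace (l j) with (G j (x, 0) + - (G j (x, 0) - l j))%C by ring.
    eapply Rle_trans; [apply Cmod_triangle|]; rewrite Cmod_opp; nra. }
  induction n as [|n IH]; intros j [rho theta] Hp.
  { unfold psum; simpl; replace (G j (rho, theta) - 0)%C with (G j (rho, theta)) by ring.
    rewrite Nat.add_0_r; pose proof (bound j _ Hp); lra. }
  set (c := fun i => (l (j + i)%nat / RtoC (INR (fact i)))%C).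
  set (E := fun s => (G j (s, theta) - psum c (S n) (cover (s, theta)))%C).
  set (b := B (j + S n)%nat / INR (fact (S n))).
  assert (Hf : forall i, 0 < INR (fact i)) by (intros; apply INR_fact_lt_0).
  assert (Hb : 0 <= b) by (apply Rdiv_le_0_compat; [apply chain_bound_nonneg|apply Hf]).
  pose proof (chain_bound_nonneg (S j)) as HB.
  destruct Hp as [Hp1 Hp2]; simpl in Hp1, Hp2; simpl fst.
  assert (Hin : forall s, 0 < s <= rho -> sector gamma r (s, theta))
    by (intros; split; simpl; lra).
  assert (Step : forall e, 0 < e <= rho -> Cmod (E rho - E e) <= b * rho ^ S n - b * e ^ S n).
  { intros e He.
    apply (curve_mean_value E
      (fun s => (G (S j) (s, theta) - psum (fun i => l (S j + i)%nat / RtoC (INR (fact i)))%C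
                 n (cover (s, theta))) * cis theta)%C
      (fun s => b * s ^ S n) (fun s => b * (INR (S n) * s ^ n))); [lra| | |].
    - intros s Hs.
      replace (psum (fun i => l (S j + i)%nat / RtoC (INR (fact i)))%C n (cover (s, theta)))
        with (psum (dcoef c) (S n - 1) (cover (s, theta))).
      2:{ replace (S n - 1)%nat with n by lia; apply psum_ext; intros i _.
          unfold dcoef, c; rewrite Nat.add_succ_r, fact_simpl, mult_INR, RtoC_mult.
          simpl Nat.add; field; split; intros E0; apply RtoC_inj in E0;
            [specialize (Hf i)|pose proof (lt_0_INR (S i) ltac:(lia))]; lra. }
      replace ((G (S j) (s, theta) - psum (dcoef c) (S n - 1) (cover (s, theta))) * cis theta)%C with
        (G (S j) (s, theta) * cis theta - psum (dcoef c) (S n - 1) (cover (s, theta)) * cis theta)%C by ring.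
      apply (curve_derive_minus (fun s => G j (s, theta)) (fun s => psum c (S n) (cover (s, theta)))).
      + apply ray_derive, Hin; lra.
      + apply (curve_derive_psum c (S n) (fun s => cover (s, theta))).
        split; unfold cover, cis, Re, Im; simpl; auto_derive; auto; ring.
    - intros s _; apply (is_derive_scal (fun s => s ^ S n) s b), is_derive_Reals.
      apply (derivable_pt_lim_pow s (S n)).
    - intros s Hs; rewrite Cmod_mult, Cmod_cis, Rmult_1_r.
      eapply Rle_trans; [apply IH, Hin; lra|]; simpl fst.
      right; unfold b; replace (j + S n)%nat with (S j + n)%nat by lia.
      rewrite fact_simpl, mult_INR; pose proof (lt_0_INR (S n) ltac:(lia)).
      specialize (Hf n); field; split; lra. }
  apply Rle_plus_epsilon; intros eps Heps.
  (* near the vertex the remainder tends to 0 *)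
  set (T := rsum (fun i => Cmod (c (i + 1)%nat) * r ^ i) n).
  assert (HT : 0 <= T).
  { apply rsum_nonneg; intros; apply Rmult_le_pos; [apply Cmod_ge_0|apply pow_le; lra]. }
  set (e := Rmin rho (eps / (B (S j) + T + 1))).
  assert (He : 0 < e) by (apply Rmin_pos; [lra|apply Rdiv_lt_0_compat; lra]).
  assert (Her : e <= rho) by apply Rmin_l.
  assert (Hee : (B (S j) + T) * e <= eps).
  { apply Rle_trans with ((B (S j) + T + 1) * (eps / (B (S j) + T + 1))).
    - apply Rmult_le_compat; try lra; apply Rmin_r.
    - right; field; lra. }
  specialize (Step e (conj He Her)).
  assert (Ee : Cmod (E e) <= (B (S j) + T) * e).
  { unfold E; replace (S n) with (n + 1)%nat by lia; rewrite psum_add.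
    replace (psum c 1 (cover (e, theta))) with (l j).
    2:{ unfold psum, c; simpl; rewrite Nat.add_0_r; field. }
    replace (G j (e, theta) - _)%C with ((G j (e, theta) - l j)
      + - (cover (e, theta) ^ 1 * psum (fun i => c (i + 1)%nat) n (cover (e, theta))))%C by ring.
    eapply Rle_trans; [apply Cmod_triangle|].
    rewrite Cmod_opp, Cmod_mult, Cmod_pow, Cmod_cover by (simpl; lra); simpl fst.
    rewrite pow_1, Rmult_plus_distr_r; apply Rplus_le_compat; [apply Hl, Hin; lra|].
    rewrite Rmult_comm; apply Rmult_le_compat_r; [lra|].
    eapply Rle_trans; [apply Cmod_psum_le|]; apply rsum_le; intros i _.
    apply Rmult_le_compat_l; [apply Cmod_ge_0|].
    rewrite Cmod_cover by (simpl; lra); apply pow_incr; simpl; lra. }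
  change (Cmod (E rho) <= b * rho ^ S n + eps).
  replace (E rho) with ((E rho - E e) + E e)%C by ring.
  eapply Rle_trans; [apply Cmod_triangle|].
  assert (0 <= b * e ^ S n) by (apply Rmult_le_pos; [exact Hb|apply pow_le; lra]).
  lra.
Qed.
End VertexTaylor.

(** * Cauchy's estimates *)

Lemma curve_lipschitz (E E' : R -> C) K a b :
  (forall t, Rmin a b <= t <= Rmax a b -> curve_derive E t (E' t) /\ Cmod (E' t) <= K) ->
  Cmod (E b - E a) <= K * Rabs (b - a).
Proof.
  assert (Gen : forall a b, a <= b ->
    (forall t, a <= t <= b -> curve_derive E t (E' t) /\ Cmod (E' t) <= K) ->
    Cmod (E b - E a) <= K * (b - a)).
  { intros x y Hxy H; replace (K * (y - x)) with (K * y - K * x) by ring.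
    apply (curve_mean_value E E' (fun t => K * t) (fun _ => K)); [exact Hxy| | |].
    - intros t Ht; apply H, Ht.
    - intros t _; auto_derive; auto; ring.
    - intros t Ht; apply H, Ht. }
  intros H; destruct (Rle_lt_dec a b) as [Hab|Hab].
  - rewrite Rmin_left, Rmax_right in H by lra; rewrite Rabs_right by lra; apply Gen; auto.
  - rewrite Rmin_right, Rmax_left in H by lra; rewrite Rabs_left by lra.
    rewrite <- Cmod_opp; replace (- (E b - E a))%C with (E a - E b)%C by ring.
    replace (- (b - a)) with (a - b) by ring; apply Gen; [lra|exact H].
Qed.

Lemma quadratic_constant (f : R -> R) K rho : 0 < rho ->
  (forall x y, 0 <= x < y -> y <= rho -> Rabs (f y - f x) <= K * (y - x) ^ 2) ->
  f rho = f 0.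
Proof.
  intros Hr H.
  assert (HK : 0 <= K).
  { specialize (H 0 rho ltac:(lra) ltac:(lra)); pose proof (Rabs_pos (f rho - f 0)).
    assert (0 < (rho - 0) ^ 2) by (apply pow_lt; lra); nra. }
  assert (Step : forall N k, (k <= S N)%nat ->
    Rabs (f (INR k * (rho / INR (S N))) - f 0) <= INR k * (K * (rho / INR (S N)) ^ 2)).
  { intros N; assert (HN : 0 < INR (S N)) by (apply lt_0_INR; lia).
    set (q := rho / INR (S N)); assert (Hq : 0 < q) by (apply Rdiv_lt_0_compat; assumption).
    induction k as [|k IH]; intros Hk.
    - simpl; rewrite Rmult_0_l; replace (f 0 - f 0) with 0 by ring; rewrite Rabs_R0; lra.
    - specialize (IH ltac:(lia)); rewrite S_INR; pose proof (pos_INR k).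
      replace (f ((INR k + 1) * q) - f 0) with
        ((f ((INR k + 1) * q) - f (INR k * q)) + (f (INR k * q) - f 0)) by ring.
      eapply Rle_trans; [apply Rabs_triang|].
      specialize (H (INR k * q) ((INR k + 1) * q)).
      replace ((INR k + 1) * q - INR k * q) with q in H by ring.
      assert (H' : Rabs (f ((INR k + 1) * q) - f (INR k * q)) <= K * q ^ 2); [|lra].
      apply H; [split; [apply Rmult_le_pos|]; lra|].
      apply Rle_trans with (INR (S N) * q).
      + apply Rmult_le_compat_r; [lra|]; rewrite <- S_INR; apply le_INR, Hk.
      + right; unfold q; field; lra. }
  destruct (Req_dec (f rho) (f 0)) as [E|E]; [exact E|exfalso].
  assert (HD : 0 < Rabs (f rho - f 0)) by (apply Rabs_pos_lt; lra).
  destruct (INR_unbounded (K * rho ^ 2 / Rabs (f rho - f 0))) as [N HN].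
  assert (HSN : 0 < INR (S N)) by (apply lt_0_INR; lia).
  specialize (Step N (S N) (le_n _)).
  replace (INR (S N) * (rho / INR (S N))) with rho in Step by (field; lra).
  replace (INR (S N) * (K * (rho / INR (S N)) ^ 2)) with (K * rho ^ 2 / INR (S N)) in Step
    by (field; lra).
  assert (K * rho ^ 2 < INR (S N) * Rabs (f rho - f 0)).
  { rewrite S_INR; apply (Rmult_lt_compat_r (Rabs (f rho - f 0))) in HN; [|exact HD].
    unfold Rdiv in HN; rewrite Rmult_assoc, Rinv_l in HN by lra; nra. }
  apply (Rmult_le_compat_l (INR (S N))) in Step; [|lra].
  replace (INR (S N) * (K * rho ^ 2 / INR (S N))) with (K * rho ^ 2) in Step by (field; lra).
  lra.
Qed.

(** A holomorphic function and its derivatives on a disk, in polar coordinates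
    around the centre; the two differential equations are the only trace of
    holomorphy, so that no chart of the disk is needed. *)
Section Cauchy.
Context (F : nat -> R -> R -> C) (R0 : R).
Hypothesis F_angle : forall j rho theta, 0 <= rho < R0 ->
  curve_derive (fun t => F j rho t) theta (RtoC rho * (Ci * cis theta) * F (S j) rho theta)%C.
Hypothesis F_radius : forall j rho theta, 0 <= rho < R0 ->
  curve_derive (fun s => F j s theta) rho (cis theta * F (S j) rho theta)%C.
Hypothesis F_period : forall j rho, F j rho (2 * PI) = F j rho 0.
Hypothesis F_center : forall j theta, F j 0 theta = F j 0 0.

Definition twist (n : nat) (theta : R) : C := cis (- (INR n * theta)).

Lemma twist_derive n theta :
  curve_derive (twist n) theta (RtoC (INR n) * (-Ci * twist n theta))%C.
Proof.
  split; unfold twist, cis, Re, Im; simpl fst; simpl snd; auto_derive; auto; ring.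
Qed.

Lemma twist_S n theta : (cis theta * twist (S n) theta)%C = twist n theta.
Proof.
  unfold twist; rewrite S_INR.
  replace (- ((INR n + 1) * theta)) with (- (INR n * theta) - theta) by ring.
  unfold cis; apply injective_projections; simpl;
    rewrite cos_minus, sin_minus; pose proof (sin2_cos2 theta) as H; unfold Rsqr in H.
  - transitivity (cos (- (INR n * theta)) * (sin theta * sin theta + cos theta * cos theta));
      [ring|rewrite H; ring].
  - transitivity (sin (- (INR n * theta)) * (sin theta * sin theta + cos theta * cos theta));
      [ring|rewrite H; ring].
Qed.

Lemma twist_0 theta : twist 0 theta = RtoC 1.
Proof.
  unfold twist, cis; simpl; rewrite Rmult_0_l, Ropp_0, cos_0, sin_0; reflexivity.
Qed.

Lemma twist_period n : twist n (2 * PI) = twist n 0.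
Proof.
  unfold twist, cis; rewrite Rmult_0_r, Ropp_0, cos_neg, sin_neg.
  replace (INR n * (2 * PI)) with (0 + 2 * INR n * PI) by ring.
  rewrite cos_period, sin_period, sin_0, Ropp_0; reflexivity.
Qed.

Context (omega : C).

(** Real parts after multiplication by a constant [omega], chosen in
    [cauchy_estimate] so that the mean of the [n]-th derivative becomes its
    squared modulus; thus all integrals are real. *)
Definition fourier_integrand j n rho theta : R :=
  Re (omega * (F j rho theta * twist n theta)).

Definition fourier j n rho : R := RInt (fourier_integrand j n rho) 0 (2 * PI).

Lemma fourier_integrand_continuous j n rho theta : 0 <= rho < R0 ->
  continuous (fourier_integrand j n rho) theta.
Proof.
  intros H; apply (ex_derive_continuous (fourier_integrand j n rho)).
  eexists; apply (curve_derive_scal omega (fun t => F j rho t * twist n t)%C).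
  apply curve_derive_mult; [apply F_angle, H|apply twist_derive].
Qed.

Lemma fourier_integrable j n rho : 0 <= rho < R0 ->
  ex_RInt (fourier_integrand j n rho) 0 (2 * PI).
Proof.
  intros H; apply (ex_RInt_continuous (V := R_CompleteNormedModule)).
  intros t _; apply fourier_integrand_continuous, H.
Qed.

(** The derivative of [F j] times an exponential along a circle integrates to
    zero: this is the integration by parts behind Cauchy's formula. *)
Lemma fourier_step j n rho : 0 <= rho < R0 ->
  INR (S n) * fourier j (S n) rho = rho * fourier (S j) n rho.
Proof.
  intros Hr.
  set (g := fun t => Re (omega * (-Ci) * (F j rho t * twist (S n) t))%C).
  set (dg := fun t => rho * fourier_integrand (S j) n rho t
                      - INR (S n) * fourier_integrand j (S n) rho t).
  assert (Hg : forall t, is_derive g t (dg t)).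
  { intros t.
    destruct (curve_derive_scal (omega * (-Ci)) (fun t => F j rho t * twist (S n) t)%C t _
      (curve_derive_mult _ _ t _ _ (F_angle j rho t Hr) (twist_derive (S n) t))) as [H _].
    unfold g.
    replace (dg t) with (Re (omega * - Ci * (RtoC rho * (Ci * cis t) * F (S j) rho t
      * twist (S n) t + F j rho t * (RtoC (INR (S n)) * (- Ci * twist (S n) t))))%C);
      [exact H|].
    unfold dg, fourier_integrand; rewrite <- (twist_S n t).
    assert (Ere : forall (x : R) (z : C), x * Re z = Re (RtoC x * z)%C)
      by (intros; unfold Re; simpl; ring).
    rewrite !Ere.
    assert (Esub : forall y z : C, Re y - Re z = Re (y - z)%C)
      by (intros; unfold Re; simpl; ring).
    rewrite Esub; f_equal.
    assert (Hi : (Ci * Ci)%C = (- (1))%C)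
      by (unfold Ci; apply injective_projections; simpl; ring).
    replace (omega * - Ci * (RtoC rho * (Ci * cis t) * F (S j) rho t * twist (S n) t
        + F j rho t * (RtoC (INR (S n)) * (- Ci * twist (S n) t))))%C with
      (- (Ci * Ci) * (RtoC rho * (omega * (F (S j) rho t * (cis t * twist (S n) t))))
       + (Ci * Ci) * (RtoC (INR (S n)) * (omega * (F j rho t * twist (S n) t))))%C by ring.
    rewrite Hi; ring. }
  assert (Cdg : forall t, continuous dg t).
  { intros t; apply (continuous_minus (V := R_NormedModule)).
    - apply (continuous_scal_r (V := R_NormedModule)), fourier_integrand_continuous, Hr.
    - apply (continuous_scal_r (V := R_NormedModule)), fourier_integrand_continuous, Hr. }
  assert (I : is_RInt dg 0 (2 * PI) (g (2 * PI) - g 0)).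
  { apply (is_RInt_derive (V := R_CompleteNormedModule)); intros; auto. }
  assert (Z : g (2 * PI) - g 0 = 0) by (unfold g; rewrite F_period, twist_period; ring).
  rewrite Z in I; apply (is_RInt_unique (V := R_CompleteNormedModule)) in I.
  assert (J : RInt dg 0 (2 * PI) = rho * fourier (S j) n rho - INR (S n) * fourier j (S n) rho).
  { apply (is_RInt_unique (V := R_CompleteNormedModule)).
    apply (is_RInt_minus (V := R_NormedModule));
      apply (is_RInt_scal (V := R_NormedModule)), (RInt_correct (V := R_CompleteNormedModule)),
        fourier_integrable, Hr. }
  rewrite I in J; lra.
Qed.

(** The [n]-th Fourier coefficient of a function on a circle is [rho^n / n!] times
    the circular mean of its [n]-th derivative. *)
Lemma fourier_iter n rho : 0 <= rho < R0 -> forall j,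
  INR (fact n) * fourier j n rho = rho ^ n * fourier (j + n) 0 rho.
Proof.
  intros Hr; induction n as [|n IH]; intros j.
  - rewrite Nat.add_0_r; simpl; ring.
  - rewrite fact_simpl, mult_INR.
    replace (INR (S n) * INR (fact n) * fourier j (S n) rho) with
      (INR (fact n) * (INR (S n) * fourier j (S n) rho)) by ring.
    rewrite fourier_step by exact Hr.
    replace (INR (fact n) * (rho * fourier (S j) n rho)) with
      (rho * (INR (fact n) * fourier (S j) n rho)) by ring.
    rewrite IH; replace (S j + n)%nat with (j + S n)%nat by lia; simpl; ring.
Qed.

(** The mean value property: the circular mean depends on the radius with a
    quadratic modulus of continuity, hence not at all. *)
Lemma fourier_mean j B rho : 0 < rho < R0 ->
  (forall s theta, 0 <= s < R0 -> Cmod (F (S (S j)) s theta) <= B) ->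
  fourier j 0 rho = 2 * PI * Re (omega * F j 0 0).
Proof.
  intros Hr HB; pose proof PI_RGT_0 as Hpi.
  assert (HB0 : 0 <= B).
  { specialize (HB 0 0 ltac:(lra)); pose proof (Cmod_ge_0 (F (S (S j)) 0 0)); lra. }
  assert (Lip : forall x y theta, 0 <= x < y -> y <= rho ->
    Cmod (F j x theta - F j y theta - RtoC (x - y) * (cis theta * F (S j) y theta))
    <= B * (y - x) * (y - x)).
  { intros x y theta Hxy Hy.
    set (E := fun s => (F j s theta - RtoC (s - y) * (cis theta * F (S j) y theta))%C).
    replace (_ - _)%C with (E x - E y)%C.
    2:{ unfold E; replace (y - y) with 0 by ring; ring. }
    replace (y - x) with (Rabs (x - y)) at 2 by (rewrite Rabs_left; lra).
    apply (curve_lipschitz E (fun s => cis theta * F (S j) s theta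
       - RtoC 1 * (cis theta * F (S j) y theta))%C).
    rewrite Rmin_right, Rmax_left by lra; intros s Hs; split.
    - apply curve_derive_minus; [apply F_radius; lra|].
      replace (RtoC 1 * (cis theta * F (S j) y theta))%C with
        (cis theta * F (S j) y theta * RtoC 1)%C by ring.
      replace (fun s => RtoC (s - y) * (cis theta * F (S j) y theta))%C with
        (fun s => (cis theta * F (S j) y theta) * RtoC (s - y))%C
        by (apply functional_extensionality; intros; ring).
      apply curve_derive_scal; split; unfold Re, Im; simpl; auto_derive; auto; ring.
    - replace (_ - _)%C with (cis theta * (F (S j) s theta - F (S j) y theta))%C by ring.
      rewrite Cmod_mult, Cmod_cis, Rmult_1_l.
      eapply Rle_trans.
      + apply (curve_lipschitz (fun s => F (S j) s theta)
          (fun s => cis theta * F (S (S j)) s theta)%C B).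
        intros t Ht; rewrite Rmin_right, Rmax_left in Ht by lra; split.
        * apply F_radius; lra.
        * rewrite Cmod_mult, Cmod_cis, Rmult_1_l; apply HB; lra.
      + apply Rmult_le_compat_l; [exact HB0|].
        rewrite Rabs_left1 by lra; lra. }
  rewrite (quadratic_constant (fourier j 0) (2 * PI * (Cmod omega * B)) rho);
    [|lra|].
  - unfold fourier; rewrite (RInt_ext _ (fun _ => Re (omega * F j 0 0))).
    + rewrite RInt_const; unfold scal; simpl; unfold mult; simpl; ring.
    + intros t _; unfold fourier_integrand; rewrite twist_0, F_center.
      f_equal; ring.
  - intros x y Hxy Hy.
    assert (Dx : 0 <= x < R0) by lra; assert (Dy : 0 <= y < R0) by lra.
    (* the linear term integrates to zero *)
    set (D := fun t => Re (omega * (cis t * F (S j) y t))%C).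
    assert (ED : is_RInt D 0 (2 * PI) 0).
    { set (g := fun t => Re (omega * (-Ci) * F j y t)%C).
      assert (Hg : forall t, is_derive g t (y * D t)).
      { intros t; destruct (curve_derive_scal (omega * (-Ci)) (fun t => F j y t) t _
          (F_angle j y t Dy)) as [H _].
        unfold g; replace (y * D t) with
          (Re (omega * - Ci * (RtoC y * (Ci * cis t) * F (S j) y t))%C); [exact H|].
        unfold D, Re; simpl; ring. }
      assert (CD : forall t, continuous D t).
      { intros t; apply (ex_derive_continuous D); eexists.
        apply (curve_derive_scal omega (fun t => cis t * F (S j) y t)%C).
        apply curve_derive_mult; [apply curve_derive_cis|apply F_angle, Dy]. }
      assert (I : is_RInt (fun t => y * D t) 0 (2 * PI) (g (2 * PI) - g 0)).
      { apply (is_RInt_derive (V := R_CompleteNormedModule)); intros t _; [apply Hg|].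
        apply (continuous_scal_r (V := R_NormedModule)), CD. }
      replace (g (2 * PI) - g 0) with 0 in I by (unfold g; rewrite F_period; ring).
      apply (is_RInt_scal (V := R_NormedModule) _ _ _ (/ y)) in I.
      change (is_RInt (fun t => scal (/ y) (y * D t)) 0 (2 * PI) (/ y * 0)) in I.
      rewrite Rmult_0_r in I.
      apply (is_RInt_ext (fun t => scal (/ y) (y * D t))); [|exact I].
      intros t _; unfold scal; simpl; unfold mult; simpl; field; lra. }
    assert (I : is_RInt (fun t => fourier_integrand j 0 x t - fourier_integrand j 0 y t
        - (x - y) * D t) 0 (2 * PI) (fourier j 0 x - fourier j 0 y - (x - y) * 0)).
    { apply (is_RInt_minus (V := R_NormedModule)).
      - apply (is_RInt_minus (V := R_NormedModule));
          apply (RInt_correct (V := R_CompleteNormedModule)), fourier_integrable; assumption.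
      - apply (is_RInt_scal (V := R_NormedModule)), ED. }
    rewrite Rabs_minus_sym.
    replace (fourier j 0 x - fourier j 0 y) with
      (fourier j 0 x - fourier j 0 y - (x - y) * 0) by ring.
    replace (2 * PI * (Cmod omega * B) * (y - x) ^ 2) with
      ((2 * PI - 0) * (Cmod omega * (B * (y - x) * (y - x)))) by ring.
    apply (norm_RInt_le_const (V := R_NormedModule) _ 0 (2 * PI) _ _ ltac:(lra)) with (2 := I).
    intros t _; unfold norm; simpl; unfold abs; simpl.
    unfold fourier_integrand, D; rewrite twist_0.
    replace (Re _ - Re _ - _) with
      (Re (omega * (F j x t - F j y t - RtoC (x - y) * (cis t * F (S j) y t)))%C)
      by (unfold Re; simpl; ring).
    eapply Rle_trans; [apply re_le_Cmod|]; rewrite Cmod_mult.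
    apply Rmult_le_compat_l; [apply Cmod_ge_0|apply Lip; assumption].
Qed.
End Cauchy.

Lemma cauchy_estimate F R0 n B B2 rho :
  (forall j rho theta, 0 <= rho < R0 ->
    curve_derive (fun t => F j rho t) theta
      (RtoC rho * (Ci * cis theta) * F (S j) rho theta)%C) ->
  (forall j rho theta, 0 <= rho < R0 ->
    curve_derive (fun s => F j s theta) rho (cis theta * F (S j) rho theta)%C) ->
  (forall j rho, F j rho (2 * PI) = F j rho 0) ->
  (forall j theta, F j 0 theta = F j 0 0) ->
  (forall rho theta, 0 <= rho < R0 -> Cmod (F O rho theta) <= B) ->
  (forall rho theta, 0 <= rho < R0 -> Cmod (F (S (S n)) rho theta) <= B2) ->
  0 < rho < R0 ->
  Cmod (F n 0 0) * rho ^ n <= INR (fact n) * B.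
Proof.
  intros H1 H2 H3 H4 HB HB2 Hr; pose proof PI_RGT_0.
  set (w := Cmod (F n 0 0)).
  assert (Hw : 0 <= w) by apply Cmod_ge_0.
  assert (HB0 : 0 <= B).
  { specialize (HB 0 0 ltac:(lra)); pose proof (Cmod_ge_0 (F O 0 0)); lra. }
  pose proof (INR_fact_lt_0 n) as Hf.
  destruct (Req_dec w 0) as [E|E].
  { rewrite E, Rmult_0_l; apply Rmult_le_pos; lra. }
  set (om := Cconj (F n 0 0)).
  pose proof (fourier_iter F R0 H1 H3 om n rho ltac:(lra) O) as It; simpl Nat.add in It.
  rewrite (fourier_mean F R0 H1 H2 H3 H4 om n B2 rho Hr HB2) in It.
  replace (Re (om * F n 0 0)) with (w * w) in It.
  2:{ replace (w * w) with (w ^ 2) by ring; unfold w, om; rewrite Cmod2_alt.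
      unfold Re, Im; simpl; ring. }
  assert (Up : fourier F om 0 n rho <= 2 * PI * (w * B)).
  { replace (2 * PI * (w * B)) with ((2 * PI - 0) * (w * B)) by ring.
    eapply Rle_trans; [apply Rle_abs|].
    apply (norm_RInt_le_const (V := R_NormedModule) (fourier_integrand F om 0 n rho)
      0 (2 * PI) (fourier F om 0 n rho) (w * B) ltac:(lra)).
    - intros t _; unfold norm; simpl; unfold abs; simpl; unfold fourier_integrand.
      eapply Rle_trans; [apply re_le_Cmod|]; rewrite !Cmod_mult.
      unfold om; rewrite Cmod_conj; unfold twist; rewrite Cmod_cis, Rmult_1_r.
      apply Rmult_le_compat_l; [exact Hw|apply HB; lra].
    - apply (RInt_correct (V := R_CompleteNormedModule)), fourier_integrable with R0; auto; lra. }
  apply (Rmult_le_compat_l (INR (fact n))) in Up; [|lra].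
  rewrite It in Up.
  apply Rmult_le_reg_l with (2 * PI * w); [apply Rmult_lt_0_compat; lra|]; lra.
Qed.

(** * Cauchy's estimates on a sector *)

Lemma Rabs_atan_le x : Rabs (atan x) <= Rabs x.
Proof.
  destruct (MVT_gen atan 0 x (fun y => / (1 + y ^ 2))) as [y [_ Hy]].
  - intros t _; apply is_derive_Reals; apply derivable_pt_lim_atan.
  - intros t _; apply derivable_continuous_pt, derivable_pt_atan.
  - rewrite atan_0, !Rminus_0_r in Hy; rewrite Hy, Rabs_mult.
    rewrite <- (Rmult_1_l (Rabs x)) at 2; apply Rmult_le_compat_r; [apply Rabs_pos|].
    pose proof (pow2_ge_0 y); rewrite Rabs_right.
    + rewrite <- Rinv_1; apply Rinv_le_contravar; lra.
    + left; apply Rinv_0_lt_compat; lra.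
Qed.

(** The point [p * (1 + s e^{i alpha})] of the surface, for [|s| < 1]: the branch of
    the argument is explicit because [1 + s cos alpha] is positive. *)
Definition around (p : R * R) (s alpha : R) : R * R :=
  (fst p * sqrt ((1 + s * cos alpha) ^ 2 + (s * sin alpha) ^ 2),
   snd p + atan (s * sin alpha / (1 + s * cos alpha))).

Lemma around_re_ge s alpha : 1 - Rabs s <= 1 + s * cos alpha.
Proof.
  pose proof (COS_bound alpha); pose proof (Rabs_pos s).
  assert (Rabs (s * cos alpha) <= Rabs s).
  { rewrite Rabs_mult; assert (Rabs (cos alpha) <= 1) by (apply Rabs_le; lra); nra. }
  pose proof (Rle_abs (- (s * cos alpha))) as H2; rewrite Rabs_Ropp in H2; lra.
Qed.

Lemma cover_around p s alpha : Rabs s < 1 ->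
  cover (around p s alpha) = (cover p * (1 + RtoC s * cis alpha))%C.
Proof.
  intros Hs; pose proof (around_re_ge s alpha) as Hx.
  unfold around; set (x := 1 + s * cos alpha) in *; set (y := s * sin alpha) in *.
  set (t := y / x).
  assert (Hsq : sqrt (x ^ 2 + y ^ 2) = x * sqrt (1 + Rsqr t)).
  { rewrite <- (sqrt_Rsqr x) at 2 by lra; rewrite <- sqrt_mult_alt by apply Rle_0_sqr.
    f_equal; unfold t, Rsqr; field; lra. }
  assert (Hp : 0 < sqrt (1 + Rsqr t)) by (apply sqrt_lt_R0; pose proof (Rle_0_sqr t); lra).
  rewrite Hsq; unfold cover; simpl fst; simpl snd.
  rewrite cos_plus, sin_plus, cos_atan, sin_atan.
  set (w := sqrt (1 + Rsqr t)) in *.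
  assert (Hy : t * x = y) by (unfold t; field; lra).
  unfold cis; apply injective_projections; simpl; fold x; fold y.
  - replace (1 + (s * cos alpha - 0 * sin alpha)) with x by (unfold x; ring).
    replace (0 + (s * sin alpha + 0 * cos alpha)) with y by (unfold y; ring).
    rewrite <- Hy; field; lra.
  - replace (1 + (s * cos alpha - 0 * sin alpha)) with x by (unfold x; ring).
    replace (0 + (s * sin alpha + 0 * cos alpha)) with y by (unfold y; ring).
    rewrite <- Hy; field; lra.
Qed.

Lemma fst_around_le p s alpha : 0 < fst p -> 0 <= s < 1 ->
  0 < fst (around p s alpha) <= fst p * (1 + s).
Proof.
  intros Hp Hs; pose proof (around_re_ge s alpha) as Hx.
  rewrite Rabs_right in Hx by lra.
  assert (Hpos : 0 < fst (around p s alpha)).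
  { unfold around; simpl fst; apply Rmult_lt_0_compat; [exact Hp|].
    apply sqrt_lt_R0; pose proof (pow2_ge_0 (s * sin alpha)).
    assert (0 < (1 + s * cos alpha) ^ 2) by (apply pow_lt; lra); lra. }
  split; [exact Hpos|].
  rewrite <- (Cmod_cover (around p s alpha)) by exact Hpos.
  rewrite cover_around by (rewrite Rabs_right; lra).
  rewrite Cmod_mult, Cmod_cover by exact Hp.
  apply Rmult_le_compat_l; [lra|].
  eapply Rle_trans; [apply Cmod_triangle|].
  rewrite Cmod_1, Cmod_mult, Cmod_cis, Cmod_R, Rabs_right; lra.
Qed.

Lemma snd_around_le p s alpha : 0 <= s <= / 2 ->
  Rabs (snd (around p s alpha)) <= Rabs (snd p) + 2 * s.
Proof.
  intros Hs; pose proof (around_re_ge s alpha) as Hx.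
  rewrite Rabs_right in Hx by lra.
  unfold around; simpl snd; eapply Rle_trans; [apply Rabs_triang|].
  apply Rplus_le_compat_l; eapply Rle_trans; [apply Rabs_atan_le|].
  unfold Rdiv; rewrite Rabs_mult, Rabs_inv, (Rabs_right (1 + s * cos alpha)) by lra.
  rewrite Rabs_mult, (Rabs_right s) by lra.
  assert (Hsin : Rabs (sin alpha) <= 1) by (apply Rabs_le; apply SIN_bound).
  apply Rmult_le_reg_r with (1 + s * cos alpha); [lra|].
  rewrite Rmult_assoc, Rinv_l by lra; nra.
Qed.

(** Where [h] is close to a polynomial of degree less than [n] on a larger
    sector, its [n]-th derivative is small on a smaller one, by Cauchy's estimate
    on a disk of radius proportional to [|z|]. *)
Lemma sector_cauchy gamma r gamma' r' G c n K :
  0 < gamma' < gamma -> 0 < r' < r ->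
  derivative_chain (sector gamma r) G ->
  (exists B, forall p, sector gamma r p -> Cmod (G (S (S n)) p) <= B) ->
  0 <= K ->
  (forall p, sector gamma r p -> Cmod (G O p - psum c n (cover p)) <= K * fst p ^ n) ->
  forall p, sector gamma' r' p ->
  let eps := Rmin (/ 2) (Rmin ((r - r') / r') ((gamma - gamma') * (PI / 4))) in
  Cmod (G n p) <= K * (4 / eps) ^ n * INR (fact n).
Proof.
  intros Hg Hr Hchain [B HB] HK Hrem p Hp eps; pose proof PI_RGT_0.
  destruct Hp as [Hp1 Hp2].
  assert (He : 0 < eps).
  { apply Rmin_pos; [lra|apply Rmin_pos]; [apply Rdiv_lt_0_compat; lra|].
    apply Rmult_lt_0_compat; lra. }
  assert (He1 : eps <= / 2) by apply Rmin_l.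
  assert (He2 : eps <= (r - r') / r') by (eapply Rle_trans; [apply Rmin_r|apply Rmin_l]).
  assert (He3 : eps <= (gamma - gamma') * (PI / 4)) by (eapply Rle_trans; [apply Rmin_r|apply Rmin_r]).
  assert (Hin : forall s alpha, 0 <= s < eps -> sector gamma r (around p s alpha)).
  { intros s alpha Hs.
    pose proof (fst_around_le p s alpha (proj1 Hp1) ltac:(lra)) as H1.
    pose proof (snd_around_le p s alpha ltac:(lra)) as H2.
    split; [split; [apply H1|]|].
    - eapply Rle_lt_trans; [apply H1|].
      apply Rlt_le_trans with (r' * (1 + eps)).
      + apply Rle_lt_trans with (fst p * (1 + eps)); [apply Rmult_le_compat_l; lra|].
        apply Rmult_lt_compat_r; lra.
      + apply Rle_trans with (r' * (1 + (r - r') / r')); [apply Rmult_le_compat_l; lra|].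
        right; field; lra.
    - lra. }
  set (z := cover p).
  assert (Hz : Cmod z = fst p) by apply Cmod_cover, Hp1.
  (* F j is the j-th derivative, in the coordinate of the disk, of G 0 minus the
     polynomial; the polynomial part disappears at order n *)
  set (cj := fun j => Nat.iter j dcoef c).
  set (line := fun s alpha => (z * (1 + RtoC s * cis alpha))%C).
  set (F := fun j s alpha => (z ^ j * (G j (around p s alpha)
              - psum (cj j) (n - j) (line s alpha)))%C).
  (* cover (around p s alpha) is the line z (1 + s e^{i alpha}) for |s| < 1 only;
     this range contains s = 0, where radial derivatives are two-sided *)
  assert (Loc : forall (f g : R -> C) t v d, 0 < d ->
     (forall u, Rabs (u - t) < d -> f u = g u) ->
     curve_derive f t v -> curve_derive g t v).
  { intros f g t v d Hd Hfg [H1 H2]; split.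
    - apply (is_derive_ext_loc (fun s => Re (f s))); [|exact H1].
      exists (mkposreal d Hd); intros u Hu; rewrite Hfg; [reflexivity|exact Hu].
    - apply (is_derive_ext_loc (fun s => Im (f s))); [|exact H2].
      exists (mkposreal d Hd); intros u Hu; rewrite Hfg; [reflexivity|exact Hu]. }
  assert (Der : forall j (ps pa : R -> R) t v,
    0 <= ps t < eps -> ex_derive ps t -> ex_derive pa t ->
    (forall u, Rabs (u - t) < / 2 -> Rabs (ps u) < 1) ->
    curve_derive (fun u => line (ps u) (pa u)) t (z * v)%C ->
    curve_derive (fun u => F j (ps u) (pa u)) t (v * F (S j) (ps t) (pa t))%C).
  { intros j ps pa t v Hs E1 E2 Hps Hl.
    pose proof (around_re_ge (ps t) (pa t)) as Hre; rewrite Rabs_right in Hre by lra.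
    replace (v * F (S j) (ps t) (pa t))%C with
      (z ^ j * (G (S j) (around p (ps t) (pa t)) * (z * v)
        - psum (dcoef (cj j)) (n - j - 1) (line (ps t) (pa t)) * (z * v)))%C.
    2:{ unfold F; replace (n - S j)%nat with (n - j - 1)%nat by lia.
        change (cj (S j)) with (dcoef (cj j)); simpl Cpow; ring. }
    apply curve_derive_scal, curve_derive_minus.
    - apply (curve_derive_log (G j) (fun u => around p (ps u) (pa u))).
      + apply (Hin (ps t) (pa t) Hs).
      + apply Hchain, Hin, Hs.
      + unfold around; simpl fst.
        apply (ex_derive_comp (fun x => fst p * sqrt x)
          (fun u => (1 + ps u * cos (pa u)) ^ 2 + (ps u * sin (pa u)) ^ 2)).
        * auto_derive.
          pose proof (pow2_ge_0 (ps t * sin (pa t))).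
          assert (0 < (1 + ps t * cos (pa t)) ^ 2) by (apply pow_lt; lra); lra.
        * auto_derive; repeat split; auto.
      + unfold around; simpl snd; auto_derive; repeat split; auto; lra.
      + apply (Loc (fun u => line (ps u) (pa u))) with (/ 2); [lra| |exact Hl].
        intros u Hu; rewrite cover_around by apply Hps, Hu; reflexivity.
    - apply (curve_derive_psum (cj j) (n - j) (fun u => line (ps u) (pa u))), Hl. }
  assert (Est : Cmod (F n 0 0) * (eps / 2) ^ n <= INR (fact n) * (K * (2 * fst p) ^ n)).
  { apply (cauchy_estimate F eps n _ (Cmod z ^ (S (S n)) * B)).
    - intros j s alpha Hs.
      apply (Der j (fun _ => s) (fun u => u) alpha (RtoC s * (Ci * cis alpha))%C Hs).
      + auto_derive; exact I.
      + auto_derive; exact I.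
      + intros _ _; rewrite Rabs_right; lra.
      + replace (z * (RtoC s * (Ci * cis alpha)))%C with
          (z * (0 + RtoC s * (Ci * cis alpha)))%C by ring.
        apply curve_derive_scal, (curve_derive_plus (fun _ => RtoC 1)).
        * apply curve_derive_const.
        * apply curve_derive_scal, curve_derive_cis.
    - intros j s alpha Hs.
      apply (Der j (fun u => u) (fun _ => alpha) s (cis alpha) Hs).
      + auto_derive; exact I.
      + auto_derive; exact I.
      + intros u Hu; apply Rabs_def2 in Hu; apply Rabs_def1; lra.
      + split; unfold line, cis, Re, Im; simpl; auto_derive; auto; ring.
    - intros j s; unfold F, around, line, cis.
      rewrite cos_2PI, sin_2PI, cos_0, sin_0; reflexivity.
    - intros j alpha; unfold F, around, line.
      rewrite !Rmult_0_l.
      replace (RtoC 0 * cis alpha)%C with (RtoC 0 * cis 0)%C by ring; reflexivity.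
    - intros s alpha Hs; unfold F; simpl Cpow; rewrite Cmult_1_l, Nat.sub_0_r.
      assert (Hs1 : Rabs s < 1) by (rewrite Rabs_right; lra).
      unfold line, z; rewrite <- cover_around by exact Hs1.
      eapply Rle_trans; [apply Hrem, Hin, Hs|].
      apply Rmult_le_compat_l; [exact HK|].
      pose proof (fst_around_le p s alpha (proj1 Hp1) ltac:(lra)) as H1.
      apply pow_incr; split; [lra|].
      eapply Rle_trans; [apply H1|]; nra.
    - intros s alpha Hs; unfold F; replace (n - S (S n))%nat with O by lia.
      rewrite Cmod_mult, Cmod_pow; apply Rmult_le_compat_l; [apply pow_le, Cmod_ge_0|].
      replace (G (S (S n)) (around p s alpha) - _)%C with (G (S (S n)) (around p s alpha))
        by (unfold psum; simpl; ring).
      apply HB, Hin, Hs.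
    - lra. }
  assert (E0 : F n 0 0 = (z ^ n * G n p)%C).
  { unfold F; rewrite Nat.sub_diag.
    replace (around p 0 0) with p; [unfold psum; simpl; ring|].
    unfold around; rewrite !Rmult_0_l, Rplus_0_r.
    replace (1 ^ 2 + 0 ^ 2) with 1 by ring.
    replace (0 / 1) with 0 by field; rewrite sqrt_1, atan_0.
    destruct p; simpl; f_equal; ring. }
  rewrite E0, Cmod_mult, Cmod_pow, Hz in Est.
  assert (Hpn : 0 < fst p ^ n) by (apply pow_lt; lra).
  assert (Hen : 0 < (eps / 2) ^ n) by (apply pow_lt; lra).
  apply Rmult_le_reg_r with (fst p ^ n * (eps / 2) ^ n).
  { apply Rmult_lt_0_compat; assumption. }
  replace (K * (4 / eps) ^ n * INR (fact n) * (fst p ^ n * (eps / 2) ^ n)) with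
    (INR (fact n) * (K * (((4 / eps) * (eps / 2)) * fst p) ^ n))
    by (rewrite !Rpow_mult_distr; ring).
  replace (4 / eps * (eps / 2)) with 2 by (field; lra).
  lra.
Qed.

(** * Membership of the root in the class *)

Lemma sector_expansion gamma r f G B :
  0 < gamma -> 0 < r ->
  (forall p, sector gamma r p -> G O p = f p) ->
  derivative_chain (sector gamma r) G ->
  (forall j p, sector gamma r p -> Cmod (G j p) <= B j) ->
  exists c, expansion (fun x : {p | sector gamma r p} => cover (proj1_sig x)) everywhere
    (fun n => B n / INR (fact n)) (fun x => f (proj1_sig x)) c.
Proof.
  intros Hg Hr H0 Hc HB.
  destruct (vertex_taylor gamma r Hg Hr G B Hc HB) as [l [Hl1 Hl2]].
  exists (fun i => l i / RtoC (INR (fact i)))%C; intros n.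
  pose proof (INR_fact_lt_0 n) as Hf; split.
  - rewrite Cmod_div by (intros E; apply RtoC_inj in E; lra).
    rewrite Cmod_R, Rabs_right by lra.
    apply Rmult_le_compat_r; [left; apply Rinv_0_lt_compat, Hf|apply Hl1].
  - intros [p Hp] _; simpl; specialize (Hl2 n O p Hp); simpl in Hl2.
    rewrite <- H0, Cmod_cover by (exact Hp || apply Hp); exact Hl2.
Qed.

Theorem theorem3 (gamma r : R) (hgamma : 0 < gamma) (hr : 0 < r)
    (M : nat -> R) (hM : strongly_regular M)
    (d : nat) (hd : (1 <= d)%nat)
    (a : nat -> R * R -> C)
    (ha : forall j : nat, (1 <= j <= d)%nat -> A_class M (sector gamma r) (a j))
    (h : R * R -> C) (hh : A_infty (sector gamma r) h)
    (hroot : forall z : R * R, sector gamma r z ->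
       monic_poly d a z (h z) = RtoC 0)
    (gamma' r' : R) (hgamma' : 0 < gamma' < gamma) (hr' : 0 < r' < r) :
  A_class M (sector gamma' r') h.
Proof.
  destruct (strongly_regular_weight M hM) as [A W].
  pose proof PI_RGT_0 as Hpi.
  assert (Sub : forall p, sector gamma' r' p -> sector gamma r p).
  { intros p [[H1 H2] H3]; split; [lra|].
    eapply Rlt_trans; [exact H3|]; apply Rmult_lt_compat_r; lra. }
  destruct (A_infty_chain gamma r h hh) as [G [G0 [Gc [Gn Gb]]]].
  set (Z := fun x : {p | sector gamma r p} => cover (proj1_sig x)).
  assert (Zr : forall x, Cmod (Z x) = fst (proj1_sig x))
    by (intros [p Hp]; apply Cmod_cover, Hp).
  assert (Z0 : forall x, Z x <> RtoC 0).
  { intros [p Hp]; apply Cmod_gt_0; rewrite Zr; apply Hp. }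
  assert (Zs : forall eps, 0 < eps -> exists x, Cmod (Z x) < eps).
  { intros eps He.
    assert (Hx : 0 < Rmin eps r / 2 < r).
    { pose proof (Rmin_pos eps r He hr); pose proof (Rmin_r eps r); lra. }
    exists (exist _ _ (axis_in_sector gamma r hgamma _ Hx)); rewrite Zr; simpl.
    pose proof (Rmin_l eps r); lra. }
  assert (Zb : forall x, Cmod (Z x) <= r).
  { intros x; rewrite Zr; destruct x as [p Hp]; simpl; destruct Hp; lra. }
  assert (aW : forall i, (1 <= i <= d)%nat -> exists b,
     has_weighted_expansion M Z everywhere (fun x => a i (proj1_sig x)) b).
  { intros i Hi; destruct (ha i Hi) as [Hinf [K [s [HK [Hs HB]]]]].
    destruct (A_infty_chain gamma r (a i) Hinf) as [g [g0 [gc [gn _]]]].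
    destruct (sector_expansion gamma r (a i) g (fun n => K * s ^ n * INR (fact n) * M n)
      hgamma hr g0 gc (fun j p Hp => HB j (g j) (gn j) p Hp)) as [b Hb].
    exists b, K, s; split; [exact HK|split; [exact Hs|]].
    eapply expansion_le; [|exact Hb].
    intros n; right; unfold geometric; field; apply not_0_INR, fact_neq_0. }
  apply choice in Gb; destruct Gb as [B HB].
  destruct (sector_expansion gamma r h G B hgamma hr G0 Gc HB) as [c Hc].
  assert (Root : has_weighted_expansion M Z everywhere (fun x => h (proj1_sig x)) c).
  { apply (root_weighted_expansion M A W Z r Z0 Zs Zb d (fun i x => a i (proj1_sig x))).
    - exact aW.
    - eexists; exact Hc.
    - intros [p Hp]; simpl; rewrite taylor2_eval; apply (hroot p Hp).
    - exact hd. }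
  destruct Root as [K [s [HK [Hs Hexp]]]].
  split.
  - split.
    + intros p Hp; apply hh, Sub, Hp.
    + intros j; exists (G j); split.
      * apply (is_derive_n_on_restrict (sector gamma r)); [exact Sub|apply Gn].
      * exists (B j); intros p Hp; apply HB, Sub, Hp.
  - set (eps := Rmin (/ 2) (Rmin ((r - r') / r') ((gamma - gamma') * (PI / 4)))).
    assert (He : 0 < eps).
    { apply Rmin_pos; [lra|apply Rmin_pos]; [apply Rdiv_lt_0_compat; lra|].
      apply Rmult_lt_0_compat; lra. }
    exists K, (s * (4 / eps)); split; [exact HK|split].
    { apply Rmult_lt_0_compat; [exact Hs|apply Rdiv_lt_0_compat; lra]. }
    intros j g Hg p Hp.
    replace (g p) with (G j p).
    2:{ apply (is_derive_n_on_unique gamma' r' h j (G j) g); [|exact Hg|exact Hp].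
        apply (is_derive_n_on_restrict (sector gamma r)); [exact Sub|apply Gn]. }
    eapply Rle_trans.
    + apply (sector_cauchy gamma r gamma' r' G c j (geometric M K s j) hgamma' hr' Gc).
      * exists (B (S (S j))); apply HB.
      * left; apply (geometric_pos M A W); assumption.
      * intros q Hq; destruct (Hexp j) as [_ H].
        specialize (H (exist _ q Hq) I); rewrite Zr in H; simpl in H.
        rewrite G0 by exact Hq; exact H.
      * exact Hp.
    + fold eps; right; unfold geometric; rewrite Rpow_mult_distr; ring.
Qed.
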